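(* There exists a $C^\infty$-smooth flow $\varphi$ on an annulus such that $\varphi$ has a global physical and natural measure $\mu_{\varphi}$, its square $\Phi=\varphi\times\varphi$ also has a global physical and natural measure $\mu_\Phi$, but <br> (1) $\mu_\Phi \neq \mu_{\varphi} \times \mu_{\varphi}$; <br> (2) $A_{min}(\Phi) \subsetneqq A_{min}(\varphi) \times A_{min}(\varphi)$.
   Context: The annulus is the compact cylinder $S^1\times[-1,1]$ with its Lebesgue probability measure. Let $\varphi$ be a flow on a compact manifold $X$ (possibly with boundary) with Lebesgue probability measure $\mu$. Physical measure: a probability measure $\nu$ on $X$ is physical if there is a set $B$ with $\mu(B)>0$ (its basin) such that for every $x\in B$ and every continuous $f\colon X\to\mathbb R$, $\lim_{T\to+\infty}\frac1T\int_0^T f(\varphi^t(x))\,dt=\int_X f\,d\nu$. It is global if its basin has full measure $\mu$. Natural measure: $\nu$ is natural if there is an open $U\subset X$ such that for every probability measure $\tilde\mu$ absolutely continuous with respect to $\mu$ with $\mathrm{supp}(\tilde\mu)\subset U$ the measures $\frac1T\int_0^T\varphi^t_*\tilde\mu\,dt$ converge weak-$*$ to $\nu$ as $T\to+\infty$. It is global if this holds with $U=X$. Minimal attractor: an open set $U\subset X$ is minimally inessential if the functions $x\mapsto\frac1T\int_0^T I_U(\varphi^t(x))\,dt$ ($I_U$ the indicator function of $U$) converge to $0$ in measure $\mu$ as $T\to+\infty$. The minimal attractor $A_{min}(\varphi)$ is the complement of the union of all minimally inessential open sets. The square is $\Phi^t(x,y)=(\varphi^t(x),\varphi^t(y))$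 on $X\times X$, considered with $\mu\times\mu$. *)

(* Defs.v *)
Set Warnings "-notation-overridden,-ambiguous-paths".
From HB Require Import structures.
From mathcomp Require Import all_boot all_order all_algebra.
From mathcomp Require Import all_classical all_reals all_analysis.
From mathcomp Require Import measurable_realfun.

Set Implicit Arguments.
Unset Strict Implicit.
Unset Printing Implicit Defensive.
Import Order.TTheory GRing.Theory Num.Theory.
Import numFieldNormedType.Exports.
Local Open Scope classical_set_scope.
Local Open Scope ring_scope.

(** No compatibility between the two structures is required; the instances used
    below are Borel. *)
#[short(type="topMeasurableType")]
HB.structure Definition TopMeasurable d :=
  {X of Topological X & Measurable d X}.

HB.instance Definition _ (d1 d2 : measure_display)
    (X : topMeasurableType d1) (Y : topMeasurableType d2) :=
  Measurable.on (X * Y)%type.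

Definition square {R : realType} {X : Type} (phi : R -> X -> X)
    (t : R) (p : X * X) : X * X :=
  (phi t p.1, phi t p.2).

Definition time_average {R : realType} {X : Type} (phi : R -> X -> X)
    (T : R) (f : X -> R) (x : X) : R :=
  T^-1 * \int[lebesgue_measure]_(t in `[0, T]) f (phi t x).

Definition attracted {R : realType} {d : measure_display}
    {X : topMeasurableType d} (phi : R -> X -> X) (nu : probability X R)
    (x : X) : Prop :=
  forall f : X -> R, continuous f ->
    time_average phi T f x @[T --> +oo] --> \int[nu]_y f y.

Definition physical_with_basin {R : realType} {d : measure_display}
    {X : topMeasurableType d} (mu : probability X R) (phi : R -> X -> X)
    (nu : probability X R) (B : set X) : Prop :=
  [/\ measurable B, (0 < mu B)%E & forall x, B x -> attracted phi nu x].

Definition global_physical {R : realType} {d : measure_display}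
    {X : topMeasurableType d} (mu : probability X R) (phi : R -> X -> X)
    (nu : probability X R) : Prop :=
  exists B : set X, physical_with_basin mu phi nu B /\ mu B = 1%E.

Definition msupport {R : realType} {d : measure_display}
    {X : topMeasurableType d} (m : probability X R) : set X :=
  [set x | forall U : set X, open U -> U x -> (0 < m U)%E].

(** [1/T \int_0^T phi^t_* m dt] as a set function: it is only a measure when
    [phi] is jointly measurable, which is not assumed here. *)
Definition averaged_measure {R : realType} {d : measure_display}
    {X : topMeasurableType d} (phi : R -> X -> X) (m : probability X R)
    (T : R) : set X -> \bar R :=
  fun E => ((T^-1)%:E *
    \int[lebesgue_measure]_(t in `[0%R, T]) pushforward m (phi t) E)%E.

Definition weak_star_cvg {R : realType} {d : measure_display}
    {X : topMeasurableType d} (m : R -> set X -> \bar R)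
    (nu : probability X R) : Prop :=
  forall f : X -> R, continuous f ->
    (\int[m T]_x (f x)%:E)%E @[T --> +oo] --> (\int[nu]_x (f x)%:E)%E.

Definition natural_on {R : realType} {d : measure_display}
    {X : topMeasurableType d} (mu : probability X R) (phi : R -> X -> X)
    (nu : probability X R) (U : set X) : Prop :=
  open U /\
  forall m : probability X R, m `<< mu -> msupport m `<=` U ->
    weak_star_cvg (averaged_measure phi m) nu.

Definition global_natural {R : realType} {d : measure_display}
    {X : topMeasurableType d} (mu : probability X R) (phi : R -> X -> X)
    (nu : probability X R) : Prop :=
  natural_on mu phi nu setT.

(** Convergence to [0] in measure of the proportion of time spent in [U]. *)
Definition minimally_inessential {R : realType} {d : measure_display}
    {X : topMeasurableType d} (mu : probability X R) (phi : R -> X -> X)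
    (U : set X) : Prop :=
  forall eps : R, 0 < eps ->
    mu [set x | eps <= `|time_average phi T \1_U x|] @[T --> +oo] --> 0%E.

Definition Amin {R : realType} {d : measure_display}
    {X : topMeasurableType d} (mu : probability X R) (phi : R -> X -> X) :
    set X :=
  ~` \bigcup_(U in [set U | open U /\ minimally_inessential mu phi U]) U.

(** The cylinder [S^1 x [-1, 1]], with [S^1] the unit circle of [R^2]. *)
Definition annulus_set (R : realType) : set (R * R * R) :=
  [set p | p.1.1 ^+ 2 + p.1.2 ^+ 2 = 1 /\ -1 <= p.2 <= 1].

Arguments annulus_set R : clear implicits.

Definition annulus (R : realType) : Type := set_type (annulus_set R).

Definition annulus_val {R : realType} : annulus R -> R * R * R := set_val.

(** [(s, y)] is sent to the point of angle [2 pi s] and height [y]; the height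
    is truncated to [[-1, 1]] only to make the map total. *)
Definition annulus_coord {R : realType} (p : R * R) : R * R * R :=
  (cos (2 * pi * p.1), sin (2 * pi * p.1), Num.max (-1) (Num.min 1 p.2)).

Lemma annulus_coordP {R : realType} (p : R * R) :
  annulus_coord p \in annulus_set R.
Proof.
rewrite inE; split => /=; first exact: cos2Dsin2.
by rewrite le_max lexx/= ge_max ge_min lexx/= andbT (le_trans (lerN10 _)).
Qed.

Definition annulus_param {R : realType}
    (p : measurableTypeR R * measurableTypeR R) : annulus R :=
  exist _ (annulus_coord p) (annulus_coordP p).

HB.instance Definition _ (R : realType) :=
  Topological.copy (annulus R) (set_type (annulus_set R)).
HB.instance Definition _ (R : realType) :=
  isPointed.Build (annulus R) (@annulus_param R (0 : R, 0 : R)).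

(** The trace of the Borel sigma-algebra of [R^3], i.e., the Borel
    sigma-algebra of the annulus. Since the annulus is second countable, the
    product sigma-algebra on its square is again the Borel one. *)
HB.instance Definition _ (R : realType) :=
  Measurable.copy (annulus R)
    (g_sigma_algebra_preimageType (@annulus_val R)).

Lemma measurable_annulus_param (R : realType) :
  measurable_fun setT (@annulus_param R).
Proof.
have mc : measurable_fun setT
    (@annulus_coord R : measurableTypeR R * measurableTypeR R -> _).
  have m1 : measurable_fun setT
      (fun p : measurableTypeR R * measurableTypeR R => p.1 : R).
    exact: measurable_fst.
  have m2 : measurable_fun setT
      (fun p : measurableTypeR R * measurableTypeR R => p.2 : R).
    exact: measurable_snd.
  have m3 : measurable_fun setT
      (fun p : measurableTypeR R * measurableTypeR R => 2 * pi * p.1 : R).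
    exact: measurable_funM.
  apply: measurable_fun_pair; first apply: measurable_fun_pair.
  - apply: (measurableT_comp (f := @cos R)) m3.
    by apply: continuous_measurable_fun; exact: continuous_cos.
  - apply: (measurableT_comp (f := @sin R)) m3.
    by apply: continuous_measurable_fun; exact: continuous_sin.
  - by apply: measurable_maxr => //; apply: measurable_minr.
move=> _ _ [B mB <-]; rewrite !setTI.
by rewrite -[X in measurable X]setTI; exact: mc.
Qed.

HB.instance Definition _ (R : realType) :=
  isMeasurableFun.Build _ _ _ _ (@annulus_param R)
    (@measurable_annulus_param R).

Lemma ltrN11 (R : realType) : -1 < 1 :> R.
Proof. exact: lt_trans (ltrN10 R) ltr01. Qed.

(** The image of [ds dy / 2] on [[0, 1] x [-1, 1]], i.e., normalized Lebesgue
    measure. *)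
Definition annulus_measure (R : realType) : probability (annulus R) R :=
  distribution
    (uniform_prob (@ltr01 R) \x uniform_prob (ltrN11 R))%E
    (@annulus_param R).

Definition annulus2_measure (R : realType) :
    probability (annulus R * annulus R)%type R :=
  (annulus_measure R \x annulus_measure R)%E.

(** [h] is of class [C^k] on the open set [U] of the finite-dimensional
    space [V]. *)
Fixpoint class_C {R : realType} {V W : normedModType R} (k : nat)
    (U : set V) (h : V -> W) : Prop :=
  match k with
  | 0 => forall x, U x -> {for x, continuous h}
  | k'.+1 => (forall x, U x -> differentiable h x) /\
             forall v : V, class_C k' U ('D_v h)
  end.

(** A map defined on a subset of a Euclidean space, here
    [R x annulus] in [R x R^3], is smooth if it extends, near each point of
    the subset, to a [C^oo] map defined on an open subset of the Euclidean
    space. *)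
Definition smooth_map {R : realType} (phi : R -> annulus R -> annulus R) :
    Prop :=
  forall (t0 : R) (x0 : annulus R),
  exists (U : set (R * (R * R * R))) (h : R * (R * R * R) -> R * R * R),
    [/\ open U, U (t0, annulus_val x0),
        forall k : nat, class_C k U h &
        forall t x, U (t, annulus_val x) ->
          h (t, annulus_val x) = annulus_val (phi t x)].

Definition smooth_flow {R : realType} (phi : R -> annulus R -> annulus R) :
    Prop :=
  [/\ forall x, phi 0 x = x,
      forall s t x, phi (s + t) x = phi s (phi t x) &
      smooth_map phi].

(* Main.v *)
Require Import Defs.
From HB Require Import structures.
From mathcomp Require Import all_boot all_order all_algebra.
From mathcomp Require Import all_classical all_reals all_analysis.
From mathcomp Require Import measurable_realfun ring lra.
Set Implicit Arguments.
Unset Strict Implicit.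
Unset Printing Implicit Defensive.
Import Order.TTheory GRing.Theory Num.Theory.
Import numFieldNormedType.Exports.
Local Open Scope classical_set_scope.
Local Open Scope ring_scope.

(** The flow is driven by a clock on the circle of the cylinder of points
    [(a, b, y)]. In the stereographic coordinate [u = b / (1 - a)], which sends
    the line [a = 1] to infinity, the clock is the translation flow of [sinh u].
    From any start [u] it reads [ln (2 t) + O(1 / t)] at time [t]; in
    particular its square differs from [phase t = ln (2 t) ^ 2] by a quantity
    that tends to [0], so that all clocks eventually show the same phase.
    Meanwhile the height [y] is moved along the segment [[-1, 1]] by the Moebius
    transformation that multiplies [(1 + y) / (1 - y)] by
    [exp (swing u' - swing u)], where [u'] is the new reading of the clock and
    [swing u = u * sin (u ^ 2)]. The exponent being a coboundary, this is a
    flow; the points of the line [a = 1] are fixed.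

    An orbit that starts off the line and off the two boundary circles converges
    to the line. It is close to the upper end of the line at the times when
    [sin (phase t)] is bounded away from [0] from above, and close to the lower
    end when it is so from below. As the phase does not depend on the orbit, two
    orbits are at the upper end together and at the lower end together: the
    square of the flow shows the same behaviour, with the two points
    [(up, up)] and [(down, down)]. These two facts are [flow_switching] and
    [switching_orbit_pair].

    Time averages. The derivative of the phase tends to [0], but so slowly that
    the phase is equidistributed modulo [2 pi] for the uniform average over
    [[0, T]] ([weyl_phase]). Hence a continuous observable has time averages that
    converge to the half sum of its values at the two ends
    ([switching_average]). This is all that the rest needs, so it is done once
    for a flow almost all of whose orbits switch between two points [p] and [q]
    (section [SwitchingSystem]): the half sum of the Dirac masses at [p] and [q]
    is a global physical measure; it is a global natural measure by Fubini's
    theorem and dominated convergence; and the minimal attractor is [{p, q}] by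
    Markov's inequality. For the flow this gives [{up, down}], for its square
    the two diagonal pairs, which miss half of the product and carry a measure
    that gives no mass to the open set of the pairs with a first point of
    positive height and a second one of negative height, to which the product
    measure gives mass [1 / 4].

    Smoothness is an issue at the line [a = 1] only. There the coordinate
    [v = 1 / u] of the circle is regular, and the clock changes [u] by an amount
    of order [exp (- 1 / |v|)], which is flat at [v = 0], whereas [u], [sin (u ^ 2)]
    and all their derivatives are at most polynomial in [1 / v]. Products of such
    tempered functions with flat ones are flat, and so are the images of flat
    functions under smooth functions that vanish at [0]. Flat functions
    extend smoothly by zero ([Flat_smooth]), so the increments of [u] and of
    [swing u] are smooth across the line ([Flat_clock_shift],
    [Flat_swing_shift]), and the flow is smooth. *)

(** * Smoothness classes are local *)

Section Germs.
Context {R : realType} {V W : normedModType R}.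
Implicit Types (f g : V -> W) (U : set V).

Lemma near_eq_differentiable f g (x : V) :
  {near x, f =1 g} -> differentiable f x -> differentiable g x.
Proof.
move=> fg /diff_locallyP[cf fE].
have fgx : f x = g x by exact: nbhs_singleton fg.
have E : g \o shift x = cst (g x) + 'd f x +o_ 0 id.
  apply/eqaddoP => _/posnumP[e].
  have : f \o shift x - (cst (f x) + 'd f x) =o_ (0:V) id.
    by rewrite fE addrC addKr.
  move=> /eqoP /(_ e%:num (gt0 e)) H.
  have fg0 : \forall h \near (0:V), f (h + x) = g (h + x).
    move: fg; rewrite (near_shift 0 x) /= => fg.
    by apply: filterS fg => h /=; rewrite subr0.
  near=> h.
  rewrite !fctE /= -fgx -(near fg0 h) //.
  by near: h.
apply/diff_locallyP; split.
  by have -> : 'd g x = 'd f x :> (V -> W) by exact: diff_unique.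
by have -> : 'd g x = 'd f x :> (V -> W) by exact: diff_unique.
Unshelve. all: by end_near. Qed.

Lemma open_eq_differentiable U f g x : open U -> {in U, f =1 g} -> U x ->
  differentiable f x -> differentiable g x.
Proof.
move=> oU fg Ux; apply: near_eq_differentiable.
by near=> y; apply: fg; rewrite inE; near: y; exact: open_nbhs_nbhs.
Unshelve. all: by end_near. Qed.

Lemma open_eq_derive U f g x v : open U -> {in U, f =1 g} -> U x ->
  'D_v f x = 'D_v g x.
Proof.
move=> oU fg Ux; apply: near_eq_derive.
by near=> y; apply: fg; rewrite inE; near: y; exact: open_nbhs_nbhs.
Unshelve. all: by end_near. Qed.

Lemma class_C_ext U k f g : open U -> {in U, f =1 g} ->
  class_C k U f -> class_C k U g.
Proof.
move=> oU; elim: k f g => [|k IH] f g fg.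
  move=> cf x Ux; rewrite /prop_for /continuous_at -(fg x) ?inE//.
  apply: cvg_trans (cf x Ux); apply: near_eq_cvg.
  by near=> y; apply: fg; rewrite inE; near: y; exact: open_nbhs_nbhs.
move=> [df Hf]; split=> [x Ux|v].
  by apply: open_eq_differentiable (df x Ux); [exact: oU|exact: fg|].
apply: IH (Hf v) => x; rewrite inE => Ux.
by apply: open_eq_derive Ux; [exact: oU|exact: fg].
Unshelve. all: by end_near. Qed.

End Germs.

(** * Towers of conditions on iterated derivatives *)

Section Tower.
Context {R : realType} {V : normedModType R}.
Implicit Types (f g : V -> R) (U : set V) (P Q S : (V -> R) -> Prop).

(** The shape of [class_C], with an arbitrary condition [P] on the iterated
    derivatives in place of continuity; growth conditions near a singular set
    are the other case of interest. *)
Fixpoint tower P U (k : nat) f : Prop :=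
  P f /\ match k with
         | 0 => True
         | k'.+1 => (forall x, U x -> differentiable f x) /\
                    forall v, tower P U k' ('D_v f)
         end.

Definition local_on U P := forall f g, {in U, f =1 g} -> P f -> P g.

Definition stableD P := forall f g, P f -> P g -> P (fun x => f x + g x).

Definition stableM P Q S := forall f g, P f -> Q g -> S (fun x => f x * g x).

Lemma tower_base P U k f : tower P U k f -> P f.
Proof. by case: k => [|k] []. Qed.

Lemma tower_sub P Q U k f : (forall g, P g -> Q g) ->
  tower P U k f -> tower Q U k f.
Proof.
move=> PQ; elim: k f => [|k IH] f [Pf H]; split=> //; try exact: PQ.
by case: H => df Hv; split=> // v; exact/IH/Hv.
Qed.

Lemma tower_pred P U k f : tower P U k.+1 f -> tower P U k f.
Proof.
elim: k f => [|k IH] f [Pf [df Hv]]; split=> //.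
by split=> // v; exact/IH/Hv.
Qed.

Lemma tower_ext P U k f g : open U -> local_on U P -> {in U, f =1 g} ->
  tower P U k f -> tower P U k g.
Proof.
move=> oU lP; elim: k f g => [|k IH] f g fg [Pf H]; split=> //; try exact: lP Pf.
case: H => df Hv; split=> [x Ux|v].
  by apply: open_eq_differentiable (df x Ux); [exact: oU|exact: fg|].
apply: IH (Hv v) => x; rewrite inE => Ux.
by apply: open_eq_derive Ux; [exact: oU|exact: fg].
Qed.

Lemma tower_add P U k f g : open U -> local_on U P -> stableD P ->
  tower P U k f -> tower P U k g -> tower P U k (fun x => f x + g x).
Proof.
move=> oU lP aP; elim: k f g => [|k IH] f g [Pf Hf] [Pg Hg].
  by split=> //; exact: aP.
case: Hf => df Hf; case: Hg => dg Hg; split; first exact: aP.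
split=> [x Ux|v]; first by apply: differentiableD; [exact: df|exact: dg].
apply: (tower_ext (f := fun x => 'D_v f x + 'D_v g x)) => //; last first.
  by apply: IH; [exact: Hf|exact: Hg].
move=> x; rewrite inE => Ux; rewrite -deriveD //.
  exact/diff_derivable/df.
exact/diff_derivable/dg.
Qed.

(** The Leibniz rule, by induction on the order. The conditions on the two
    factors differ because a tempered function times a flat one is flat. *)
Lemma tower_mul P Q S U k f g : open U -> local_on U S -> stableD S ->
  stableM P Q S ->
  tower P U k f -> tower Q U k g -> tower S U k (fun x => f x * g x).
Proof.
move=> oU lS aS mS; elim: k f g => [|k IH] f g Hf Hg.
  by split=> //; apply: mS; [exact: tower_base Hf|exact: tower_base Hg].
have [Pf [df Hfv]] := Hf; have [Qg [dg Hgv]] := Hg.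
split; first exact: mS.
split=> [x Ux|v]; first by apply: differentiableM; [exact: df|exact: dg].
apply: (tower_ext (f := fun x => f x * 'D_v g x + 'D_v f x * g x)) => //.
  move=> x; rewrite inE => Ux.
  rewrite [RHS](@deriveM _ _ f g).
  - by congr (_ + _); rewrite mulrC.
  - exact/diff_derivable/df.
  - exact/diff_derivable/dg.
by apply: tower_add => //; apply: IH;
  [exact: tower_pred|exact: Hgv|exact: Hfv|exact: tower_pred].
Qed.

(** Iterated derivatives are exhibited as a sequence, since a bound on the
    composite below concerns all of them at once. *)
Definition derivatives_on (O : set R) (G : nat -> R -> R) :=
  forall i x, O x -> is_derive x (1 : R) (G i) (G i.+1 x).

Lemma differentiable_comp1 (G dG : R -> R) f x v :
  differentiable f x -> is_derive (f x) (1 : R) G (dG (f x)) ->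
  differentiable (G \o f) x /\ 'D_v (G \o f) x = dG (f x) * 'D_v f x.
Proof.
move=> df dG'; have /derivable1_diffP dGx : derivable G (f x) 1 by case: dG'.
split; first exact: differentiable_comp.
rewrite deriveE; last exact: differentiable_comp.
rewrite diff_comp //= deriv1E; last exact/derivable1_diffP.
by rewrite derive1E derive_val [LHS]mulrC deriveE.
Qed.

(** One statement serves ordinary smoothness, tempered growth and flatness:
    only the bound [Q0] on the composite itself may be finer than the bound [Q]
    on the composites with the derivatives. *)
Lemma tower_comp P Q Q0 U (O : set R) (G : nat -> R -> R) k f :
  open U -> local_on U Q -> local_on U Q0 -> stableD Q -> stableD Q0 ->
  stableM Q P Q -> stableM Q P Q0 ->
  derivatives_on O G -> (forall x, U x -> O (f x)) ->
  (forall g, Q0 g -> Q g) ->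
  (forall i, Q (G i \o f)) -> Q0 (G 0 \o f) ->
  tower P U k f -> tower Q0 U k (G 0 \o f).
Proof.
move=> oU lQ lQ0 aQ aQ0 mQ mQ0 dG fO Q0Q HQ HQ0.
have step k' : tower P U k'.+1 f -> (forall i, tower Q U k' (G i \o f)) ->
    forall i v, tower Q0 U k' ('D_v (G i \o f)).
  move=> [Pf [df Hfv]] IH i v.
  apply: (tower_ext (f := fun x => (G i.+1 \o f) x * 'D_v f x)) => //.
    move=> x; rewrite inE => Ux; have [||_ ->//] :=
      @differentiable_comp1 (G i) (G i.+1) f x v.
    - exact: df.
    - exact/dG/fO.
  by apply: (tower_mul (P := Q) (Q := P)) => //; exact: Hfv.
have dc : forall x, U x -> differentiable f x ->
    forall i, differentiable (G i \o f) x.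
  by move=> x Ux df i; have [||+ _] :=
    @differentiable_comp1 (G i) (G i.+1) f x 0; [|exact/dG/fO|].
have HQk : forall k', tower P U k' f -> forall i, tower Q U k' (G i \o f).
  elim=> [|k' IH] Hf i; first by split.
  split; first exact: HQ.
  split=> [x Ux|v]; first by apply: dc => //; case: Hf => _ [+ _]; exact.
  apply: tower_sub; first exact: Q0Q.
  by apply: step => // j; apply: IH; exact: tower_pred.
case: k => [|k] Hf; first by split.
split=> //; split=> [x Ux|v].
  by apply: dc => //; case: Hf => _ [+ _]; exact.
by apply: step => // j; apply: HQk; exact: tower_pred.
Qed.

Definition cont_on U f := forall x, U x -> {for x, continuous f}.

Lemma cont_on_local U : open U -> local_on U (cont_on U).
Proof.
move=> oU f g fg cf x Ux; rewrite /prop_for /continuous_at -(fg x) ?inE//.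
apply: cvg_trans (cf x Ux); apply: near_eq_cvg.
by near=> y; apply: fg; rewrite inE; near: y; exact: open_nbhs_nbhs.
Unshelve. all: by end_near. Qed.

Lemma cont_onD U : stableD (cont_on U).
Proof. by move=> f g cf cg x Ux; apply: cvgD; [exact: cf|exact: cg]. Qed.

Lemma cont_onM U : stableM (cont_on U) (cont_on U) (cont_on U).
Proof. by move=> f g cf cg x Ux; apply: cvgM; [exact: cf|exact: cg]. Qed.

Lemma class_C_tower U k f : class_C k U f <-> tower (cont_on U) U k f.
Proof.
elim: k f => [|k IH] f; first by split=> [?|[]].
split=> [[df Hv]|[_ [df Hv]]]; split=> //.
- by move=> x /df; exact: differentiable_continuous.
- by split=> // v; exact/IH/Hv.
- by move=> v; exact/IH/Hv.
Qed.

Definition smooth_on U f := forall k, class_C k U f.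

Lemma smooth_onP U f : smooth_on U f <-> forall k, tower (cont_on U) U k f.
Proof. by split=> H k; apply/class_C_tower. Qed.

Variable U : set V.
Hypothesis oU : open U.

Lemma smooth_on_ext f g : {in U, f =1 g} -> smooth_on U f -> smooth_on U g.
Proof.
move=> fg /smooth_onP H; apply/smooth_onP => k.
by apply: tower_ext (H k) => //; exact: cont_on_local.
Qed.

Lemma smooth_onD f g :
  smooth_on U f -> smooth_on U g -> smooth_on U (fun x => f x + g x).
Proof.
move=> /smooth_onP Hf /smooth_onP Hg; apply/smooth_onP => k.
by apply: tower_add => //; [exact: cont_on_local|exact: cont_onD].
Qed.

Lemma smooth_onM f g :
  smooth_on U f -> smooth_on U g -> smooth_on U (fun x => f x * g x).
Proof.
move=> /smooth_onP Hf /smooth_onP Hg; apply/smooth_onP => k.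
apply: (tower_mul (P := cont_on U) (Q := cont_on U)) => //.
- exact: cont_on_local.
- exact: cont_onD.
- exact: cont_onM.
Qed.

Lemma smooth_on_comp (O : set R) (G : nat -> R -> R) f :
  derivatives_on O G -> (forall x, U x -> O (f x)) ->
  smooth_on U f -> smooth_on U (fun x => G 0 (f x)).
Proof.
move=> dG fO /smooth_onP Hf; apply/smooth_onP => k.
have HC i : cont_on U (G i \o f).
  move=> x Ux; apply: continuous_comp.
    by have /tower_base := Hf 0; exact.
  apply: differentiable_continuous; apply/derivable1_diffP.
  by have := dG i _ (fO x Ux); case.
apply: (tower_comp (P := cont_on U) (Q := cont_on U) (O := O)) => //.
- exact: cont_on_local.
- exact: cont_on_local.
- exact: cont_onD.
- exact: cont_onD.
- exact: cont_onM.
- exact: cont_onM.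
Qed.

Lemma smooth_on_cst (c : R) : smooth_on U (fun=> c).
Proof.
move=> k; elim: k c => [|k IH] c.
  by move=> x _; exact: cvg_cst.
split=> [x _|v]; first exact: differentiable_cst.
rewrite (_ : 'D_v _ = fun=> 0); first exact: IH.
by apply/funext => x; rewrite derive_cst.
Qed.

Lemma smooth_on_linear (f : {linear V -> R}) : continuous f -> smooth_on U f.
Proof.
move=> cf [|k]; first by move=> x _; exact: cf.
split=> [x _|v]; first exact: linear_differentiable.
rewrite (_ : 'D_v _ = fun=> f v); first exact: smooth_on_cst.
apply/funext => x; rewrite deriveE; last exact: linear_differentiable.
by rewrite diff_lin.
Qed.

Lemma smooth_on_sub (U' : set V) f : U' `<=` U -> smooth_on U f -> smooth_on U' f.
Proof.
move=> UU Hf k; move: (Hf k) => {Hf}; elim: k f => [|k IH] f.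
  by move=> cf x /UU; exact: cf.
by move=> [df Hv]; split=> [x /UU /df//|v]; exact/IH/Hv.
Qed.

Lemma smooth_on_cont f : smooth_on U f -> cont_on U f.
Proof. by move=> /(_ 0). Qed.

Lemma open_nonzero f : cont_on U f -> open (U `&` [set z | f z != 0]).
Proof.
move=> cf; rewrite openE => z [Uz sz].
apply: filterI; first exact: open_nbhs_nbhs.
suff : nbhs (f z) [set x : R | x != 0] by move=> /(cf z Uz).
by apply: open_nbhs_nbhs; split=> //; exact: open_neq.
Qed.

End Tower.

Section PairSmooth.
Context {R : realType} {V W1 W2 : normedModType R}.

Lemma class_C_pair (U : set V) k (f : V -> W1) (g : V -> W2) : open U ->
  class_C k U f -> class_C k U g -> class_C k U (fun x => (f x, g x)).
Proof.
move=> oU; elim: k f g => [|k IH] f g.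
  by move=> cf cg x Ux; apply: cvg_pair; [exact: cf|exact: cg].
move=> [df Hf] [dg Hg].
split=> [x Ux|v]; first by apply: differentiable_pair; [exact: df|exact: dg].
apply: (class_C_ext (f := fun x => ('D_v f x, 'D_v g x))) => //; last first.
  by apply: IH; [exact: Hf|exact: Hg].
move=> x; rewrite inE => Ux; rewrite !deriveE.
- by rewrite diff_pair //; [exact: df|exact: dg].
- by apply: differentiable_pair; [exact: df|exact: dg].
- exact: dg.
- exact: df.
Qed.

End PairSmooth.

(** * Successive derivatives of elementary functions *)

Section DerivativeSequences.
Context {R : realType}.

Lemma derivatives_expR : derivatives_on setT (fun _ : nat => @expR R).
Proof. by move=> i x _; exact: is_derive_expR. Qed.

Definition sin_derivs (i : nat) (x : R) := sin (x + i%:R * (pi / 2)).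

Lemma derivatives_sin : derivatives_on setT sin_derivs.
Proof.
move=> i x _; rewrite /sin_derivs.
have -> : x + i.+1%:R * (pi / 2) = x + i%:R * (pi / 2) + pi / 2.
  by rewrite -natr1; ring.
rewrite sinDpihalf.
by apply: is_derive_eq; rewrite ?scaler0 ?addr0 ?scaler1 // mulr1.
Qed.

Lemma derivatives_cos : derivatives_on setT (fun i => sin_derivs i.+1).
Proof. by move=> i; exact: derivatives_sin. Qed.

Lemma sin_derivs0 x : sin_derivs 0 x = sin x.
Proof. by rewrite /sin_derivs mul0r addr0. Qed.

Lemma sin_derivs1 x : sin_derivs 1 x = cos x.
Proof. by rewrite /sin_derivs mul1r sinDpihalf. Qed.

Definition inv_derivs (i : nat) (x : R) := (-1) ^+ i * i`!%:R * (x ^+ i.+1)^-1.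

Lemma derivatives_inv : derivatives_on [set x : R | x != 0] inv_derivs.
Proof.
move=> i x /= x0.
have xi0 : x ^+ i.+1 != 0 by rewrite expf_neq0.
rewrite /inv_derivs.
have Dx : is_derive x (1 : R) (fun y => y ^+ i.+1) (i.+1%:R * x ^+ i).
  apply: DeriveDef; first exact: exprn_derivable.
  by rewrite exp_derive /GRing.scale /= mulr1.
have DV := @is_deriveV _ (fun y : R => y ^+ i.+1) x _ _ xi0 Dx.
have := is_deriveZ ((-1) ^+ i * i`!%:R) DV.
move/is_derive_eq; apply.
rewrite /GRing.scale /= factS natrM !exprS.
by field; rewrite x0 expf_neq0.
Qed.

Definition ln_derivs (i : nat) := if i is j.+1 then inv_derivs j else @ln R.

Lemma derivatives_ln : derivatives_on [set x : R | 0 < x] ln_derivs.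
Proof.
move=> [|i] x /= x0; last by apply: derivatives_inv; rewrite /= gt_eqF.
by rewrite /inv_derivs expr0 fact0 !mul1r; exact: is_derive1_ln.
Qed.

End DerivativeSequences.

Lemma lipschitz_at0 {R : realType} (G : R -> R) (l : R) :
  is_derive (0 : R) (1 : R) G l -> G 0 = 0 ->
  exists2 e : R, 0 < e & forall x, `|x| < e -> `|G x| <= (`|l| + 1) * `|x|.
Proof.
move=> [dG lE] G0.
have : (fun h : R => h^-1 *: ((G \o shift 0) (h *: (1 : R)) - G 0)) @ 0^' --> l.
  by rewrite -lE; exact: dG.
move/cvgrPdist_lt => /(_ _ ltr01) [/= e e0 He]; exists e => // x xe.
have [->|x0] := eqVneq x 0; first by rewrite G0 !normr0 mulr0.
have := He x; rewrite /= sub0r normrN => /(_ xe x0).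
rewrite G0 subr0 addr0 /GRing.scale /= mulr1 => /ltW Hx.
rewrite -ler_pdivrMr ?normr_gt0// -normf_div mulrC -[X in `|X|](subrK l) addrC.
by rewrite (le_trans (ler_normD _ _))// lerD2l distrC.
Qed.

(** * Flat and tempered functions *)

Section Flat.
Context {R : realType} {V : normedModType R}.
Variables (U : set V) (sing : V -> R).
Hypotheses (oU : open U) (csing : cont_on U sing).
Implicit Types f g : V -> R.

Let U0 : set V := U `&` [set z | sing z != 0].

Definition tempered f := forall z, U z -> sing z = 0 ->
  exists n C, \forall y \near z, sing y != 0 -> `|sing y| ^+ n * `|f y| <= C.

Definition flat f := forall z, U z -> sing z = 0 ->
  forall n, exists C, \forall y \near z,
    sing y != 0 -> `|f y| <= C * `|sing y| ^+ n.

Lemma open_off_sing : open U0.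
Proof. exact: open_nonzero. Qed.

Lemma near_eq_off_sing f g z : {in U0, f =1 g} -> U z ->
  \forall y \near z, sing y != 0 -> f y = g y.
Proof.
move=> fg Uz; near=> y => sy; apply: fg; rewrite inE; split=> //.
by near: y; exact: open_nbhs_nbhs.
Unshelve. all: by end_near. Qed.

Lemma near_sing_small z (e : R) : 0 < e -> U z -> sing z = 0 ->
  \forall y \near z, `|sing y| < e.
Proof.
move=> e0 Uz sz; have /cvgrPdist_lt/(_ _ e0) := csing Uz.
by apply: filterS => y; rewrite sz sub0r normrN.
Qed.

Lemma tempered_local : local_on U0 tempered.
Proof.
move=> f g fg tf z Uz sz; have [n [C H]] := tf z Uz sz; exists n, C.
have E := near_eq_off_sing fg Uz.
by near=> y => sy; rewrite -(near E y)//; move: sy; near: y; exact: H.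
Unshelve. all: by end_near. Qed.

Lemma flat_local : local_on U0 flat.
Proof.
move=> f g fg tf z Uz sz n; have [C H] := tf z Uz sz n; exists C.
have E := near_eq_off_sing fg Uz.
by near=> y => sy; rewrite -(near E y)//; move: sy; near: y; exact: H.
Unshelve. all: by end_near. Qed.

Lemma flat_tempered f : flat f -> tempered f.
Proof.
move=> ff z Uz sz; have [C H] := ff z Uz sz 0; exists 0, C.
by apply: filterS H => y + sy => /(_ sy); rewrite !expr0 mul1r mulr1.
Qed.

Lemma temperedD : stableD tempered.
Proof.
move=> f g tf tg z Uz sz.
have [n [C Hf]] := tf z Uz sz; have [m [D Hg]] := tg z Uz sz.
exists (n + m), (C + D).
have S := near_sing_small ltr01 Uz sz.
near=> y => sy.
have s1 : `|sing y| <= 1 by apply/ltW; near: y; exact: S.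
have Hfy : `|sing y| ^+ n * `|f y| <= C by move: sy; near: y; exact: Hf.
have Hgy : `|sing y| ^+ m * `|g y| <= D by move: sy; near: y; exact: Hg.
apply: (le_trans (ler_wpM2l _ (ler_normD _ _))); first by rewrite exprn_ge0.
rewrite mulrDr; apply: lerD; [apply: le_trans Hfy|apply: le_trans Hgy].
  by rewrite exprD -mulrA mulrCA ler_piMl ?mulr_ge0 ?exprn_ge0 ?exprn_ile1.
by rewrite exprD -mulrA ler_piMl ?mulr_ge0 ?exprn_ge0 ?exprn_ile1.
Unshelve. all: by end_near. Qed.

Lemma temperedM : stableM tempered tempered tempered.
Proof.
move=> f g tf tg z Uz sz.
have [n [C Hf]] := tf z Uz sz; have [m [D Hg]] := tg z Uz sz.
exists (n + m), (C * D).
near=> y => sy.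
have Hfy : `|sing y| ^+ n * `|f y| <= C by move: sy; near: y; exact: Hf.
have Hgy : `|sing y| ^+ m * `|g y| <= D by move: sy; near: y; exact: Hg.
by rewrite exprD normrM mulrACA ler_pM ?mulr_ge0 ?exprn_ge0.
Unshelve. all: by end_near. Qed.

Lemma flatD : stableD flat.
Proof.
move=> f g tf tg z Uz sz n.
have [C Hf] := tf z Uz sz n; have [D Hg] := tg z Uz sz n.
exists (C + D).
near=> y => sy; rewrite mulrDl; apply: le_trans (ler_normD _ _) _.
by apply: lerD; move: sy; near: y; [exact: Hf|exact: Hg].
Unshelve. all: by end_near. Qed.

(** The polynomial growth of [f] costs finitely many powers of [sing], out of
    the arbitrarily many at hand for [g]. *)
Lemma temperedM_flat : stableM tempered flat flat.
Proof.
move=> f g tf tg z Uz sz n.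
have [m [C Hf]] := tf z Uz sz; have [D Hg] := tg z Uz sz (n + m).
exists (C * D).
near=> y => sy.
have Hfy : `|sing y| ^+ m * `|f y| <= C by move: sy; near: y; exact: Hf.
have Hgy : `|g y| <= D * `|sing y| ^+ (n + m) by move: sy; near: y; exact: Hg.
have D0 : 0 <= D.
  by rewrite -(pmulr_lge0 _ (exprn_gt0 (n + m) (_ : 0 < `|sing y|))) ?normr_gt0//
    (le_trans _ Hgy).
rewrite normrM; apply: (le_trans (ler_wpM2l _ Hgy)) => //.
have -> : `|f y| * (D * `|sing y| ^+ (n + m)) =
  D * `|sing y| ^+ n * (`|sing y| ^+ m * `|f y|) by rewrite exprD; ring.
have -> : C * D * `|sing y| ^+ n = D * `|sing y| ^+ n * C by ring.
by rewrite ler_wpM2l ?mulr_ge0 ?exprn_ge0.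
Unshelve. all: by end_near. Qed.

Lemma flatM_tempered : stableM flat tempered flat.
Proof.
move=> f g ff tg; apply: (flat_local (f := fun x => g x * f x)).
  by move=> x _; rewrite mulrC.
exact: temperedM_flat.
Qed.

Lemma cont_tempered f : cont_on U f -> tempered f.
Proof.
move=> cf z Uz sz; exists 0, (`|f z| + 1).
have /cvgrPdist_lt/(_ _ ltr01) := cf z Uz.
apply: filterS => y fy _; rewrite expr0 mul1r -[X in `|X|](subrK (f z)) addrC.
by rewrite (le_trans (ler_normD _ _))// lerD2l distrC ltW.
Qed.

(** Unlike their lower-case counterparts, these also constrain the derivatives
    of all orders, off the zeros of [sing]. *)
Definition Tempered f := forall k, tower tempered U0 k f.
Definition Flat f := forall k, tower flat U0 k f.

Lemma smooth_Tempered f : smooth_on U f -> Tempered f.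
Proof.
move=> /smooth_onP Hf k; have {Hf} := Hf k.
elim: k f => [|k IH] f [Pf H]; split=> //.
- exact: cont_tempered.
- exact: cont_tempered.
- by case: H => df Hv; split=> [x [/df]|v] //; exact/IH/Hv.
Qed.

Lemma Tempered_ext f g : {in U0, f =1 g} -> Tempered f -> Tempered g.
Proof.
by move=> fg Hf k; apply: tower_ext fg (Hf k);
  [exact: open_off_sing|exact: tempered_local].
Qed.

Lemma Flat_ext f g : {in U0, f =1 g} -> Flat f -> Flat g.
Proof.
by move=> fg Hf k; apply: tower_ext fg (Hf k);
  [exact: open_off_sing|exact: flat_local].
Qed.

Lemma Flat_Tempered f : Flat f -> Tempered f.
Proof. by move=> Hf k; apply: tower_sub (Hf k); exact: flat_tempered. Qed.

Lemma TemperedD f g : Tempered f -> Tempered g -> Tempered (fun x => f x + g x).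
Proof.
by move=> Hf Hg k; apply: tower_add;
  [exact: open_off_sing|exact: tempered_local|exact: temperedD|..].
Qed.

Lemma TemperedM f g : Tempered f -> Tempered g -> Tempered (fun x => f x * g x).
Proof.
by move=> Hf Hg k; apply: (tower_mul (P := tempered) (Q := tempered));
  [exact: open_off_sing|exact: tempered_local|exact: temperedD|
   exact: temperedM|..].
Qed.

Lemma FlatD f g : Flat f -> Flat g -> Flat (fun x => f x + g x).
Proof.
by move=> Hf Hg k; apply: tower_add;
  [exact: open_off_sing|exact: flat_local|exact: flatD|..].
Qed.

Lemma FlatM f g : Tempered f -> Flat g -> Flat (fun x => f x * g x).
Proof.
by move=> Hf Hg k; apply: (tower_mul (P := tempered) (Q := flat));
  [exact: open_off_sing|exact: flat_local|exact: flatD|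
   exact: temperedM_flat|..].
Qed.

Lemma Tempered_cst (c : R) : Tempered (fun=> c).
Proof. by apply: smooth_Tempered; exact: smooth_on_cst. Qed.

Lemma TemperedN f : Tempered f -> Tempered (fun x => - f x).
Proof.
move=> Hf; apply: (Tempered_ext (f := fun x => -1 * f x)).
  by move=> x _; rewrite mulN1r.
exact: TemperedM (Tempered_cst _) Hf.
Qed.

(** The derivatives of the sine are bounded on the whole line, so [f] may blow
    up at the zeros of [sing]. *)
Lemma Tempered_sin_derivs i f : Tempered f ->
  Tempered (fun x => sin_derivs i (f x)).
Proof.
move=> Hf k; have ts j : tempered (sin_derivs j \o f).
  move=> z _ _; exists 0, 1; near=> y => _.
  by rewrite expr0 mul1r /= /sin_derivs ler_norml sin_geN1 sin_le1.
apply: (@tower_comp _ _ tempered tempered tempered U0 setT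
  (fun j => sin_derivs (j + i))) (Hf k) => //.
- exact: open_off_sing.
- exact: tempered_local.
- exact: tempered_local.
- exact: temperedD.
- exact: temperedD.
- exact: temperedM.
- exact: temperedM.
- by move=> j x _; exact: derivatives_sin.
Unshelve. all: by end_near. Qed.

Lemma Tempered_sin f : Tempered f -> Tempered (fun x => sin (f x)).
Proof.
move=> /(Tempered_sin_derivs 0); apply: Tempered_ext => x _.
by rewrite sin_derivs0.
Qed.

Lemma Tempered_cos f : Tempered f -> Tempered (fun x => cos (f x)).
Proof.
move=> /(Tempered_sin_derivs 1); apply: Tempered_ext => x _.
by rewrite sin_derivs1.
Qed.

Hypothesis smooth_sing : smooth_on U sing.

Lemma Tempered_inv : Tempered (fun x => (sing x)^-1).
Proof.
move=> k.
apply: (tower_ext (f := inv_derivs 0 \o sing)).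
- exact: open_off_sing.
- exact: tempered_local.
- by move=> x _; rewrite /= /inv_derivs expr0 fact0 !mul1r.
have ti i : tempered (inv_derivs i \o sing).
  move=> z _ _; exists i.+1, (i`!%:R); near=> y => sy.
  rewrite /= /inv_derivs !normrM normrX normrN1 expr1n mul1r normfV normrX.
  by rewrite mulrCA divff ?mulr1 ?expf_neq0 ?normr_eq0// ger0_norm.
apply: (@tower_comp _ _ tempered tempered tempered U0 [set x | x != 0])
   (smooth_Tempered smooth_sing k) => //.
- exact: open_off_sing.
- exact: tempered_local.
- exact: tempered_local.
- exact: temperedD.
- exact: temperedD.
- exact: temperedM.
- exact: temperedM.
- exact: derivatives_inv.
- by move=> x [].
Unshelve. all: by end_near. Qed.

(** The sign is locally constant off the zeros of [sing], so its derivatives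
    vanish there. *)
Lemma Tempered_sg : Tempered (fun x => Num.sg (sing x)).
Proof.
move=> k.
have locc x : U0 x -> {near x, (fun=> Num.sg (sing x)) =1 (fun x => Num.sg (sing x))}.
  move=> [Ux sx]; have c := csing Ux.
  have [sx0|sx0] : sing x < 0 \/ 0 < sing x by apply/orP; rewrite -neq_lt.
    have N : nbhs (sing x) [set r | r < 0] by exact: lt_nbhsl.
    rewrite ltr0_sg//; near=> y; rewrite ltr0_sg//; near: y.
    exact: (c _ N).
  have N : nbhs (sing x) [set r | 0 < r] by exact: lt_nbhsr.
  rewrite gtr0_sg//; near=> y; rewrite gtr0_sg//; near: y.
  exact: (c _ N).
have ts : tempered (fun x => Num.sg (sing x)).
  move=> z _ _; exists 0, 1; near=> y => sy.
  by rewrite expr0 mul1r normr_sg sy.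
case: k => [|k]; split=> //; split=> [x U0x|v].
  exact: near_eq_differentiable (locc x U0x) (differentiable_cst _ _).
apply: (tower_ext (f := fun=> 0)) (Tempered_cst 0 k).
- exact: open_off_sing.
- exact: tempered_local.
move=> x; rewrite inE => U0x.
by rewrite -(near_eq_derive v (locc x U0x)) derive_cst.
Unshelve. all: by end_near. Qed.

(** This is [1 + z <= exp z] at [z = 1 / ((n + 1) x)], raised to the power
    [n + 1]. *)
Lemma expRN_inv_le (n : nat) (x : R) : 0 < x ->
  expR (- x^-1) <= n.+1%:R ^+ n.+1 * x ^+ n.+1.
Proof.
move=> x0; have Nx0 : 0 < n.+1%:R * x by rewrite mulr_gt0.
have -> : - x^-1 = n.+1%:R * - (n.+1%:R * x)^-1.
  by field; rewrite gt_eqF //= pnatr_eq0.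
rewrite expRM_natl -exprMn lerXn2r ?nnegrE ?expR_ge0 ?(ltW Nx0)//.
rewrite expRN invf_ple ?posrE ?expR_gt0//.
by apply: le_trans (expR_ge1Dx _); rewrite lerDr.
Qed.

(** The exponent is [- 1 / |sing x|], written as a product of functions already
    known to be tempered; the exponential is its own derivative, so only its
    values have to be bounded. *)
Lemma Flat_expR : Flat (fun x => expR (- (Num.sg (sing x) * (sing x)^-1))).
Proof.
move=> k.
have ff : flat (fun x => expR (- (Num.sg (sing x) * (sing x)^-1))).
  move=> z Uz sz n; exists (n.+1%:R ^+ n.+1).
  have S := near_sing_small ltr01 Uz sz.
  near=> y => sy; rewrite ger0_norm ?expR_ge0//.
  have -> : Num.sg (sing y) * (sing y)^-1 = `|sing y|^-1.
    by rewrite {2}[sing y]numEsg invfM mulrA divff ?mul1r// sgr_eq0.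
  apply: le_trans (expRN_inv_le n _) _; first by rewrite normr_gt0.
  rewrite ler_wpM2l ?exprn_ge0// exprS ler_piMl ?exprn_ge0//.
  by apply/ltW; near: y; exact: S.
apply: (@tower_comp _ _ tempered flat flat U0 setT (fun _ : nat => @expR R)) => //.
- exact: open_off_sing.
- exact: flat_local.
- exact: flat_local.
- exact: flatD.
- exact: flatD.
- exact: flatM_tempered.
- exact: flatM_tempered.
- exact: derivatives_expR.
- by apply: TemperedN; apply: TemperedM Tempered_inv; exact: Tempered_sg.
Unshelve. all: by end_near. Qed.

Lemma flat_cvg f z : flat f -> U z -> sing z = 0 -> forall e, 0 < e ->
  \forall y \near z, sing y != 0 -> `|f y| < e.
Proof.
move=> ff Uz sz e e0; have [C H] := ff z Uz sz 1.
pose D := `|C| + 1; have D0 : 0 < D by rewrite ltr_wpDl.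
have S := near_sing_small (divr_gt0 e0 D0) Uz sz.
near=> y => sy; apply: (@le_lt_trans _ _ (C * `|sing y| ^+ 1)).
  by move: sy; near: y; exact: H.
have Sy : `|sing y| < e / D by near: y; exact: S.
rewrite expr1 (@le_lt_trans _ _ (D * `|sing y|))//.
  by rewrite ler_wpM2r// /D ler_wpDr// ler_norm.
by rewrite mulrC -ltr_pdivlMr.
Unshelve. all: by end_near. Qed.

(** As [G 0] vanishes at [0], it is dominated by a linear function near [0],
    where [f] takes its values. Its derivatives are merely bounded there, but the
    chain rule multiplies them by derivatives of [f], which are flat. *)
Lemma Flat_comp (O : set R) (G : nat -> R -> R) f : derivatives_on O G ->
  O 0 -> G 0 0 = 0 -> (forall x, U0 x -> O (f x)) ->
  Flat f -> Flat (fun x => G 0 (f x)).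
Proof.
move=> dG O0 G0 fO Hf k.
have ff : flat f by exact: tower_base (Hf 0).
have tG i : tempered (G i \o f).
  move=> z Uz sz; exists 0, (`|G i 0| + 1).
  have cG : {for 0, continuous (G i)}.
    apply: differentiable_continuous; apply/derivable1_diffP.
    by have := dG i _ O0; case.
  move/cvgrPdist_lt : cG => /(_ _ ltr01) [/= e e0 He].
  have F := flat_cvg ff Uz sz e0.
  near=> y => sy; rewrite expr0 mul1r /= -[X in `|X|](subrK (G i 0)) addrC.
  rewrite (le_trans (ler_normD _ _))// lerD2l distrC ltW// He//=.
  by rewrite sub0r normrN; move: sy; near: y; exact: F.
have fG : flat (G 0 \o f).
  move=> z Uz sz n; have [C H] := ff z Uz sz n.
  have [e e0 Le] := lipschitz_at0 (dG 0%N 0 O0) G0.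
  have F := flat_cvg ff Uz sz e0.
  exists ((`|G 1 0| + 1) * C); near=> y => sy /=.
  apply: le_trans (Le _ _) _; first by move: sy; near: y; exact: F.
  by rewrite -mulrA ler_wpM2l ?addr_ge0//; move: sy; near: y; exact: H.
apply: (@tower_comp _ _ flat tempered flat U0 O G) => //.
- exact: open_off_sing.
- exact: tempered_local.
- exact: flat_local.
- exact: temperedD.
- exact: flatD.
- by move=> g h tg fh; apply: temperedM => //; exact: flat_tempered.
- exact: temperedM_flat.
- exact: flat_tempered.
Unshelve. all: by end_near. Qed.

Lemma sing_lipschitz z : U z -> sing z = 0 ->
  exists2 K : R, 0 < K & \forall h \near (0 : V), `|sing (h + z)| <= K * `|h|.
Proof.
move=> Uz sz; have ds : differentiable sing z.
  by have [+ _] := smooth_sing 1; exact.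
have [k k0 dk] := linear_lipschitz (diff_continuous ds).
exists (k + 1); first by rewrite addr_gt0.
have /eqaddoP/(_ _ ltr01) := diff_locally ds.
apply: filterS => h; rewrite !fctE sz add0r mul1r => Hh.
rewrite -[X in `|X|](subrK ('d sing z h)) mulrDl mul1r addrC.
by rewrite (le_trans (ler_normD _ _))// lerD.
Qed.

(** [f = O(sing ^ 2)] and [sing (h + z) = O(h)] at a zero [z] of [sing], so
    [f (h + z) = o(h)]. *)
Lemma flat_differentiable0 f z : flat f ->
  (forall x, U x -> sing x = 0 -> f x = 0) -> U z -> sing z = 0 ->
  differentiable f z /\ forall v, 'D_v f z = 0.
Proof.
move=> ff f0 Uz sz.
have [C H] := ff z Uz sz 2.
have fz : f z = 0 by exact: f0.
suff E : f \o shift z = cst (f z) + \0 +o_ (0:V) id.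
  have dE : 'd f z = \0 :> (V -> R).
    by apply: diff_unique => //; exact: cst_continuous.
  have df : differentiable f z.
    by apply/diff_locallyP; rewrite dE; split=> //; exact: cst_continuous.
  by split=> // v; rewrite deriveE// dE.
apply/eqaddoP => _/posnumP[e].
have [K K0 HK] := sing_lipschitz Uz sz.
pose D := `|C| + 1; have D0 : 0 < D by rewrite ltr_wpDl.
have eDK : 0 < e%:num / (D * K) by rewrite divr_gt0 ?mulr_gt0.
have S := near_sing_small eDK Uz sz.
have toz : (fun h : V => h + z) @ 0 --> z.
  by rewrite -[X in _ --> X]add0r; apply: cvgD; [exact: cvg_id|exact: cvg_cst].
have Hz := toz _ H; have Sz := toz _ S.
have Un := toz _ (open_nbhs_nbhs (conj oU Uz)).
near=> h; rewrite !fctE fz /= !addr0 subr0.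
have [s0|s0] := eqVneq (sing (h + z)) 0.
  rewrite f0//; first by rewrite normr0 mulr_ge0.
  by near: h; exact: Un.
have fh : `|f (h + z)| <= C * `|sing (h + z)| ^+ 2.
  by move: s0; near: h; exact: Hz.
have sh : `|sing (h + z)| < e%:num / (D * K) by near: h; exact: Sz.
have sl : `|sing (h + z)| <= K * `|h| by near: h; exact: HK.
have fD : `|f (h + z)| <= D * (`|sing (h + z)| * `|sing (h + z)|).
  apply: (le_trans fh); rewrite -expr2 ler_wpM2r ?exprn_ge0//.
  by rewrite /D ler_wpDr// ler_norm.
apply: (le_trans fD).
have -> : e%:num * `|h| = D * ((e%:num / (D * K)) * (K * `|h|)).
  by field; rewrite !gt_eqF.
by rewrite ler_wpM2l ?(ltW D0)// ler_pM// ltW.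
Unshelve. all: by end_near. Qed.

(** At the zeros of [sing] the differential of [f] exists and vanishes, so the
    directional derivatives of [f] again satisfy the hypotheses. *)
Lemma Flat_smooth f : Flat f -> (forall x, U x -> sing x = 0 -> f x = 0) ->
  smooth_on U f.
Proof.
move=> Hf f0 k; move: (Hf k.+1) f0 => {Hf}; elim: k f => [|k IH] f Hf f0.
  move=> x Ux; have [s0|s0] := eqVneq (sing x) 0.
    apply: differentiable_continuous.
    by have [] := flat_differentiable0 (tower_base Hf) f0 Ux s0.
  by case: Hf => _ [df _]; apply: differentiable_continuous; exact: df.
case: (Hf) => ff [df Hv].
split=> [x Ux|v].
  have [s0|s0] := eqVneq (sing x) 0; last exact: df.
  by have [] := flat_differentiable0 ff f0 Ux s0.
apply: IH (Hv v) _ => x Ux sx.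
by have [_ ->] := flat_differentiable0 ff f0 Ux sx.
Qed.

End Flat.

(** * The clock and the motion of the height *)

Section Clock.
Context {R : realType}.
Implicit Types (u w t s q y : R).

Definition sinh u := (expR u - expR (- u)) / 2.
Definition asinh w := ln (w + Num.sqrt (w ^+ 2 + 1)).

Lemma asinh_arg_gt0 w : 0 < w + Num.sqrt (w ^+ 2 + 1).
Proof.
have : `|w| < Num.sqrt (w ^+ 2 + 1).
  by rewrite -sqrtr_sqr ltr_sqrt ?ltrDl// ltr_wpDl// sqr_ge0.
by have := ler_norm (- w); rewrite normrN; lra.
Qed.

Lemma sqrt_sqr_add1 w z : 0 < z -> z ^+ 2 = w ^+ 2 + 1 ->
  Num.sqrt (w ^+ 2 + 1) = z.
Proof. by move=> z0 <-; rewrite sqrtr_sqr gtr0_norm. Qed.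

Lemma sinhK : cancel sinh asinh.
Proof.
move=> u; rewrite /asinh (@sqrt_sqr_add1 _ ((expR u + expR (- u)) / 2)).
- have -> : sinh u + (expR u + expR (- u)) / 2 = expR u by rewrite /sinh; field.
  exact: expRK.
- by rewrite divr_gt0// addr_gt0// expR_gt0.
- have E : expR u * expR (- u) = 1 by rewrite -expRD subrr expR0.
  rewrite /sinh; set a := expR u in E *; set b := expR (- u) in E *.
  transitivity ((a - b) ^+ 2 / 4 + a * b); first by field.
  by rewrite E; field.
Qed.

Lemma asinhK : cancel asinh sinh.
Proof.
move=> w; rewrite /sinh expRN /asinh lnK ?posrE ?asinh_arg_gt0//.
set z := Num.sqrt _.
have z2 : z ^+ 2 = w ^+ 2 + 1 by rewrite sqr_sqrtr// ltW// ltr_wpDl// sqr_ge0.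
have z0 : w + z != 0 by rewrite gt_eqF// asinh_arg_gt0.
have -> : (w + z)^-1 = z - w.
  apply: (mulfI z0); rewrite divff//.
  transitivity (z ^+ 2 - w ^+ 2); last by ring.
  by rewrite z2; ring.
by field.
Qed.

(** A translation read in the coordinate [sinh u]. It moves [u] by about
    [2 t exp (- |u|)] when [u] is large, which is why it fixes infinity to
    infinite order. *)
Definition clock t u := asinh (sinh u + t).

Lemma clock0 u : clock 0 u = u.
Proof. by rewrite /clock addr0 sinhK. Qed.

Lemma clockD s t u : clock (s + t) u = clock s (clock t u).
Proof. by rewrite /clock asinhK addrA addrAC. Qed.

(** The growing amplitude drives the height to the ends of the segment; the
    growing frequency [u ^ 2] makes the two ends equally visited, as [sin u] would
    stay too long on one side when [u] grows like a logarithm. *)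
Definition swing u := u * sin (u ^+ 2).

(** The transformation that multiplies [(1 + y) / (1 - y)] by [q]. *)
Definition mobius (q y : R) := ((1 + y) * q - (1 - y)) / ((1 + y) * q + (1 - y)).

Lemma mobius_den_gt0 q y : 0 < q -> -1 <= y <= 1 ->
  0 < (1 + y) * q + (1 - y).
Proof.
move=> q0 /andP[y1 y2].
have [->|yN] := eqVneq y (-1); first by rewrite subrr mul0r; lra.
have y0 : 0 < 1 + y by rewrite -(opprK 1) addrC subr_gt0 lt_neqAle eq_sym yN.
by rewrite ltr_wpDr ?mulr_gt0// subr_ge0.
Qed.

Lemma mobius1 y : mobius 1 y = y.
Proof.
rewrite /mobius mulr1 (_ : 1 + y - (1 - y) = y * 2); last by ring.
by rewrite (_ : 1 + y + (1 - y) = 2) ?mulfK//; ring.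
Qed.

Lemma mobius_itv q y : 0 < q -> -1 <= y <= 1 -> -1 <= mobius q y <= 1.
Proof.
move=> q0 y1; have d := mobius_den_gt0 q0 y1.
rewrite /mobius ler_pdivlMr// ler_pdivrMr//.
case/andP: y1 => y1 y2.
have : 0 <= (1 + y) * q by rewrite mulr_ge0 ?(ltW q0)//; lra.
by move=> ?; apply/andP; split; lra.
Qed.

Lemma mobiusM q1 q2 y : 0 < q1 -> 0 < q2 -> -1 <= y <= 1 ->
  mobius (q1 * q2) y = mobius q1 (mobius q2 y).
Proof.
move=> q10 q20 y1; have d := mobius_den_gt0 q20 y1.
have d1 := mobius_den_gt0 (mulr_gt0 q10 q20) y1.
rewrite /mobius; field.
rewrite (gt_eqF d)/=.
set x := (X in X != 0).
have -> : x = 2 * ((1 + y) * (q1 * q2) + (1 - y)) by rewrite /x; ring.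
by rewrite (gt_eqF d1) /= mulf_neq0 ?(gt_eqF d1).
Qed.

End Clock.

(** * The flow *)

Section Flow.
Context {R : realType}.
Implicit Types (t s u : R) (x : annulus R) (p : R * R * R).

(** Stereographic projection of the circle from the point [(1, 0)]; its inverse
    is the pair [circle_cos], [circle_sin]. *)
Definition half_cot p := p.1.2 / (1 - p.1.1).

Definition circle_cos (u : R) := (u ^+ 2 - 1) / (u ^+ 2 + 1).
Definition circle_sin (u : R) := 2 * u / (u ^+ 2 + 1).

(** On the line [a = 1], where [half_cot] is infinite, the points are fixed. *)
Definition flow_val t p : R * R * R :=
  if p.1.1 == 1 then p else
  let u := half_cot p in
  let u' := clock t u in
  (circle_cos u', circle_sin u', mobius (expR (swing u' - swing u)) p.2).

Lemma sqrD1_neq0 u : u ^+ 2 + 1 != 0.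
Proof. by rewrite gt_eqF// ltr_wpDl// sqr_ge0. Qed.

Lemma circle_cosD_sin u : circle_cos u ^+ 2 + circle_sin u ^+ 2 = 1.
Proof. by rewrite /circle_cos /circle_sin; field; exact: sqrD1_neq0. Qed.

Lemma circle_cos_neq1 u : circle_cos u != 1.
Proof.
rewrite -subr_eq0 (_ : _ - 1 = - 2 / (u ^+ 2 + 1)).
  by rewrite mulf_neq0 ?oppr_eq0 ?invr_eq0 ?sqrD1_neq0.
by rewrite /circle_cos; field; exact: sqrD1_neq0.
Qed.

Lemma half_cot_circle u y : half_cot (circle_cos u, circle_sin u, y) = u.
Proof.
rewrite /half_cot /circle_cos /circle_sin /=; field.
rewrite sqrD1_neq0 /= (_ : _ - _ = 2)//; ring.
Qed.

Lemma circle_half_cot p : annulus_set R p -> p.1.1 != 1 ->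
  (circle_cos (half_cot p), circle_sin (half_cot p)) = p.1.
Proof.
case: p => [[a b] y] [/= ab1 _] a1.
have a1' : 1 - a != 0 by rewrite subr_eq0 eq_sym.
have b2 : b ^+ 2 = (1 - a) * (1 + a) by rewrite -(addKr (a ^+ 2) (b ^+ 2)) ab1; ring.
have u2 : half_cot (a, b, y) ^+ 2 = (1 + a) / (1 - a).
  by rewrite /half_cot /= exprMn b2; field.
rewrite /circle_cos /circle_sin u2 /half_cot /=; congr pair; field.
  by rewrite a1' /= (_ : 1 + a + (1 - a) = 2)//; ring.
by rewrite a1' /= (_ : 1 + a + (1 - a) = 2)//; ring.
Qed.

Lemma flow_valP t p : annulus_set R p -> annulus_set R (flow_val t p).
Proof.
rewrite /flow_val; case: ifPn => // _ [_ y1].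
split => /=; first exact: circle_cosD_sin.
by apply: mobius_itv => //; exact: expR_gt0.
Qed.

Lemma annulus_valP x : annulus_set R (annulus_val x).
Proof. by have := valP x; rewrite inE. Qed.

Definition flow t x : annulus R :=
  exist _ (flow_val t (annulus_val x)) (mem_set (flow_valP t (annulus_valP x))).

Lemma flow_valE t x : annulus_val (flow t x) = flow_val t (annulus_val x).
Proof. by []. Qed.

Lemma annulus_val_inj : injective (@annulus_val R).
Proof. exact: val_inj. Qed.

Lemma flow0 x : flow 0 x = x.
Proof.
apply: annulus_val_inj; rewrite flow_valE /flow_val; case: eqP => // /eqP a1.
rewrite clock0 subrr expR0 mobius1.
have := circle_half_cot (annulus_valP x) a1.
by case: (annulus_val x) a1 => [[a b] y] /= _ [-> ->].
Qed.

Lemma flowD s t x : flow (s + t) x = flow s (flow t x).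
Proof.
apply: annulus_val_inj; rewrite !flow_valE /flow_val.
have [a1|a1] := eqVneq (annulus_val x).1.1 1; first by rewrite a1 eqxx.
rewrite /= (negbTE (circle_cos_neq1 _)) half_cot_circle -clockD.
congr (_, _, _); have [_ y1] := annulus_valP x.
rewrite -mobiusM ?expR_gt0// -expRD; congr (mobius (expR _) _); ring.
Qed.

End Flow.

(** * Smoothness away from the fixed line *)

Section SmoothFunctions.
Context {R : realType} {V : normedModType R}.
Variable U : set V.
Hypothesis oU : open U.
Implicit Types f g : V -> R.

Lemma smooth_onN f : smooth_on U f -> smooth_on U (fun x => - f x).
Proof.
move=> Hf; apply: (smooth_on_ext oU (f := fun x => -1 * f x)).
  by move=> x _; rewrite mulN1r.
exact: smooth_onM (smooth_on_cst _ _) Hf.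
Qed.

Lemma smooth_onB f g :
  smooth_on U f -> smooth_on U g -> smooth_on U (fun x => f x - g x).
Proof. by move=> Hf Hg; apply: smooth_onD => //; exact: smooth_onN. Qed.

Lemma smooth_on_sqr f : smooth_on U f -> smooth_on U (fun x => f x ^+ 2).
Proof.
move=> Hf; apply: (smooth_on_ext oU (f := fun x => f x * f x)).
  by move=> x _; rewrite expr2.
exact: smooth_onM.
Qed.

Lemma smooth_on_inv f : (forall x, U x -> f x != 0) -> smooth_on U f ->
  smooth_on U (fun x => (f x)^-1).
Proof.
move=> f0 Hf; apply: (smooth_on_ext oU (f := fun x => inv_derivs 0 (f x))).
  by move=> x _; rewrite /inv_derivs expr0 fact0 !mul1r.
exact: (smooth_on_comp oU derivatives_inv f0 Hf).
Qed.

Lemma smooth_on_div f g : (forall x, U x -> g x != 0) ->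
  smooth_on U f -> smooth_on U g -> smooth_on U (fun x => f x / g x).
Proof. by move=> g0 Hf Hg; apply: smooth_onM => //; exact: smooth_on_inv. Qed.

Lemma smooth_on_expR f : smooth_on U f -> smooth_on U (fun x => expR (f x)).
Proof. by move=> Hf; apply: (smooth_on_comp oU derivatives_expR _ Hf). Qed.

Lemma smooth_on_sin f : smooth_on U f -> smooth_on U (fun x => sin (f x)).
Proof.
move=> Hf; apply: (smooth_on_ext oU (f := fun x => sin_derivs 0 (f x))).
  by move=> x _; rewrite sin_derivs0.
by apply: (smooth_on_comp oU derivatives_sin _ Hf).
Qed.

Lemma smooth_on_ln f : (forall x, U x -> 0 < f x) -> smooth_on U f ->
  smooth_on U (fun x => ln (f x)).
Proof. by move=> f0 Hf; apply: (smooth_on_comp oU derivatives_ln _ Hf). Qed.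

(** Expresses the square root through functions whose successive derivatives
    are explicit. *)
Lemma sqrt_expR_ln (x : R) : 0 < x -> Num.sqrt x = expR (ln x / 2).
Proof.
move=> x0; have {1}-> : x = expR (ln x / 2) ^+ 2.
  by rewrite -expRM_natl mulrC divfK// lnK.
by rewrite sqrtr_sqr gtr0_norm// expR_gt0.
Qed.

Lemma smooth_on_sqrt f : (forall x, U x -> 0 < f x) -> smooth_on U f ->
  smooth_on U (fun x => Num.sqrt (f x)).
Proof.
move=> f0 Hf; apply: (smooth_on_ext oU (f := fun x => expR (ln (f x) / 2))).
  by move=> x; rewrite inE => Ux; rewrite sqrt_expR_ln//; exact: f0.
apply: smooth_on_expR; apply: smooth_onM => //; last exact: smooth_on_cst.
exact: smooth_on_ln.
Qed.

Lemma smooth_on_sinh f : smooth_on U f -> smooth_on U (fun x => sinh (f x)).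
Proof.
move=> Hf; apply: smooth_onM => //; last exact: smooth_on_cst.
by apply: smooth_onB; apply: smooth_on_expR => //; exact: smooth_onN.
Qed.

Lemma smooth_on_asinh f : smooth_on U f -> smooth_on U (fun x => asinh (f x)).
Proof.
move=> Hf; apply: smooth_on_ln => [x _|]; first exact: asinh_arg_gt0.
apply: smooth_onD => //; apply: smooth_on_sqrt => [x _|].
  by rewrite ltr_wpDl// sqr_ge0.
by apply: smooth_onD => //; [exact: smooth_on_sqr|exact: smooth_on_cst].
Qed.

Lemma smooth_on_swing f : smooth_on U f -> smooth_on U (fun x => swing (f x)).
Proof.
move=> Hf; apply: smooth_onM => //.
by apply: smooth_on_sin; exact: smooth_on_sqr.
Qed.

Lemma smooth_on_circle_cos f : smooth_on U f ->
  smooth_on U (fun x => circle_cos (f x)).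
Proof.
move=> Hf; apply: smooth_on_div => [x _||]; first exact: sqrD1_neq0.
- by apply: smooth_onB; [exact: smooth_on_sqr|exact: smooth_on_cst].
- by apply: smooth_onD => //; [exact: smooth_on_sqr|exact: smooth_on_cst].
Qed.

Lemma smooth_on_circle_sin f : smooth_on U f ->
  smooth_on U (fun x => circle_sin (f x)).
Proof.
move=> Hf; apply: smooth_on_div => [x _||]; first exact: sqrD1_neq0.
- by apply: smooth_onM => //; exact: smooth_on_cst.
- by apply: smooth_onD => //; [exact: smooth_on_sqr|exact: smooth_on_cst].
Qed.

End SmoothFunctions.

Section FlowCharts.
Context {R : realType}.
Let V := (R * (R * R * R))%type.
Implicit Types (p : V) (U : set V).

Lemma smooth_time U : smooth_on U (fun p => p.1).
Proof.
by apply: (@smooth_on_linear _ _ _ (fst : {linear V -> R})) => p; exact: cvg_fst.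
Qed.

Lemma smooth_coord1 U : smooth_on U (fun p => p.2.1.1).
Proof.
apply: (@smooth_on_linear _ _ _ ((fst \o (fst \o snd)) : {linear V -> R})) => p.
apply: continuous_comp; last exact: cvg_fst.
by apply: continuous_comp; [exact: cvg_snd|exact: cvg_fst].
Qed.

Lemma smooth_coord2 U : smooth_on U (fun p => p.2.1.2).
Proof.
apply: (@smooth_on_linear _ _ _ ((snd \o (fst \o snd)) : {linear V -> R})) => p.
apply: continuous_comp; last exact: cvg_snd.
by apply: continuous_comp; [exact: cvg_snd|exact: cvg_fst].
Qed.

Lemma smooth_height U : smooth_on U (fun p => p.2.2).
Proof.
apply: (@smooth_on_linear _ _ _ ((snd \o snd) : {linear V -> R})) => p.
by apply: continuous_comp; exact: cvg_snd.
Qed.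

(** The denominator of [mobius] vanishes off the annulus, so the open set has to
    be shrunk. *)
Lemma flow_chart U (A B D : V -> R) (t0 : R) (x0 : annulus R) :
  open U -> smooth_on U A -> smooth_on U B -> smooth_on U D ->
  U (t0, annulus_val x0) ->
  (forall t x, U (t, annulus_val x) -> annulus_val (flow t x) =
     (A (t, annulus_val x), B (t, annulus_val x),
      mobius (expR (D (t, annulus_val x))) (annulus_val x).2)) ->
  exists U' (h : V -> R * R * R),
    [/\ open U', U' (t0, annulus_val x0), forall k, class_C k U' h &
        forall t x, U' (t, annulus_val x) ->
          h (t, annulus_val x) = annulus_val (flow t x)].
Proof.
move=> oU sA sB sD U0 flowE.
pose den (p : V) := (1 + p.2.2) * expR (D p) + (1 - p.2.2).
have sE : smooth_on U (fun p => (1 + p.2.2) * expR (D p)).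
  apply: smooth_onM => //; last exact: smooth_on_expR.
  by apply: smooth_onD => //; [exact: smooth_on_cst|exact: smooth_height].
have s1y : smooth_on U (fun p => 1 - p.2.2).
  by apply: smooth_onB => //; [exact: smooth_on_cst|exact: smooth_height].
have sden : smooth_on U den by exact: smooth_onD.
pose U' := U `&` [set p | den p != 0].
have oU' : open U' by apply: open_nonzero => //; exact: smooth_on_cont.
have UU : U' `<=` U by move=> p [].
have sM : smooth_on U' (fun p => mobius (expR (D p)) p.2.2).
  apply: smooth_on_div => // [p []//||]; last exact: smooth_on_sub UU sden.
  by apply: smooth_on_sub UU _; exact: smooth_onB.
exists U', (fun p => (A p, B p, mobius (expR (D p)) p.2.2)); split=> //.
- split=> //=; rewrite /den /= gt_eqF// mobius_den_gt0 ?expR_gt0//.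
  by have [] := annulus_valP x0.
- move=> k; apply: class_C_pair => //; first apply: class_C_pair => //.
  + exact: smooth_on_sub UU sA k.
  + exact: smooth_on_sub UU sB k.
- by move=> t x [Ux _]; rewrite flowE.
Qed.

Lemma flow_chart_regular (t0 : R) (x0 : annulus R) :
  (annulus_val x0).1.1 != 1 ->
  exists U (h : V -> R * R * R),
    [/\ open U, U (t0, annulus_val x0), forall k, class_C k U h &
        forall t x, U (t, annulus_val x) ->
          h (t, annulus_val x) = annulus_val (flow t x)].
Proof.
move=> a1.
pose U : set V := setT `&` [set p | 1 - p.2.1.1 != 0].
have oU : open U.
  apply: open_nonzero; first exact: openT.
  apply: smooth_on_cont; apply: smooth_onB; first exact: openT.
    exact: smooth_on_cst.
  exact: smooth_coord1.
have su : smooth_on U (fun p => half_cot p.2).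
  apply: smooth_on_div => // [p []//||]; first exact: smooth_coord2.
  by apply: smooth_onB => //; [exact: smooth_on_cst|exact: smooth_coord1].
have sc : smooth_on U (fun p => clock p.1 (half_cot p.2)).
  apply: smooth_on_asinh => //; apply: smooth_onD => //; last exact: smooth_time.
  exact: smooth_on_sinh.
apply: (@flow_chart U
  (fun p => circle_cos (clock p.1 (half_cot p.2)))
  (fun p => circle_sin (clock p.1 (half_cot p.2)))
  (fun p => swing (clock p.1 (half_cot p.2)) - swing (half_cot p.2))) => //.
- exact: smooth_on_circle_cos.
- exact: smooth_on_circle_sin.
- by apply: smooth_onB => //; exact: smooth_on_swing.
- by split=> //=; rewrite subr_eq0 eq_sym.
- move=> t x [_ /= Ux]; rewrite flow_valE /flow_val ifN//.
  by apply: contra Ux => /eqP ->; rewrite subrr.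
Qed.

End FlowCharts.

(** * Smoothness at the fixed line *)

Section ClockExpansion.
Context {R : realType}.
Implicit Types (u w t e x : R).

Lemma sinhN u : sinh (- u) = - sinh u.
Proof. by rewrite /sinh opprK; field. Qed.

Lemma asinhN w : asinh (- w) = - asinh w.
Proof. by apply: (can_inj (@sinhK R)); rewrite sinhN !asinhK. Qed.

Lemma clockN t u : clock (- t) (- u) = - clock t u.
Proof. by rewrite /clock sinhN -opprD asinhN. Qed.

(** With [e = exp (- u)], the displacement of the clock becomes the logarithm of
    an expression in [t] and [e] that is smooth near [e = 0], where it takes the
    value [1]. It is therefore flat whenever [e] is. *)
Lemma clock_expR t u (e := expR (- u)) (x := (1 - e ^+ 2) / 2 + t * e) :
  0 < x + Num.sqrt (x ^+ 2 + e ^+ 2) /\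
  clock t u - u = ln (x + Num.sqrt (x ^+ 2 + e ^+ 2)).
Proof.
have e0 : 0 < e by exact: expR_gt0.
have ue : u = - ln e by rewrite /e expRK opprK.
have xE : x = (sinh u + t) * e.
  rewrite /x /sinh -/e (_ : expR u = e^-1); last by rewrite /e expRN invrK.
  by field; rewrite gt_eqF.
have sE : Num.sqrt (x ^+ 2 + e ^+ 2) = Num.sqrt ((sinh u + t) ^+ 2 + 1) * e.
  have -> : x ^+ 2 + e ^+ 2 = ((sinh u + t) ^+ 2 + 1) * e ^+ 2 by rewrite xE; ring.
  rewrite sqrtrM; first by rewrite sqrtr_sqr gtr0_norm.
  by rewrite addr_ge0// sqr_ge0.
have W := asinh_arg_gt0 (sinh u + t).
rewrite sE [in X in ln X]xE [in X in 0 < X]xE -mulrDl; split.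
  by rewrite mulr_gt0.
by rewrite lnM ?posrE// {2}ue opprK.
Qed.

(** [ln (1 + x)] and [expR x - 1] vanish at [0], unlike [ln] and [expR]; only
    such functions preserve flatness. *)
Definition ln1p_derivs (i : nat) (x : R) := ln_derivs i (1 + x).

Lemma derivatives_ln1p : derivatives_on [set x : R | 0 < 1 + x] ln1p_derivs.
Proof.
move=> i x x0; rewrite /ln1p_derivs.
have d1 : is_derive x (1 : R) (fun y => 1 + y) (1 : R).
  by apply: is_derive_eq; rewrite add0r mulr1.
have := is_derive1_comp (@derivatives_ln R i (1 + x) x0) d1.
by rewrite mulr1.
Qed.

Definition expm1_derivs (i : nat) (x : R) :=
  if i is 0 then expR x - 1 else expR x.

Lemma derivatives_expm1 : derivatives_on setT expm1_derivs.
Proof.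
move=> [|i] x _; last exact: is_derive_expR.
by apply: is_derive_eq; rewrite subr0.
Qed.

Definition cosm1_derivs (i : nat) (x : R) :=
  if i is 0 then cos x - 1 else sin_derivs i.+1 x.

Lemma derivatives_cosm1 : derivatives_on setT cosm1_derivs.
Proof.
move=> [|i] x _; last exact: derivatives_sin.
have Dc := @derivatives_cos R 0%N x I.
have -> : cosm1_derivs 0 = fun y => sin_derivs 1 y + - 1.
  by apply/funext => y; rewrite sin_derivs1.
by apply: is_derive_eq; rewrite subr0.
Qed.

End ClockExpansion.

Section SingularChart.
Context {R : realType}.
Let V := (R * (R * R * R))%type.
Implicit Types (p : V).

Definition sing_dom : set V := setT `&` [set p | 1 + p.2.1.1 != 0].

(** The inverse of [half_cot] on the circle, regular near the line [a = 1]. *)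
Definition half_tan p : R := p.2.1.2 / (1 + p.2.1.1).

Lemma open_sing_dom : open sing_dom.
Proof.
apply: open_nonzero; first exact: openT.
apply: smooth_on_cont; apply: smooth_onD; first exact: openT.
  exact: smooth_on_cst.
exact: smooth_coord1.
Qed.

Lemma smooth_half_tan : smooth_on sing_dom half_tan.
Proof.
apply: smooth_on_div => //; first exact: open_sing_dom.
- by move=> p [].
- exact: smooth_coord2.
- apply: smooth_onD => //; first exact: open_sing_dom.
    exact: smooth_on_cst.
  exact: smooth_coord1.
Qed.

Let oU := open_sing_dom.
Let cv := smooth_on_cont smooth_half_tan.
Let sv := smooth_half_tan.
Local Notation Tempered := (Tempered sing_dom half_tan).
Local Notation Flat := (Flat sing_dom half_tan).

Let sg p : R := Num.sg (half_tan p).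
Let u p : R := (half_tan p)^-1.
(** This is [exp (- |u|)], small on both sides of the line. *)
Let e p : R := expR (- (sg p * u p)).

Let Tsg : Tempered sg. Proof. exact: Tempered_sg. Qed.
Let Tu : Tempered u. Proof. exact: Tempered_inv. Qed.
Let Fe : Flat e. Proof. exact: Flat_expR. Qed.
Let Tt : Tempered (fun p => p.1).
Proof. by apply: smooth_Tempered => //; exact: smooth_time. Qed.
Let Tc (c : R) : Tempered (fun=> c). Proof. exact: Tempered_cst. Qed.
Let TD f g : Tempered f -> Tempered g -> Tempered (fun x => f x + g x).
Proof. exact: TemperedD. Qed.
Let TM f g : Tempered f -> Tempered g -> Tempered (fun x => f x * g x).
Proof. exact: TemperedM. Qed.
Let FD f g : Flat f -> Flat g -> Flat (fun x => f x + g x).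
Proof. exact: FlatD. Qed.
Let FM f g : Tempered f -> Flat g -> Flat (fun x => f x * g x).
Proof. exact: FlatM. Qed.
Let FT f : Flat f -> Tempered f. Proof. exact: Flat_Tempered. Qed.

(** The displacement of the coordinate [u = 1 / v] during the time [p.1]. *)
Definition clock_shift p : R :=
  if half_tan p == 0 then 0 else clock p.1 (half_tan p)^-1 - (half_tan p)^-1.

Definition swing_shift p : R :=
  if half_tan p == 0 then 0 else
  swing (clock p.1 (half_tan p)^-1) - swing (half_tan p)^-1.

(** The functions [f1], [f2] and [f3] split [clock_expR] into operations that
    preserve flatness: with the notations there, and [t] replaced by [- t] for
    negative [u], [x = 1 / 2 + f1], [x ^ 2 + e ^ 2 = (1 + 4 f2) / 4], and the argument of
    the logarithm is [1 + f3]. *)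
Let f1 p : R := - 2^-1 * e p * e p + sg p * p.1 * e p.
Let f2 p : R := f1 p * f1 p + f1 p + e p * e p.

Let Ff1 : Flat f1.
Proof.
by apply: FD; apply: FM => //; apply: TM => //; exact: FT.
Qed.

Let Ff2 : Flat f2.
Proof.
by apply: FD; [apply: FD => //|]; apply: FM => //; exact: FT.
Qed.

Let half_argE p : (1 - e p ^+ 2) / 2 + sg p * p.1 * e p = 2^-1 + f1 p.
Proof. by rewrite /f1; field. Qed.

Let f2E p : 1 + 4 * f2 p = 4 * ((2^-1 + f1 p) ^+ 2 + e p ^+ 2).
Proof. by rewrite /f2; field. Qed.

Let f2_gt0 p : 0 < 1 + 4 * f2 p.
Proof.
rewrite f2E mulr_gt0// ltr_wpDl ?sqr_ge0//.
by rewrite exprn_gt0// expR_gt0.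
Qed.

Let f3 p : R := f1 p + 2^-1 * expm1_derivs 0 (2^-1 * ln1p_derivs 0 (4 * f2 p)).

Let Ff3 : Flat f3.
Proof.
apply: FD => //; apply: FM => //.
apply: (Flat_comp oU cv derivatives_expm1) => //.
  by rewrite /= expR0 subrr.
apply: FM => //; apply: (Flat_comp oU cv derivatives_ln1p) => //=.
- by rewrite addr0 ln1.
- exact: FM.
Qed.

Let f3E p : 1 + f3 p = 2^-1 + f1 p + Num.sqrt ((2^-1 + f1 p) ^+ 2 + e p ^+ 2).
Proof.
have -> : Num.sqrt ((2^-1 + f1 p) ^+ 2 + e p ^+ 2) =
    2^-1 * expR (2^-1 * ln (1 + 4 * f2 p)).
  rewrite [2^-1 * ln _]mulrC -sqrt_expR_ln// f2E sqrtrM//.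
  rewrite (_ : 4 = 2 ^+ 2) ?sqrtr_sqr; last by rewrite -natrX.
  by rewrite ger0_norm// mulKf.
by rewrite /f3 /=/ln1p_derivs /=; field.
Qed.

Let half_tan_sg p : half_tan p != 0 -> sg p = 1 \/ sg p = -1.
Proof. by rewrite /sg; case: sgrP => // _ _; [left|right]. Qed.

(** [clock_expR] is used for positive [u]; as the clock is odd in [(t, u)], it
    serves negative [u] as well. *)
Let clock_shiftE p : half_tan p != 0 -> 0 < 1 + f3 p /\
  sg p * ln (1 + f3 p) = clock_shift p.
Proof.
move=> v0; rewrite /clock_shift (negbTE v0) f3E -half_argE /e -/(u p).
have [E|E] := half_tan_sg v0; rewrite E.
  by have := clock_expR p.1 (u p); rewrite !mul1r => -[? ->].
have := clock_expR (- p.1) (- u p); rewrite !mulN1r => -[? <-].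
by split=> //; rewrite clockN opprD !opprK.
Qed.

Lemma Flat_clock_shift : Flat clock_shift.
Proof.
apply: (Flat_ext oU cv (f := fun p => sg p * ln1p_derivs 0 (f3 p))).
  by move=> p; rewrite inE => -[_ v0]; have [] := clock_shiftE v0.
apply: FM => //; apply: (Flat_comp oU cv derivatives_ln1p) => //=.
- by rewrite addr0 ln1.
- by move=> p [_ v0]; have [] := clock_shiftE v0.
Qed.

(** The displacement of [u ^ 2]. *)
Let eta p : R := (2 * u p + clock_shift p) * clock_shift p.

Let Feta : Flat eta.
Proof.
have Fd := Flat_clock_shift.
by apply: FM => //; apply: TD; [exact: TM|exact: FT].
Qed.

(** With [d = clock_shift], the difference
    [(u + d) sin (u ^ 2 + eta) - u sin (u ^ 2)] is
    [d sin (u ^ 2 + eta) + u sin (u ^ 2) (cos eta - 1) + u cos (u ^ 2) sin eta],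
    where each term is tempered times flat. *)
Lemma Flat_swing_shift : Flat swing_shift.
Proof.
have Fd := Flat_clock_shift.
have T2 : Tempered (fun p => u p * u p) by exact: TM.
have Ts : Tempered (fun p => sin (u p * u p)) by exact: Tempered_sin.
have Tcs : Tempered (fun p => cos (u p * u p)) by exact: Tempered_cos.
apply: (Flat_ext oU cv (f := fun p =>
   sin (u p * u p + eta p) * clock_shift p +
   (u p * sin (u p * u p) * cosm1_derivs 0 (eta p) +
    u p * cos (u p * u p) * sin_derivs 0 (eta p)))).
  move=> p; rewrite inE => -[_ /= v0].
  rewrite /swing_shift (negbTE v0).
  have -> : clock p.1 (half_tan p)^-1 = u p + clock_shift p.
    by rewrite /clock_shift (negbTE v0) addrC subrK.
  rewrite /swing -/(u p) (_ : (u p + clock_shift p) ^+ 2 = u p * u p + eta p).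
    by rewrite sin_derivs0 /= sinD expr2; ring.
  by rewrite /eta; ring.
apply: FD; first by apply: FM => //; apply: Tempered_sin => //; apply: TD => //; exact: FT.
apply: FD; apply: FM => //.
- exact: TM.
- apply: (Flat_comp oU cv derivatives_cosm1) => //.
  by rewrite /= cos0 subrr.
- exact: TM.
- apply: (Flat_comp oU cv derivatives_sin) => //.
  by rewrite sin_derivs0 sin0.
Qed.

(** In the coordinate [v = 1 / u], the new reading of the clock is [N / v] with
    [N = 1 + v * clock_shift], and [circle_cos (N / v)], [circle_sin (N / v)] are
    quotients of smooth functions whose denominator [N ^ 2 + v ^ 2] does not vanish,
    not even at [v = 0]. *)
Lemma flow_chart_singular (t0 : R) (x0 : annulus R) :
  (annulus_val x0).1.1 = 1 ->
  exists U (h : V -> R * R * R),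
    [/\ open U, U (t0, annulus_val x0), forall k, class_C k U h &
        forall t x, U (t, annulus_val x) ->
          h (t, annulus_val x) = annulus_val (flow t x)].
Proof.
move=> a1.
have sc : smooth_on sing_dom clock_shift.
  apply: (Flat_smooth oU cv sv Flat_clock_shift) => p _ v0.
  by rewrite /clock_shift v0 eqxx.
have ss : smooth_on sing_dom swing_shift.
  apply: (Flat_smooth oU cv sv Flat_swing_shift) => p _ v0.
  by rewrite /swing_shift v0 eqxx.
pose N p := 1 + half_tan p * clock_shift p.
have sN : smooth_on sing_dom N.
  by apply: smooth_onD => //; [exact: smooth_on_cst|exact: smooth_onM].
have sN2 := smooth_on_sqr oU sN; have sv2 := smooth_on_sqr oU sv.
have den0 p : N p ^+ 2 + half_tan p ^+ 2 != 0.
  have [v0|v0] := eqVneq (half_tan p) 0.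
    by rewrite /N v0 mul0r addr0 expr1n expr0n addr0 oner_neq0.
  by rewrite gt_eqF// ltr_wpDl ?sqr_ge0// exprn_even_gt0.
apply: (@flow_chart _ sing_dom
  (fun p => (N p ^+ 2 - half_tan p ^+ 2) / (N p ^+ 2 + half_tan p ^+ 2))
  (fun p => 2 * (half_tan p * N p) / (N p ^+ 2 + half_tan p ^+ 2))
  swing_shift) => //.
- apply: smooth_on_div => //; first exact: smooth_onB.
  exact: smooth_onD.
- apply: smooth_on_div => //; last exact: smooth_onD.
  by apply: smooth_onM => //; [exact: smooth_on_cst|exact: smooth_onM].
- by split=> //=; rewrite a1.
move=> t x [_ /= aN]; rewrite flow_valE /flow_val.
set p := (t, annulus_val x).
have [/= ab _] := annulus_valP x.
set a := (annulus_val x).1.1 in aN ab *.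
have b2 : (annulus_val x).1.2 ^+ 2 = (1 - a) * (1 + a).
  by rewrite -(addKr (a ^+ 2) (_ ^+ 2)) ab; ring.
have [a1x|a1x] := eqVneq a 1.
  have b0 : (annulus_val x).1.2 = 0.
    by apply/eqP; rewrite -sqrf_eq0 b2 a1x subrr mul0r.
  have v0 : half_tan p = 0 by rewrite /half_tan /= b0 mul0r.
  rewrite /N /swing_shift v0 eqxx expR0 mobius1 !mul0r addr0 expr1n expr0n.
  rewrite subr0 addr0 divr1 mulr0 mul0r.
  by rewrite -{1}a1x -b0 /a; case: (annulus_val x) => [[]].
have a1' : 1 - a != 0 by rewrite subr_eq0 eq_sym.
have b0 : (annulus_val x).1.2 != 0 by rewrite -sqrf_eq0 b2 mulf_neq0.
have v0 : half_tan p != 0 by rewrite /half_tan /= mulf_neq0// invr_eq0.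
have uE : half_cot (annulus_val x) = (half_tan p)^-1.
  rewrite /half_cot /half_tan /= invf_div.
  apply: (mulIf a1'); apply: (mulIf b0); rewrite mulfVK//.
  by rewrite -/a mulrAC divfK// mulrC -expr2 b2 mulrC.
rewrite uE /swing_shift (negbTE v0).
have pt : p.1 = t by [].
have cE : clock t (half_tan p)^-1 = N p / half_tan p.
  by rewrite /N /clock_shift (negbTE v0) pt; field.
rewrite pt cE.
rewrite /circle_cos /circle_sin; congr (_, _, _); field; rewrite v0 ?den0//.
Qed.

Lemma smooth_map_flow : smooth_map (@flow R).
Proof.
move=> t0 x0; have [/flow_chart_singular|/flow_chart_regular] :=
  eqVneq (annulus_val x0).1.1 1; exact.
Qed.

Lemma smooth_flow_flow : smooth_flow (@flow R).
Proof. by split; [exact: flow0|exact: flowD|exact: smooth_map_flow]. Qed.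

End SingularChart.

(** * Equidistribution of the phase *)

Section TimeIntegrals.
Context {R : realType}.
Implicit Types (f g F : R -> R) (a b M : R).
Local Notation leb := (@lebesgue_measure R).

Lemma integrable_bounded_itv g M a b : measurable_fun setT g ->
  (forall t, `|g t| <= M) -> leb.-integrable `[a, b] (EFin \o g).
Proof.
move=> mg gM; apply: measurable_bounded_integrable => //.
- by rewrite /= lebesgue_measure_itv /=; case: ifP => _; rewrite ?ltry.
- exact: measurable_funTS.
- by exists M; split; [exact: num_real|move=> x xM t _; exact: le_trans (ltW xM)].
Qed.

Lemma Rintegral_itv_cst a b (c : R) : a <= b ->
  \int[leb]_(_ in `[a, b]) c = c * (b - a).
Proof.
move=> ab; rewrite Rintegral_cst//= lebesgue_measure_itv /= lte_fin.
by case: ltgtP ab => // -> _; rewrite subrr.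
Qed.

Lemma ler_Rintegral_itv g M a b : measurable_fun setT g ->
  (forall t, `|g t| <= M) -> a <= b ->
  `|\int[leb]_(t in `[a, b]) g t| <= M * (b - a).
Proof.
move=> mg gM ab; have ig := integrable_bounded_itv a b mg gM.
apply: le_trans (le_normr_Rintegral _ ig) _ => //.
rewrite -Rintegral_itv_cst//; apply: le_Rintegral => //.
- apply: (@integrable_bounded_itv (fun t => `|g t|) M).
    exact: measurableT_comp.
  by move=> t; rewrite normr_id.
- exact: (@integrable_bounded_itv (fun=> M) `|M|).
Qed.

Lemma Rintegral_FTC f F a b : a < b ->
  (forall t, a <= t -> is_derive t (1 : R) F (f t)) ->
  (forall t, a <= t -> {for t, continuous f}) ->
  \int[leb]_(t in `[a, b]) f t = F b - F a.
Proof.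
move=> ab dF cf; rewrite /Rintegral (@continuous_FTC2 _ f F)//.
- apply: continuous_in_subspaceT => x; rewrite inE/= in_itv/= => /andP[ax _].
  exact: cf.
- have cF t : a <= t -> {for t, continuous F}.
    move=> at_; apply: differentiable_continuous; apply/derivable1_diffP.
    by case: (dF t at_).
  split.
  + by move=> x; rewrite in_itv/= => /andP[/ltW ax _]; case: (dF x ax).
  + by apply: cvg_at_right_filter; exact: cF.
  + by apply: cvg_at_left_filter; apply: cF; exact: ltW.
- move=> x; rewrite in_itv/= => /andP[/ltW ax _].
  by rewrite derive1E; case: (dF x ax).
Qed.

Definition phase (t : R) := ln (2 * t) ^+ 2.

Lemma measurable_phase : measurable_fun setT phase.
Proof.
by apply: measurable_funX; apply: measurableT_comp.
Qed.

Lemma cvg_ln_pinfty : ln x @[x --> +oo%R] --> (+oo%R : set_system R).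
Proof.
apply/cvgryPge => A; exists (expR A); split; first exact: num_real.
by move=> x Ax; rewrite -(expRK A) ler_ln ?posrE ?expR_gt0 ?(lt_trans _ Ax) ?expR_gt0// ltW.
Qed.

(** With [rho = 1 / phase'], the function [(F \o phase) * rho] has derivative
    [k \o phase + (F \o phase) * rho']. Since the phase is the square of a
    logarithm, [rho = t / (2 ln (2 t))] is negligible with respect to [t]
    and [rho'] tends to [0]; so the average of [k \o phase] tends to [0]. *)
Lemma weyl_phase (F k : R -> R) M :
  (forall x, is_derive x (1 : R) F (k x)) -> continuous k ->
  (forall x, `|F x| <= M) -> (forall x, `|k x| <= M) ->
  T^-1 * \int[leb]_(t in `[0, T]) k (phase t) @[T --> +oo] --> (0 : R).
Proof.
move=> dF ck FM kM.
have M0 : 0 <= M by exact: le_trans (normr_ge0 (F 0)) (FM 0).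
apply/cvgrPdist_le => e e0.
pose d := e / (3 * (M + 1)).
have d0 : 0 < d by rewrite divr_gt0 ?mulr_gt0// ltr_wpDl.
pose L (t : R) := ln (2 * t).
(* The inverse of the derivative of the phase, and its derivative. *)
pose rho (t : R) := t / (2 * L t).
pose drho (t : R) := (2 * L t)^-1 - (2 * L t ^+ 2)^-1.
have [T1 [T10 LT1]] : exists T1, 0 < T1 /\ forall t, T1 <= t -> 1 + d^-1 <= L t.
  have /cvgryPge/(_ (1 + d^-1)) [N [_ HN]] := cvg_ln_pinfty.
  exists (`|N| + 1); split=> [|t Nt]; first by rewrite ltr_wpDl.
  apply: HN; have := ler_norm N; have := normr_ge0 N; lra.
have di0 : 0 < d^-1 by rewrite invr_gt0.
have L0 t : T1 <= t -> 0 < L t by move=> /LT1; lra.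
have Li t : T1 <= t -> (L t)^-1 <= d.
  by move=> T1t; rewrite invf_ple ?posrE ?L0// (le_trans _ (LT1 t T1t))// lerDr.
have rho_le t : T1 <= t -> `|rho t| <= t * d.
  move=> T1t; have t0 := lt_le_trans T10 T1t.
  rewrite /rho invfM ger0_norm ?mulr_ge0 ?invr_ge0 ?(ltW t0) ?(ltW (L0 _ T1t))//.
  rewrite ler_wpM2l ?(ltW t0)//; have := Li t T1t.
  have : 0 < (L t)^-1 by rewrite invr_gt0 L0.
  lra.
have drho_le t : T1 <= t -> `|drho t| <= d.
  move=> T1t; have l0 : 0 < (L t)^-1 by rewrite invr_gt0 L0.
  have l1 : (L t)^-1 <= 1.
    by rewrite invf_le1 ?L0//; have := LT1 t T1t; lra.
  have -> : drho t = (L t)^-1 / 2 * (1 - (L t)^-1).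
    by rewrite /drho; field; rewrite gt_eqF ?L0.
  rewrite ger0_norm; last by rewrite mulr_ge0 ?divr_ge0//; lra.
  apply: le_trans (Li t T1t); rewrite -[leRHS]mulr1.
  by apply: ler_pM; rewrite ?divr_ge0//; lra.
have dL t : T1 <= t -> is_derive t (1 : R) L t^-1.
  move=> T1t; have t0 : 0 < 2 * t by rewrite mulr_gt0// (lt_le_trans T10).
  have d2 : is_derive t (1 : R) (fun x => 2 * x) (2 : R).
    by apply: is_derive_eq; rewrite /GRing.scale /= mulr1.
  apply: is_derive_eq (is_derive1_comp (is_derive1_ln t0) d2) _.
  by field; rewrite gt_eqF// (lt_le_trans T10).
have drhoE t : T1 <= t -> is_derive t (1 : R) rho (drho t).
  move=> T1t; have := dL t T1t => dLt.
  have d2 : is_derive t (1 : R) (fun x => 2 * L x) (2 * t^-1).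
    exact: is_deriveZ.
  have n0 : 2 * L t != 0 by rewrite mulf_neq0// gt_eqF// L0.
  have di := @is_deriveV _ (fun x => 2 * L x) t _ _ n0 d2.
  apply: is_derive_eq (is_deriveM (is_derive_id _ _) di) _.
  rewrite /drho /GRing.scale /=; field.
  by rewrite !gt_eqF ?L0// (lt_le_trans T10).
have dphase t : T1 <= t -> is_derive t (1 : R) phase (2 * L t / t).
  move=> T1t; have := dL t T1t => dLt.
  apply: is_derive_eq (is_deriveM dLt dLt) _.
  rewrite /GRing.scale /= -/(L t); field.
  by rewrite gt_eqF// (lt_le_trans T10).
pose G (t : R) := F (phase t) * rho t.
have dG t : T1 <= t ->
    is_derive t (1 : R) G (k (phase t) + F (phase t) * drho t).
  move=> T1t; have dFp := is_derive1_comp (dF (phase t)) (dphase t T1t).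
  apply: is_derive_eq (is_deriveM dFp (drhoE t T1t)) _.
  rewrite /GRing.scale /= addrC; congr (_ + _).
  by rewrite /rho; field; rewrite !gt_eqF ?L0// (lt_le_trans T10).
have cL t : T1 <= t -> {for t, continuous L}.
  move=> T1t; apply: differentiable_continuous; apply/derivable1_diffP.
  by case: (dL t T1t).
have cG t : T1 <= t ->
    {for t, continuous (fun t => k (phase t) + F (phase t) * drho t)}.
  move=> T1t.
  have cp : {for t, continuous phase}.
    apply: differentiable_continuous; apply/derivable1_diffP.
    by case: (dphase t T1t).
  apply: cvgD; first by apply: (continuous_comp cp); exact: ck.
  apply: cvgM.
    apply: (continuous_comp cp); apply: differentiable_continuous.
    by apply/derivable1_diffP; case: (dF (phase t)).
  have n0 : 2 * L t != 0 by rewrite mulf_neq0// gt_eqF// L0.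
  have n1 : 2 * L t ^+ 2 != 0 by rewrite mulf_neq0// expf_neq0// gt_eqF// L0.
  apply: cvgB; apply: cvgV => //; apply: cvgM; try exact: cvg_cst.
    exact: cL.
  by rewrite expr2; apply: cvgM; exact: cL.
near=> T; rewrite sub0r normrN.
have T1T : T1 < T by near: T; apply: nbhs_pinfty_gt; exact: num_real.
have T0 : 0 < T by exact: lt_trans T1T.
have MT1 : M * T1 <= T * d.
  by rewrite -ler_pdivrMr//; near: T; apply: nbhs_pinfty_ge; exact: num_real.
have mk : measurable_fun setT (fun t => k (phase t)).
  by apply: measurableT_comp; [exact: continuous_measurable_fun|exact: measurable_phase].
have mF : measurable_fun setT (fun t => F (phase t)).
  apply: measurableT_comp; last exact: measurable_phase.
  apply: continuous_measurable_fun => x; apply: differentiable_continuous.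
  by apply/derivable1_diffP; case: (dF x).
pose f t := k (phase t) + F (phase t) * drho t.
have ik : leb.-integrable `[0, T] (EFin \o (fun t => k (phase t))).
  exact: integrable_bounded_itv mk (fun=> kM _).
have ik1 : leb.-integrable `[T1, T] (EFin \o (fun t => k (phase t))).
  exact: integrable_bounded_itv mk (fun=> kM _).
have if1 : leb.-integrable `[T1, T] (EFin \o f).
  apply: continuous_compact_integrable; first exact: segment_compact.
  apply: continuous_in_subspaceT => x; rewrite inE/= in_itv/= => /andP[T1x _].
  exact: cG.
have ifk : leb.-integrable `[T1, T] (EFin \o (fun t => f t - k (phase t))).
  by apply: eq_integrable (integrableB _ if1 ik1) => // x _.
have FTC := Rintegral_FTC T1T dG cG.
have E1 : \int[leb]_(t in `[0, T]) k (phase t) =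
    \int[leb]_(t in `[0, T1]) k (phase t) +
    \int[leb]_(t in `[T1, T]) k (phase t).
  have := Rintegral_itvB (x := T1) ik; rewrite !bnd_simp.
  move=> /(_ (ltW T10) (ltW T1T)); rewrite Rintegral_itv_obnd_cbnd => [<-|].
    by rewrite addrC subrK.
  by apply: integrableS ik1 => //; exact: subset_itv_oc_cc.
(* Each of the three contributions is at most a constant times [d * T]. *)
have B1 : `|\int[leb]_(t in `[0, T1]) k (phase t)| <= M * T1.
  by have := ler_Rintegral_itv mk (fun=> kM _) (ltW T10); rewrite subr0.
have B2 : `|\int[leb]_(t in `[T1, T]) f t -
            \int[leb]_(t in `[T1, T]) k (phase t)| <= M * d * (T - T1).
  rewrite -RintegralB// (le_trans (le_normr_Rintegral _ _))//.
  rewrite -(Rintegral_itv_cst _ (ltW T1T)); apply: le_Rintegral => //.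
  - exact: integrable_norm ifk.
  - exact: (@integrable_bounded_itv (fun=> M * d) `|M * d|).
  - move=> t; rewrite /= in_itv/= => /andP[T1t _].
    rewrite /f addrAC subrr add0r normrM.
    by apply: ler_pM => //; exact: drho_le.
have B3 t : T1 <= t -> t <= T -> `|G t| <= M * (T * d).
  move=> T1t tT; rewrite normrM; apply: ler_pM => //.
  by apply: le_trans (rho_le t T1t) _; rewrite ler_wpM2r// ltW.
have B4 : `|\int[leb]_(t in `[0, T]) k (phase t)| <= 3 * (M + 1) * d * T.
  have BT := B3 T (ltW T1T) (lexx T); have BT1 := B3 T1 (lexx T1) (ltW T1T).
  have MdT1 : 0 <= M * d * T1 by do 2?apply: mulr_ge0 => //; exact: ltW.
  have dT : 0 <= T * d by apply: mulr_ge0; exact: ltW.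
  rewrite E1; move: B1 B2; rewrite FTC.
  move: (\int[leb]_(t in `[0, T1]) _) (\int[leb]_(t in `[T1, T]) _) => x y.
  move: BT BT1; rewrite !ler_norml => /andP[? ?] /andP[? ?] /andP[? ?] /andP[? ?].
  by apply/andP; split; lra.
have -> : e = 3 * (M + 1) * d.
  by rewrite /d mulrC divfK// gt_eqF// mulr_gt0// ltr_wpDl.
by rewrite normrM ger0_norm ?invr_ge0 ?(ltW T0)// mulrC ler_pdivrMr.
Unshelve. all: by end_near. Qed.

End TimeIntegrals.

(** * Periodic profiles with explicit primitives *)

Section PhaseProfiles.
Context {R : realType}.
Implicit Types (e x K : R).

(** Tends to the sign of [sin x] when [e] tends to [0], and has an elementary
    periodic primitive. *)
Definition square_wave e x := sin x / Num.sqrt (sin x ^+ 2 + e ^+ 2).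

Lemma square_wave_den_gt0 e x : 0 < e -> 0 < sin x ^+ 2 + e ^+ 2.
Proof. by move=> e0; rewrite ltr_wpDl ?sqr_ge0// exprn_gt0. Qed.

Lemma continuous_square_wave e : 0 < e -> continuous (square_wave e).
Proof.
move=> e0 x; have d0 := square_wave_den_gt0 x e0.
apply: cvgM; first exact: continuous_sin.
apply: cvgV; first by rewrite gt_eqF// sqrtr_gt0.
apply: continuous_comp; last exact: sqrt_continuous.
apply: cvgD; last exact: cvg_cst.
by rewrite expr2; apply: cvgM; exact: continuous_sin.
Qed.

Lemma square_wave_le1 e x : 0 < e -> `|square_wave e x| <= 1.
Proof.
move=> e0; have d0 := square_wave_den_gt0 x e0.
rewrite normrM normfV (ger0_norm (sqrtr_ge0 _)) ler_pdivrMr ?sqrtr_gt0// mul1r.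
by rewrite -sqrtr_sqr ler_sqrt ?lerDl ?sqr_ge0// ltW.
Qed.

Lemma square_wave_near1 e s x : 0 < e -> 0 < s -> s <= sin x ->
  `|1 - square_wave e x| <= e / s.
Proof.
move=> e0 s0 sx; have d0 := square_wave_den_gt0 x e0.
have x0 : 0 < sin x by exact: lt_le_trans sx.
have D : Num.sqrt (sin x ^+ 2 + e ^+ 2) <= sin x + e.
  rewrite -[leRHS]ger0_norm; last by rewrite addr_ge0 ?ltW.
  rewrite -sqrtr_sqr ler_sqrt ?sqr_ge0//.
  rewrite sqrrD lerD2r lerDl mulrn_wge0// mulr_ge0 ?ltW//.
have q0 : 0 < Num.sqrt (sin x ^+ 2 + e ^+ 2) by rewrite sqrtr_gt0.
rewrite ger0_norm; last first.
  by rewrite subr_ge0 (le_trans (ler_norm _))// square_wave_le1.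
have xq : sin x <= Num.sqrt (sin x ^+ 2 + e ^+ 2).
  rewrite -[leLHS](gtr0_norm x0) -sqrtr_sqr ler_sqrt ?lerDl ?sqr_ge0//.
  exact: ltW.
rewrite /square_wave; set q := Num.sqrt _ in D q0 xq *.
have -> : 1 - sin x / q = (q - sin x) / q by field; rewrite gt_eqF.
rewrite ler_pdivrMr// mulrAC ler_pdivlMr//.
apply: (@le_trans _ _ (e * s)).
  by rewrite ler_wpM2r ?(ltW s0)//; lra.
by rewrite ler_wpM2l ?(ltW e0)//; lra.
Qed.

Lemma square_waveN e x : square_wave e (- x) = - square_wave e x.
Proof. by rewrite /square_wave sinN sqrrN mulNr. Qed.

Lemma square_wave_nearN1 e s x : 0 < e -> 0 < s -> sin x <= - s ->
  `|1 + square_wave e x| <= e / s.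
Proof.
move=> e0 s0 sx; rewrite -[square_wave e x]opprK -square_waveN.
by apply: square_wave_near1 => //; rewrite sinN; lra.
Qed.

Definition square_wave_primitive e x := - asin (cos x / Num.sqrt (1 + e ^+ 2)).

Lemma square_wave_primitiveP e x : 0 < e ->
  is_derive x (1 : R) (square_wave_primitive e) (square_wave e x).
Proof.
move=> e0; have d0 := square_wave_den_gt0 x e0.
have r0 : 0 < 1 + e ^+ 2 by rewrite ltr_wpDr ?sqr_ge0.
set r := Num.sqrt (1 + e ^+ 2).
have r1 : 0 < r by rewrite sqrtr_gt0.
have r2 : r ^+ 2 = 1 + e ^+ 2 by rewrite sqr_sqrtr// ltW.
have c2 : cos x ^+ 2 < r ^+ 2.
  have := cos2Dsin2 x; have := sqr_ge0 (sin x).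
  have : 0 < e ^+ 2 by rewrite exprn_gt0.
  by rewrite r2; lra.
have cr : -1 < cos x / r < 1.
  rewrite -ltr_norml normrM normfV (gtr0_norm r1) ltr_pdivrMr// mul1r.
  by rewrite -(gtr0_norm r1) -ltr_sqr ?nnegrE// !real_normK ?num_real.
have d1 : is_derive x (1 : R) (fun y => cos y / r) (- sin x / r).
  by apply: is_derive_eq; rewrite /GRing.scale /=; field; rewrite gt_eqF.
have := is_deriveN (@is_derive1_comp _ (@asin R) (fun y => cos y / r) x _ _
  (is_derive1_asin cr) d1).
move/is_derive_eq; apply.
have -> : 1 - (cos x / r) ^+ 2 = (sin x ^+ 2 + e ^+ 2) / r ^+ 2.
  have s2 : sin x ^+ 2 = 1 - cos x ^+ 2 by rewrite -(cos2Dsin2 x); ring.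
  rewrite s2 (_ : 1 - _ + _ = r ^+ 2 - cos x ^+ 2); last by rewrite r2; ring.
  by field; rewrite gt_eqF.
rewrite sqrtrM ?ltW// sqrtrV ?sqr_ge0// sqrtr_sqr (gtr0_norm r1) /square_wave.
by field; rewrite !gt_eqF ?sqrtr_gt0.
Qed.

(** A Poisson kernel in the angle [2 x]: a periodic density of mean [1] that
    concentrates near the zeros of the sine when [K] is large. It serves to show
    that the phase spends little time there. *)
Definition zero_comb K x := K / (cos x ^+ 2 + K ^+ 2 * sin x ^+ 2).

Lemma cos2_add_sin2_gt0 K x : 0 < K -> 0 < cos x ^+ 2 + K * sin x ^+ 2.
Proof.
move=> K0; have [s0|s0] := eqVneq (sin x) 0.
  by have := cos2Dsin2 x; rewrite s0 expr0n /= mulr0 addr0 => ->.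
by rewrite ltr_wpDl ?sqr_ge0// mulr_gt0// exprn_even_gt0.
Qed.

Lemma zero_comb_ge0 K x : 0 < K -> 0 <= zero_comb K x.
Proof.
move=> K0; rewrite divr_ge0 ?(ltW K0)// ltW// cos2_add_sin2_gt0//.
by rewrite exprn_gt0.
Qed.

Lemma zero_comb_le K x : 1 <= K -> zero_comb K x <= K.
Proof.
move=> K1; have K0 : 0 < K by lra.
rewrite ler_pdivrMr ?cos2_add_sin2_gt0 ?exprn_gt0// ler_peMr ?(ltW K0)//.
rewrite -[leLHS](cos2Dsin2 x) lerD2l ler_peMl ?sqr_ge0//.
by rewrite expr_ge1// ltW.
Qed.

Lemma zero_comb_near0 K x : 1 <= K -> `|sin x| <= K^-1 -> K / 2 <= zero_comb K x.
Proof.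
move=> K1 sK; have K0 : 0 < K by lra.
rewrite /zero_comb ler_pM2l// lef_pV2 ?posrE ?cos2_add_sin2_gt0 ?exprn_gt0//.
have c1 : cos x ^+ 2 <= 1.
  by have := cos2Dsin2 x; have := sqr_ge0 (sin x); lra.
have s1 : K ^+ 2 * sin x ^+ 2 <= 1.
  rewrite -exprMn -[leLHS]real_normK ?num_real// expr_le1// normrM gtr0_norm//.
  by rewrite mulrC -ler_pdivlMr// mul1r.
lra.
Qed.

Lemma continuous_zero_comb K : 0 < K -> continuous (zero_comb K).
Proof.
move=> K0 x; apply: cvgM; first exact: cvg_cst.
apply: cvgV; first by rewrite gt_eqF// cos2_add_sin2_gt0// exprn_gt0.
apply: cvgD.
  by rewrite expr2; apply: cvgM; exact: continuous_cos.
apply: cvgM; first exact: cvg_cst.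
by rewrite expr2; apply: cvgM; exact: continuous_sin.
Qed.

(** The angle between [x] and the lift of [atan (K * tan x)], which is what
    integrates [zero_comb K - 1]; the subtraction formula for the tangent makes
    it smooth across the poles of [tan]. *)
Definition zero_comb_primitive K x :=
  atan ((K - 1) * (sin x * cos x) / (cos x ^+ 2 + K * sin x ^+ 2)).

Lemma zero_comb_primitiveP K x : 0 < K ->
  is_derive x (1 : R) (zero_comb_primitive K) (zero_comb K x - 1).
Proof.
move=> K0; have d0 := cos2_add_sin2_gt0 x K0.
have dK := cos2_add_sin2_gt0 x (exprn_gt0 2 K0).
have csE := cos2Dsin2 x.
have dN : is_derive x (1 : R) (fun y => (K - 1) * (sin y * cos y))
    ((K - 1) * (cos x ^+ 2 - sin x ^+ 2)).
  by apply: is_derive_eq; rewrite /GRing.scale /=; ring.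
have dD : is_derive x (1 : R) (fun y => cos y ^+ 2 + K * sin y ^+ 2)
    (2 * (K - 1) * (sin x * cos x)).
  have E (c s : R) : c * - s + c * - s + K * (s * c + s * c) =
    2 * (K - 1) * (s * c) by ring.
  by apply: is_derive_eq; exact: E.
have dV := @is_deriveV _ (fun y => cos y ^+ 2 + K * sin y ^+ 2) x _ _
  (lt0r_neq0 d0) dD.
have dQ := is_deriveM dN dV.
have := @is_derive1_comp _ (@atan R)
  (fun y => (K - 1) * (sin y * cos y) / (cos y ^+ 2 + K * sin y ^+ 2)) x _ _
  (is_derive1_atan _) dQ.
move/is_derive_eq; apply; rewrite /zero_comb /GRing.scale /=.
move: csE dK d0; move: (cos x) (sin x) => c s csE dK d0.
have D2 : (c ^+ 2 + K * s ^+ 2) ^+ 2 + ((K - 1) * (s * c)) ^+ 2 =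
    c ^+ 2 + K ^+ 2 * s ^+ 2.
  transitivity ((c ^+ 2 + s ^+ 2) * (c ^+ 2 + K ^+ 2 * s ^+ 2)); first by ring.
  by rewrite csE mul1r.
have -> : 1 + ((K - 1) * (s * c) * (c ^+ 2 + K * s ^+ 2)^-1) ^+ 2 =
    (c ^+ 2 + K ^+ 2 * s ^+ 2) / (c ^+ 2 + K * s ^+ 2) ^+ 2.
  by rewrite -D2; field; rewrite gt_eqF.
have -> : K / (c ^+ 2 + K ^+ 2 * s ^+ 2) - 1 =
   (K - 1) * (c ^+ 2 - K * s ^+ 2) / (c ^+ 2 + K ^+ 2 * s ^+ 2).
  rewrite -[1 in LHS](divff (lt0r_neq0 dK)) -mulrBl; congr (_ / _).
  transitivity (K * (c ^+ 2 + s ^+ 2) - (c ^+ 2 + K ^+ 2 * s ^+ 2)); last by ring.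
  by rewrite csE mulr1.
have E : (K - 1) * (c ^+ 2 - s ^+ 2) * (c ^+ 2 + K * s ^+ 2) -
   (K - 1) * (s * c) * (2 * (K - 1) * (s * c)) =
   (K - 1) * (c ^+ 2 - K * s ^+ 2).
  transitivity ((c ^+ 2 + s ^+ 2) * ((K - 1) * (c ^+ 2 - K * s ^+ 2))); first by ring.
  by rewrite csE mul1r.
rewrite -E; field.
by rewrite exprMn !gt_eqF.
Qed.

Lemma norm_atan_le x : `|atan x| <= pi.
Proof.
have := atan_gtNpi2 x; have := atan_ltpi2 x; have := pi_gt0 R.
by rewrite ler_norml; move=> ? ? ?; apply/andP; split; lra.
Qed.

Lemma norm_square_wave_primitive_le e x : 0 < e ->
  `|square_wave_primitive e x| <= pi.
Proof.
move=> e0; rewrite normrN.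
have r1 : 0 < Num.sqrt (1 + e ^+ 2) by rewrite sqrtr_gt0 ltr_wpDr ?sqr_ge0.
have /andP[c1 c2] : -1 <= cos x / Num.sqrt (1 + e ^+ 2) <= 1.
  rewrite -ler_norml normrM normfV (gtr0_norm r1) ler_pdivrMr// mul1r.
  apply: (@le_trans _ _ 1); first by rewrite ler_norml cos_geN1 cos_le1.
  by rewrite -[leLHS]sqrtr1 ler_sqrt ?lerDl ?sqr_ge0// addr_ge0 ?sqr_ge0.
have := asin_geNpi2; have := asin_lepi2; have := pi_gt0 R.
move=> p0 /(_ R (cos x / Num.sqrt (1 + e ^+ 2))); rewrite c1 c2 => /(_ isT) u.
move=> /(_ R (cos x / Num.sqrt (1 + e ^+ 2))); rewrite c1 c2 => /(_ isT) l.
by rewrite ler_norml; apply/andP; split; lra.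
Qed.

End PhaseProfiles.

(** * Time averages of switching observables *)

Section Switching.
Context {R : realType}.
Local Notation leb := (@lebesgue_measure R).

(** Nothing is required while the sine is close to [0]. *)
Definition switching (g : R -> R) (c d : R) :=
  forall s eta : R, 0 < s -> 0 < eta -> \forall t \near +oo,
    (s <= sin (phase t) -> `|g t - c| <= eta) /\
    (sin (phase t) <= - s -> `|g t - d| <= eta).

(** Compare [g] with the profile [(c + d) / 2 + (c - d) / 2 * square_wave (phase t)],
    whose average tends to [(c + d) / 2]. The error is small at the times when the
    sine of the phase is not small; at the other times it is bounded by a small
    multiple of [zero_comb], whose average tends to [1]. *)
Lemma switching_average (g : R -> R) (c d M : R) : measurable_fun setT g ->
  (forall t, `|g t| <= M) -> `|c| <= M -> `|d| <= M -> switching g c d ->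
  T^-1 * \int[leb]_(t in `[0, T]) g t @[T --> +oo] --> (c + d) / 2.
Proof.
move=> mg gM cM dM sw.
have M0 : 0 <= M by exact: le_trans (normr_ge0 c) cM.
apply/cvgrPdist_le => e e0.
(* The sine of the phase counts as small below [1 / K]; the wave is smoothed at
   the scale [v = K ^ -2], so that it is within [v / K^-1 = 1 / K] of the sign
   elsewhere. The weight [6 * z] makes [6 * z * zero_comb K] exceed the bound
   [3 * M] of the error where the sine is small. *)
pose K := 1 + 100 * (M + 1) / e.
have K1 : 1 <= K by rewrite lerDl divr_ge0 ?(ltW e0)// mulr_ge0// addr_ge0.
have K0 : 0 < K by lra.
have KM : (M + 1) / K <= e / 100.
  rewrite ler_pdivrMr// (_ : e / 100 * K = e / 100 + (M + 1)); first by lra.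
  by rewrite /K; field; rewrite gt_eqF.
pose z := (M + 1) / K.
have z0 : 0 <= z by rewrite divr_ge0 ?(ltW K0)// addr_ge0.
pose v := K ^- 2.
have v0 : 0 < v by rewrite invr_gt0 exprn_gt0.
have vK : v / K^-1 = K^-1 by rewrite invrK /v; field; rewrite gt_eqF.
have Ki0 : 0 < K^-1 by rewrite invr_gt0.
have [T0 HT0] : exists T0 : R, 0 < T0 /\ forall t, T0 <= t ->
    (K^-1 <= sin (phase t) -> `|g t - c| <= e / 10) /\
    (sin (phase t) <= - K^-1 -> `|g t - d| <= e / 10).
  have e10 : 0 < e / 10 by rewrite divr_gt0.
  have [T0 [_ H]] := sw _ _ Ki0 e10; exists (`|T0| + 1); split=> [|t Tt].
    by rewrite ltr_wpDl.
  by apply: H; have := ler_norm T0; lra.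
case: HT0 => T00 HT0.
pose h t := square_wave v (phase t).
pose k t := zero_comb K (phase t) - 1.
pose i0 : R -> R := \1_(`[0, T0]%classic).
pose r t := (e / 10 + z + 6 * z) + (6 * z * k t + 3 * M * i0 t).
pose err t := g t - (c + d) / 2 - (c - d) / 2 * h t.
have h1 t : `|h t| <= 1 by exact: square_wave_le1.
have cdM : `|(c - d) / 2| <= M.
  by move: cM dM; rewrite !ler_norml => /andP[? ?] /andP[? ?]; apply/andP; split; lra.
have err_M t : `|err t| <= 3 * M.
  have Mh : `|(c - d) / 2 * h t| <= M.
    by rewrite normrM -[leRHS]mulr1 ler_pM.
  move: (gM t) cM dM Mh; rewrite /err !ler_norml.
  by move=> /andP[? ?] /andP[? ?] /andP[? ?] /andP[? ?]; apply/andP; split; lra.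
have k1 t : 0 <= k t + 1 by rewrite /k subrK zero_comb_ge0.
have i01 t : 0 <= i0 t by rewrite /i0 indicE.
have zk t : 0 <= 6 * z * (k t + 1).
  by apply: mulr_ge0 => //; exact: mulr_ge0.
have err_r t : 0 <= t -> `|err t| <= r t.
  move=> t0; have [Tt|tT] := leP T0 t; last first.
    have it : i0 t = 1 by rewrite /i0 indicE mem_set//= in_itv/= t0 ltW.
    apply: le_trans (err_M t) _; rewrite /r it mulr1.
    have := zk t; rewrite mulrDr mulr1; lra.
  have Mi : 0 <= 3 * M * i0 t by apply: mulr_ge0 => //; exact: mulr_ge0.
  have := zk t => {}zk.
  have Mz : M * K^-1 <= z by rewrite ler_wpM2r ?(ltW Ki0)// lerDl.
  have [H1 H2] := HT0 t Tt.
  have [s1|s1] := leP K^-1 (sin (phase t)).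
    have hh : `|(c - d) / 2 * (1 - h t)| <= z.
      rewrite normrM (le_trans _ Mz)// ler_pM//.
      by rewrite -vK; exact: square_wave_near1.
    have -> : err t = (g t - c) + (c - d) / 2 * (1 - h t).
      by rewrite /err; field.
    rewrite (le_trans (ler_normD _ _))// /r; have := H1 s1.
    by rewrite mulrDr mulr1 in zk; lra.
  have [s2|s2] := leP (sin (phase t)) (- K^-1).
    have hh : `|(c - d) / 2 * (1 + h t)| <= z.
      rewrite normrM (le_trans _ Mz)// ler_pM//.
      by rewrite -vK; exact: square_wave_nearN1.
    have -> : err t = (g t - d) - (c - d) / 2 * (1 + h t).
      by rewrite /err; field.
    rewrite (le_trans (ler_normB _ _))// /r; have := H2 s2.
    by rewrite mulrDr mulr1 in zk; lra.
  apply: le_trans (err_M t) _.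
  have sK : `|sin (phase t)| <= K^-1 by rewrite ler_norml !ltW.
  have kK := zero_comb_near0 K1 sK.
  have : 3 * M <= 6 * z * (k t + 1).
    apply: (@le_trans _ _ (6 * z * (K / 2))).
      by rewrite (_ : 6 * z * (K / 2) = 3 * (M + 1)); [lra|rewrite /z; field; rewrite gt_eqF].
    by apply: ler_wpM2l; [exact: mulr_ge0|rewrite /k subrK].
  by rewrite /r mulrDr mulr1; lra.
have mh : measurable_fun setT h.
  apply: measurableT_comp; last exact: measurable_phase.
  by apply: continuous_measurable_fun; exact: continuous_square_wave.
have mk : measurable_fun setT k.
  apply: measurable_funB => //.
  apply: measurableT_comp; last exact: measurable_phase.
  by apply: continuous_measurable_fun; exact: continuous_zero_comb.
have mi : measurable_fun setT i0 by exact: measurable_indic.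
have merr : measurable_fun setT err.
  apply: measurable_funB; first exact: measurable_funB.
  exact: measurable_funM.
have kK t : `|k t| <= K.
  have := zero_comb_le (phase t) K1; have := k1 t; rewrite /k ler_norml.
  by move=> ? ?; apply/andP; split; lra.
have i1 t : `|i0 t| <= 1.
  by rewrite /i0 indicE; case: (_ \in _); rewrite ?normr1 ?normr0.
have Wh : T^-1 * \int[leb]_(t in `[0, T]) h t @[T --> +oo] --> (0 : R).
  apply: (@weyl_phase R (square_wave_primitive v) (square_wave v) (pi + 1)).
  - by move=> x; exact: square_wave_primitiveP.
  - exact: continuous_square_wave.
  - by move=> x; rewrite (le_trans (norm_square_wave_primitive_le x v0))// lerDl.
  - by move=> x; rewrite (le_trans (square_wave_le1 x v0))// lerDr pi_ge0.
have Wk : T^-1 * \int[leb]_(t in `[0, T]) k t @[T --> +oo] --> (0 : R).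
  apply: (@weyl_phase R (zero_comb_primitive K) (fun x => zero_comb K x - 1)
    (pi + K)).
  - by move=> x; exact: zero_comb_primitiveP.
  - move=> x; apply: cvgB; last exact: cvg_cst.
    exact: continuous_zero_comb.
  - by move=> x; rewrite (le_trans (norm_atan_le _))// lerDl ltW.
  - move=> x; rewrite ler_norml; have := zero_comb_le x K1.
    have := zero_comb_ge0 x K0; have := pi_ge0 R.
    by move=> ? ? ?; apply/andP; split; lra.
move/cvgrPdist_le : Wh => Wh; move/cvgrPdist_le : Wk => Wk.
have eM0 : 0 < e / (10 * (M + 1)) by rewrite divr_gt0 ?mulr_gt0// ltr_wpDl.
near=> T.
have T0T : 0 < T by near: T; apply: nbhs_pinfty_gt; exact: num_real.
have HT : 30 * M * T0 / e <= T.
  by near: T; apply: nbhs_pinfty_ge; exact: num_real.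
have Ah : `|T^-1 * \int[leb]_(t in `[0, T]) h t| <= e / (10 * (M + 1)).
  by rewrite -normrN -sub0r; near: T; exact: Wh.
have Ak : `|T^-1 * \int[leb]_(t in `[0, T]) k t| <= 1.
  by rewrite -normrN -sub0r; near: T; exact: Wk.
have intb (f : R -> R) (N : R) : measurable_fun setT f -> (forall t : R, `|f t| <= N) ->
  leb.-integrable `[0, T] (EFin \o f) by exact: integrable_bounded_itv.
have ih := intb _ _ mh h1; have ik := intb _ _ mk kK.
have ii := intb _ _ mi i1; have ie := intb _ _ merr err_M.
have ig := intb _ _ mg gM.
have icst (x : R) : leb.-integrable `[0, T] (EFin \o (fun=> x)).
  exact: (intb _ `|x|).
have cstE (x : R) : \int[leb]_(_ in `[0, T]) x = x * T.
  by rewrite (Rintegral_itv_cst _ (ltW T0T)) subr0.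
have iZ (f : R -> R) (N x : R) : measurable_fun setT f ->
    (forall t : R, `|f t| <= N) ->
    leb.-integrable `[0, T] (EFin \o (fun t => x * f t)).
  move=> mf fN; apply: (intb _ (`|x| * N)); first exact: measurable_funM.
  by move=> t; rewrite normrM ler_wpM2l.
have iD (f1 f2 : R -> R) : leb.-integrable `[0, T] (EFin \o f1) ->
    leb.-integrable `[0, T] (EFin \o f2) ->
    leb.-integrable `[0, T] (EFin \o (fun t => f1 t + f2 t)).
  by move=> i1' i2'; apply: eq_integrable (integrableD _ i1' i2') => // x _.
have Ierr : \int[leb]_(t in `[0, T]) err t = \int[leb]_(t in `[0, T]) g t -
    ((c + d) / 2 * T + (c - d) / 2 * \int[leb]_(t in `[0, T]) h t).
  rewrite -RintegralZl// -cstE -RintegralD//; last exact: iZ mh h1.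
  rewrite -RintegralB//; last by apply: iD => //; exact: iZ mh h1.
  by apply: eq_Rintegral => t _; rewrite /err; ring.
have ir1 : leb.-integrable `[0, T] (EFin \o (fun t => 6 * z * k t)).
  exact: iZ mk kK.
have ir2 : leb.-integrable `[0, T] (EFin \o (fun t => 3 * M * i0 t)).
  exact: iZ mi i1.
have ir : leb.-integrable `[0, T] (EFin \o r).
  by apply: (iD) => //; exact: iD.
have Ii : \int[leb]_(t in `[0, T]) i0 t <= T0.
  rewrite /Rintegral integral_indic//.
  have H : (leb (`[0%R, T0]%classic `&` `[0%R, T]%classic) <= T0%:E)%E.
    apply: (@le_trans _ _ (leb `[0, T0]%classic)).
      by apply: le_measure; rewrite ?inE//; exact: measurableI.
    by rewrite /= lebesgue_measure_itv /= lte_fin T00 -EFinB subr0.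
  by rewrite -lee_fin fineK// ge0_fin_numE// (le_lt_trans H (ltry _)).
have Ir : \int[leb]_(t in `[0, T]) r t <=
    (e / 10 + z + 6 * z) * T + (6 * z * \int[leb]_(t in `[0, T]) k t + 3 * M * T0).
  rewrite RintegralD//; last exact: iD.
  rewrite cstE lerD2l RintegralD// !RintegralZl// lerD2l.
  by apply: ler_wpM2l => //; exact: mulr_ge0.
have Ie : `|\int[leb]_(t in `[0, T]) err t| <= \int[leb]_(t in `[0, T]) r t.
  apply: le_trans (le_normr_Rintegral _ ie) _ => //.
  apply: le_Rintegral => //; first exact: integrable_norm ie.
  by move=> t /=; rewrite in_itv/= => /andP[t0 _]; exact: err_r.
have TV : 0 < T^-1 by rewrite invr_gt0.
have -> : (c + d) / 2 - T^-1 * \int[leb]_(t in `[0, T]) g t =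
    - (T^-1 * \int[leb]_(t in `[0, T]) err t +
       (c - d) / 2 * (T^-1 * \int[leb]_(t in `[0, T]) h t)).
  by rewrite Ierr; field; rewrite gt_eqF.
rewrite normrN (le_trans (ler_normD _ _))//.
have B1 : `|(c - d) / 2 * (T^-1 * \int[leb]_(t in `[0, T]) h t)| <= e / 10.
  rewrite normrM (_ : e / 10 = (M + 1) * (e / (10 * (M + 1)))); last first.
    by field; rewrite gt_eqF// ltr_wpDl.
  by apply: ler_pM => //; apply: le_trans cdM _; rewrite lerDl.
have B2 : `|T^-1 * \int[leb]_(t in `[0, T]) err t| <=
   (e / 10 + z + 6 * z) + (6 * z * 1 + e / 10).
  rewrite normrM (gtr0_norm TV).
  apply: (le_trans (ler_wpM2l (ltW TV) (le_trans Ie Ir))).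
  move: Ak; move: (\int[leb]_(t in `[0, T]) k t) => Ik Ak.
  have -> : T^-1 * ((e / 10 + z + 6 * z) * T + (6 * z * Ik + 3 * M * T0)) =
      (e / 10 + z + 6 * z) + (6 * z * (T^-1 * Ik) + 3 * M * T0 / T).
    by field; rewrite gt_eqF.
  rewrite lerD2l; apply: lerD.
    apply: ler_wpM2l; first exact: mulr_ge0.
    exact: le_trans (ler_norm _) Ak.
  by rewrite ler_pdivrMr//; move: HT; rewrite ler_pdivrMr//; lra.
by apply: le_trans (lerD B2 B1) _; move: KM; rewrite -/z; lra.
Unshelve. all: by end_near. Qed.

End Switching.

(** * Asymptotics of the clock *)

Section SwitchingOrbits.
Context {R : realType}.
Implicit Types (s t u w y q : R).

Lemma sin_lipschitz (a b : R) : `|sin a - sin b| <= `|a - b|.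
Proof.
wlog ab : a b / b <= a.
  by move=> H; have [|/ltW] := leP b a; [exact: H|rewrite distrC (distrC a); exact: H].
have [|x _ ->] := @MVT_segment R sin cos b a ab.
  by apply: continuous_subspaceT; exact: continuous_sin.
by rewrite normrM ler_piMl// ler_norml cos_geN1 cos_le1.
Qed.

Lemma ln_le_sub1 (x : R) : 0 < x -> ln x <= x - 1.
Proof. by move=> x0; have := expR_ge1Dx (ln x); rewrite lnK//; lra. Qed.

(** From [ln r <= r - 1] for [r] and for its inverse. *)
Lemma norm_ln_le (r c : R) : `|r - 1| <= c -> c <= 1 / 2 -> `|ln r| <= 2 * c.
Proof.
rewrite !ler_norml => /andP[r1 r2] c2.
have r0 : 0 < r by lra.
have L1 := ln_le_sub1 r0.
have ri0 : 0 < r^-1 by rewrite invr_gt0.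
have := ln_le_sub1 ri0; rewrite lnV ?posrE// => L2.
apply/andP; split; last by lra.
have : r^-1 <= 1 + 2 * c.
  rewrite -[leLHS]mul1r ler_pdivrMr//.
  apply: (@le_trans _ _ ((1 + 2 * c) * (1 - c))); last by rewrite ler_wpM2l//; lra.
  have : 0 <= c * (1 / 2 - c) by rewrite mulr_ge0//; lra.
  by lra.
by lra.
Qed.

Lemma cvg_ln2_pinfty : ln (2 * t) @[t --> +oo%R] --> (+oo%R : set_system R).
Proof.
apply/cvgryPge => A; have /cvgryPge/(_ A) [N [_ HN]] := @cvg_ln_pinfty R.
exists `|N|; split; first exact: num_real.
by move=> x Nx; apply: HN; have := ler_norm N; have := normr_ge0 N; lra.
Qed.

Lemma near_pinfty_ge (a : R) : \forall t \near +oo, a <= t.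
Proof. by apply: nbhs_pinfty_ge; exact: num_real. Qed.

(** With [w = sinh u], the clock is [ln (2 (w + t) + O(1))]. *)
Lemma clock_asympt u : exists k : R, 0 < k /\
  \forall t \near +oo, `|clock t u - ln (2 * t)| <= k / t.
Proof.
pose w := sinh u; pose c := `|w| + 1.
have c0 : 0 < c by rewrite ltr_wpDl.
exists (2 * c); split; first by rewrite mulr_gt0.
near=> t.
have tc : 2 * c <= t by near: t; exact: near_pinfty_ge.
have t0 : 0 < t by lra.
have wn := ler_norm w; have wn' := ler_norm (- w); rewrite normrN in wn'.
have v0 : 0 < w + t by rewrite /c in tc; lra.
pose z := w + t + Num.sqrt ((w + t) ^+ 2 + 1).
have z0 : 0 < z by exact: asinh_arg_gt0.
have z1 : 2 * (w + t) <= z.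
  have : w + t <= Num.sqrt ((w + t) ^+ 2 + 1).
    rewrite -[leLHS](gtr0_norm v0) -sqrtr_sqr ler_sqrt ?lerDl//.
    by rewrite addr_ge0 ?sqr_ge0.
  by rewrite /z; lra.
have z2 : z <= 2 * (w + t) + 1.
  have : Num.sqrt ((w + t) ^+ 2 + 1) <= w + t + 1.
    have v1 : 0 <= w + t + 1 by lra.
    rewrite -[leRHS](ger0_norm v1) -sqrtr_sqr ler_sqrt ?sqr_ge0//.
    by rewrite (_ : (w + t + 1) ^+ 2 = (w + t) ^+ 2 + 1 + 2 * (w + t)) ?lerDl; [lra|ring].
  by rewrite /z; lra.
have -> : clock t u - ln (2 * t) = ln (z / (2 * t)).
  by rewrite ln_div ?posrE ?mulr_gt0.
rewrite -mulrA; apply: norm_ln_le; last by rewrite ler_pdivrMr//; lra.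
have -> : z / (2 * t) - 1 = (z - 2 * t) / (2 * t) by field; rewrite gt_eqF.
rewrite normrM normfV [`|2 * t|]gtr0_norm ?mulr_gt0// ler_pdivrMr ?mulr_gt0//.
rewrite (_ : c / t * (2 * t) = 2 * c); last by field; rewrite gt_eqF.
by rewrite ler_norml /c; apply/andP; split; lra.
Unshelve. all: by end_near. Qed.

Lemma ln_le_quot (x : R) : 1 < x -> ln x / x <= 4 / ln x.
Proof.
move=> x1; have x0 : 0 < x by exact: lt_trans x1.
have L0 : 0 < ln x by exact: ln_gt0.
rewrite ler_pdivrMr// mulrAC ler_pdivlMr//.
have : ln x / 2 <= expR (ln x / 2) by have := expR_ge1Dx (ln x / 2); lra.
move=> H.
have : (ln x / 2) * (ln x / 2) <= expR (ln x / 2) * expR (ln x / 2).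
  by apply: ler_pM => //; rewrite divr_ge0// ltW.
by rewrite -expRD -splitr lnK//; lra.
Qed.

Lemma clock_pinfty u : clock t u @[t --> +oo%R] --> (+oo%R : set_system R).
Proof.
have [k [k0 H]] := clock_asympt u.
apply/cvgryPge => A; near=> t.
have t1 : k + 1 <= t by near: t; exact: near_pinfty_ge.
have Ht : `|clock t u - ln (2 * t)| <= k / t by near: t; exact: H.
have kt : k / t <= 1 by rewrite ler_pdivrMr; lra.
have LA : A + 1 <= ln (2 * t).
  by near: t; have /cvgryPge := cvg_ln2_pinfty; exact.
by move: Ht; rewrite ler_norml => /andP[? ?]; lra.
Unshelve. all: by end_near. Qed.

(** The difference of the squares is the product of [O(1 / t)] with a sum of
    logarithms. This is what makes the phases of all orbits agree. *)
Lemma clock_phase u (e : R) : 0 < e ->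
  \forall t \near +oo, `|clock t u ^+ 2 - phase t| <= e.
Proof.
move=> e0; have [k [k0 H]] := clock_asympt u.
near=> t.
have t1 : k + 1 <= t by near: t; exact: near_pinfty_ge.
have t0 : 0 < t by lra.
have Ht : `|clock t u - ln (2 * t)| <= k / t by near: t; exact: H.
have kt : k / t <= 1 by rewrite ler_pdivrMr; lra.
have kte : k / t <= e / 2.
  have : k / (e / 2) <= t by near: t; exact: near_pinfty_ge.
  by rewrite !ler_pdivrMr ?divr_gt0// [t * _]mulrC.
have LA : 1 + 32 * k / e <= ln (2 * t).
  by near: t; have /cvgryPge := cvg_ln2_pinfty; exact.
have ke0 : 0 < 32 * k / e by rewrite divr_gt0 ?mulr_gt0.
have L0 : 0 < ln (2 * t) by lra.
have t2 : 1 < 2 * t by lra.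
have Q := ln_le_quot t2.
rewrite /phase; move: Ht Q LA L0; move: (clock t u) (ln (2 * t)) => a L Ht Q LA L0.
rewrite subr_sqr normrM.
have aL : `|a + L| <= 2 * L + 1.
  by move: Ht; rewrite !ler_norml => /andP[? ?]; apply/andP; split; lra.
apply: (le_trans (ler_pM _ _ Ht aL)) => //.
have -> : k / t * (2 * L + 1) = 4 * k * (L / (2 * t)) + k / t.
  by field; rewrite gt_eqF.
have E1 : 4 * k * (L / (2 * t)) <= e / 2.
  apply: (@le_trans _ _ (4 * k * (4 / L))).
    by rewrite ler_wpM2l// mulr_ge0// ltW.
  rewrite mulrA ler_pdivrMr// -ler_pdivrMl ?divr_gt0//.
  by rewrite (_ : (e / 2)^-1 * (4 * k * 4) = 32 * k / e); [lra|field; rewrite gt_eqF].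
by lra.
Unshelve. all: by end_near. Qed.

End SwitchingOrbits.

(** * The chordal distance *)

Section AnnulusMetric.
Context {R : realType}.
Local Notation X := (annulus R).
Implicit Types x y : X.

Definition chordal x y : R := `|annulus_val x - annulus_val y|.

Lemma continuous_annulus_val : continuous (@annulus_val R).
Proof. exact: initial_continuous. Qed.

Lemma chordal_ge0 x y : 0 <= chordal x y.
Proof. exact: normr_ge0. Qed.

Lemma chordalxx x : chordal x x = 0.
Proof. by rewrite /chordal subrr normr0. Qed.

Lemma chordal_eq0 x y : chordal x y = 0 -> x = y.
Proof.
by move/eqP; rewrite normr_eq0 subr_eq0 => /eqP; exact: annulus_val_inj.
Qed.

Lemma continuous_chordal x : continuous (chordal x).
Proof.
move=> y.
have c : annulus_val z @[z --> y] --> (annulus_val y : (R * R * R)%type).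
  exact: continuous_annulus_val.
exact: cvg_norm (cvgB (cvg_cst (annulus_val x : (R * R * R)%type)) c).
Qed.

Lemma nbhs_chordal x (U : set X) : nbhs x U ->
  exists2 e : R, 0 < e & forall y, chordal x y < e -> U y.
Proof.
rewrite nbhsE => -[V [[W oW <-] Wx] VU].
have : nbhs (annulus_val x) W by exact: open_nbhs_nbhs.
move=> /nbhs_ballP[e /= e0 eW]; exists e => // y xy.
have Wy : W (annulus_val y) by apply: eW; rewrite -ball_normE.
exact: VU.
Qed.

Lemma chordal_lt (a b h : R) x (e : R) :
  `|(annulus_val x).1.1 - a| < e -> `|(annulus_val x).1.2 - b| < e ->
  `|(annulus_val x).2 - h| < e ->
  forall y, annulus_val y = (a, b, h) -> chordal y x < e.
Proof.
rewrite /chordal; case: (annulus_val x) => [[a' b'] h'] /= Ha Hb Hh y ->.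
by rewrite distrC !prod_normE /= !gt_max Ha Hb
  Hh.
Qed.

End AnnulusMetric.

(** * Orbits switch between the two poles *)

Section SwitchingFlow.
Context {R : realType}.
Implicit Types (s t u y q e : R).

(** The two limit points are visited according to the sign of the sine of one
    and the same phase for all orbits; pairs of orbits inherit the property for
    that reason. *)
Definition switching_orbit {X : topologicalType} (o : R -> X) (p q : X) :=
  forall s, 0 < s -> forall U V : set X, nbhs p U -> nbhs q V ->
  \forall t \near +oo, (s <= sin (phase t) -> U (o t)) /\
                       (sin (phase t) <= - s -> V (o t)).

Lemma switching_orbit_pair {X Y : topologicalType} (o1 : R -> X) (o2 : R -> Y)
    (p1 q1 : X) (p2 q2 : Y) :
  switching_orbit o1 p1 q1 -> switching_orbit o2 p2 q2 ->
  switching_orbit (fun t => (o1 t, o2 t)) (p1, p2) (q1, q2).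
Proof.
move=> H1 H2 s s0 U V [[U1 U2] /= [nU1 nU2] UU] [[V1 V2] /= [nV1 nV2] VV].
have {}H1 := H1 s s0 U1 V1 nU1 nV1; have {}H2 := H2 s s0 U2 V2 nU2 nV2.
near=> t.
have [a1 b1] : (s <= sin (phase t) -> U1 (o1 t)) /\
  (sin (phase t) <= - s -> V1 (o1 t)) by near: t; exact: H1.
have [a2 b2] : (s <= sin (phase t) -> U2 (o2 t)) /\
  (sin (phase t) <= - s -> V2 (o2 t)) by near: t; exact: H2.
by split=> st; [apply: UU|apply: VV]; split=> /=; auto.
Unshelve. all: by end_near. Qed.

Lemma switching_orbit_comp {X : topologicalType} (o : R -> X) (p q : X)
    (f : X -> R) :
  continuous f -> switching_orbit o p q -> switching (f \o o) (f p) (f q).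
Proof.
move=> cf H s eta s0 eta0.
have Np r : nbhs r [set z | `|f z - f r| <= eta].
  have /cvgrPdist_le/(_ _ eta0) := cf r.
  by apply: filterS => z; rewrite distrC.
exact: H s s0 _ _ (Np p) (Np q).
Qed.

Lemma swing_large s (A u : R) : 0 < s -> 1 + `|A| / s <= u -> s <= sin (u ^+ 2) ->
  A <= swing u.
Proof.
move=> s0 Au su; have A0 : 0 <= `|A| / s by rewrite divr_ge0 ?(ltW s0).
apply: (le_trans (ler_norm _)); rewrite -[`|A|](divfK (lt0r_neq0 s0)).
by apply: ler_pM; rewrite ?(ltW s0)//; lra.
Qed.

Lemma swing_small s (A u : R) : 0 < s -> 1 + `|A| / s <= u ->
  sin (u ^+ 2) <= - s -> swing u <= A.
Proof.
move=> s0 Au su; have A0 : 0 <= `|A| / s by rewrite divr_ge0 ?(ltW s0).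
have : `|A| <= u * - sin (u ^+ 2).
  rewrite -[`|A|](divfK (lt0r_neq0 s0)).
  by apply: ler_pM; rewrite ?(ltW s0)//; lra.
by rewrite /swing mulrN; have := ler_norm (- A); rewrite normrN; lra.
Qed.

Lemma mobius_near1 y e : -1 < y < 1 -> 0 < e ->
  exists2 A : R, 0 < A & forall q, A <= q -> `|mobius q y - 1| < e.
Proof.
move=> /andP[y1 y2] e0.
have y3 : 0 < 1 + y by lra.
pose A := 2 * (1 - y) / ((1 + y) * e) + 1.
have Ap : 0 < 2 * (1 - y) / ((1 + y) * e).
  by rewrite divr_gt0// mulr_gt0//; lra.
exists A; first by rewrite addr_gt0.
move=> q Aq; have q0 : 0 < q by rewrite (lt_le_trans _ Aq)// addr_gt0.
have d0 : 0 < (1 + y) * q + (1 - y) by rewrite addr_gt0 ?mulr_gt0//; lra.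
have -> : mobius q y - 1 = - (2 * (1 - y) / ((1 + y) * q + (1 - y))).
  by rewrite /mobius; field; rewrite gt_eqF.
rewrite normrN gtr0_norm; last by rewrite divr_gt0// mulr_gt0//; lra.
rewrite ltr_pdivrMr//.
have : 2 * (1 - y) / ((1 + y) * e) < q by rewrite (lt_le_trans _ Aq)// ltrDl.
rewrite ltr_pdivrMr ?mulr_gt0// => H.
have : 0 < e * (1 - y) by rewrite mulr_gt0//; lra.
lra.
Qed.

(** The symmetry that exchanges the two ends. *)
Lemma mobiusN q y : 0 < q -> -1 < y < 1 -> mobius q y = - mobius q^-1 (- y).
Proof.
move=> q0 /andP[y1 y2]; rewrite /mobius.
have d0 : 0 < (1 + y) * q + (1 - y) by rewrite addr_gt0 ?mulr_gt0//; lra.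
have d1 : 0 < (1 - y) + q * (1 + y) by rewrite addr_gt0 ?mulr_gt0//; lra.
by field; rewrite (gt_eqF q0) opprK [_ * q]mulrC (gt_eqF d1).
Qed.

Lemma mobius_nearN1 y e : -1 < y < 1 -> 0 < e ->
  exists2 A : R, 0 < A & forall q, 0 < q -> q <= A -> `|mobius q y + 1| < e.
Proof.
move=> y1 e0; have y2 : -1 < - y < 1 by move: y1 => /andP[? ?]; apply/andP; split; lra.
have [A A0 HA] := mobius_near1 y2 e0.
exists A^-1; first by rewrite invr_gt0.
move=> q q0 qA; rewrite mobiusN// -normrN opprD opprK; apply: HA.
by rewrite -(invrK A) lef_pV2 ?posrE ?invr_gt0.
Qed.

Lemma circle_near e : 0 < e ->
  \forall u \near +oo, `|circle_cos u - 1| < e /\ `|circle_sin u - 0| < e.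
Proof.
move=> e0; near=> u.
have u1 : 1 + 2 / e <= u by near: u; exact: near_pinfty_ge.
have e2 : 0 < 2 / e by rewrite divr_gt0.
have u0 : 0 < u by lra.
have d0 : 0 < u ^+ 2 + 1 by rewrite ltr_wpDl ?sqr_ge0.
have ue : 2 < e * u.
  have : 2 / e < u by lra.
  by rewrite ltr_pdivrMr// mulrC.
have uu : 2 * u < e * (u ^+ 2 + 1).
  have : 2 * u < e * u * u by rewrite ltr_pM2r.
  by lra.
split.
  have -> : circle_cos u - 1 = - (2 / (u ^+ 2 + 1)).
    by rewrite /circle_cos; field; rewrite gt_eqF.
  rewrite normrN gtr0_norm ?divr_gt0// ltr_pdivrMr//.
  by apply: le_lt_trans uu; lra.
rewrite subr0 /circle_sin gtr0_norm ?divr_gt0 ?mulr_gt0// ltr_pdivrMr//.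
Unshelve. all: by end_near. Qed.

Local Notation X := (annulus R).

Definition pole_up : X := annulus_param (0 : R, 1 : R).
Definition pole_down : X := annulus_param (0 : R, -1 : R).

Lemma pole_upE : annulus_val pole_up = (1, 0, 1).
Proof.
transitivity (annulus_coord (0 : R, 1 : R)); first by [].
by rewrite /annulus_coord /= mulr0 cos0 sin0 minxx max_r// (le_trans (lerN10 _)).
Qed.

Lemma pole_downE : annulus_val pole_down = (1, 0, -1).
Proof.
transitivity (annulus_coord (0 : R, -1 : R)); first by [].
by rewrite /annulus_coord /= mulr0 cos0 sin0 min_r ?maxxx// (le_trans (lerN10 _)).
Qed.

(** The excluded points lie on the fixed line or on the boundary circles, where
    the height does not move. *)
Definition wandering : set X :=
  [set x | (annulus_val x).1.1 != 1 /\ -1 < (annulus_val x).2 < 1].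

(** The coordinate of the circle goes to infinity with the clock. The sine of
    the phase being at least [s], that of the square of the clock is at least
    [s / 2] after some time, so that [swing] is arbitrarily large; the other sign is
    similar. *)
Lemma flow_switching (x : X) : wandering x ->
  switching_orbit (flow ^~ x) pole_up pole_down.
Proof.
move=> [a1 y1] s s0 U V /nbhs_chordal[e1 e10 HU] /nbhs_chordal[e2 e20 HV].
pose u := half_cot (annulus_val x); pose y := (annulus_val x).2.
have flowE t : annulus_val (flow t x) =
    (circle_cos (clock t u), circle_sin (clock t u),
     mobius (expR (swing (clock t u) - swing u)) y).
  by rewrite flow_valE /flow_val (negbTE a1).
have [A A0 HA] := mobius_near1 y1 e10.
have [B B0 HB] := mobius_nearN1 y1 e20.
have s20 : 0 < s / 2 by rewrite divr_gt0.
have toclock (P : R -> Prop) : (\forall z \near +oo, P z) ->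
    \forall t \near +oo, P (clock t u).
  by move=> HP; exact: clock_pinfty HP.
have C1 := toclock _ (circle_near e10).
have C2 := toclock _ (circle_near e20).
have C3 := toclock _ (near_pinfty_ge (1 + `|ln A + swing u| / (s / 2))).
have C4 := toclock _ (near_pinfty_ge (1 + `|ln B + swing u| / (s / 2))).
have C5 := clock_phase u s20.
near=> t.
have p5 : `|clock t u ^+ 2 - phase t| <= s / 2 by near: t; exact: C5.
have := le_trans (sin_lipschitz _ _) p5; rewrite ler_norml => /andP[p6 p7].
split=> st.
  have [c1 c2] : `|circle_cos (clock t u) - 1| < e1 /\
    `|circle_sin (clock t u) - 0| < e1 by near: t; exact: C1.
  have c3 : 1 + `|ln A + swing u| / (s / 2) <= clock t u by near: t; exact: C3.
  have S : ln A + swing u <= swing (clock t u).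
    by apply: (swing_large s20 c3); lra.
  apply: HU; apply: (@chordal_lt _ 1 0 1); rewrite ?flowE//=; last exact: pole_upE.
  by apply: HA; rewrite -[leLHS](lnK A0) ler_expR; lra.
have [c1 c2] : `|circle_cos (clock t u) - 1| < e2 /\
  `|circle_sin (clock t u) - 0| < e2 by near: t; exact: C2.
have c4 : 1 + `|ln B + swing u| / (s / 2) <= clock t u by near: t; exact: C4.
have S : swing (clock t u) <= ln B + swing u.
  by apply: (swing_small s20 c4); lra.
apply: HV; apply: (@chordal_lt _ 1 0 (-1)); rewrite ?flowE//=; last exact: pole_downE.
rewrite opprK; apply: HB; first exact: expR_gt0.
by rewrite -[leRHS](lnK B0) ler_expR; lra.
Unshelve. all: by end_near. Qed.

End SwitchingFlow.

(** * Integrals of time averages *)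

Section IntegralPreliminaries.
Context {R : realType}.
Local Notation leb := (@lebesgue_measure R).

Import HBNNSimple.

(** [averaged_measure] is a set function without a measure structure, so that
    integrals against it are transported through their definition. *)
Lemma eq_set_function_integral {d} {X : measurableType d}
    (m1 m2 : set X -> \bar R) (f : X -> \bar R) :
  (forall E, measurable E -> m1 E = m2 E) ->
  (\int[m1]_x f x = \int[m2]_x f x)%E.
Proof.
move=> m12; rewrite /integral.
congr (ereal_sup _ - ereal_sup _)%E; apply/eq_imagel => h _.
  by apply: eq_fsbigr => r _; rewrite m12.
by apply: eq_fsbigr => r _; rewrite m12.
Qed.

Lemma bounded_integrable {d} {X : measurableType d}
    (m : probability X R) (f : X -> R) (M : R) :
  measurable_fun setT f -> (forall x, `|f x| <= M) ->
  m.-integrable setT (EFin \o f).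
Proof.
move=> mf fM; apply: measurable_bounded_integrable => //.
- exact: fin_num_fun_lty.
- by exists M; split; [exact: num_real|move=> x xM t _; exact: le_trans (ltW xM)].
Qed.

Lemma integral_fin_bounded {d} {X : measurableType d}
    (m : probability X R) (f : X -> R) (M : R) :
  measurable_fun setT f -> (forall x, `|f x| <= M) ->
  (\int[m]_x (f x)%:E = (\int[m]_x f x)%:E)%E.
Proof.
move=> mf fM; rewrite /Rintegral fineK//.
exact: integrable_fin_num (bounded_integrable m mf fM).
Qed.

(** The shift of [g] by its bound [M] reduces this to nonnegative functions. *)
Lemma Rintegral_uniform (T : R) (T0 : 0 < T) (g : R -> R) (M : R) :
  measurable_fun setT g -> (forall t, `|g t| <= M) ->
  (\int[uniform_prob T0]_t (g t)%:E =
   (T^-1 * \int[leb]_(t in `[0, T]) g t)%:E)%E.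
Proof.
move=> mg gM.
have M0 : 0 <= M by exact: le_trans (normr_ge0 (g 0)) (gM 0).
have mgM : measurable_fun setT (fun t => g t + M) by exact: measurable_funD.
have gMM t : `|g t + M| <= M + M.
  by rewrite (le_trans (ler_normD _ _))// lerD// ger0_norm.
have gM0 t : 0 <= g t + M by have := gM t; rewrite ler_norml => /andP[? _]; lra.
have ig := integrable_bounded_itv 0 T mg gM.
have igM := integrable_bounded_itv 0 T mgM gMM.
have iM : leb.-integrable `[0, T] (EFin \o (fun=> M)).
  exact: (@integrable_bounded_itv _ (fun=> M) `|M|).
have E1 : (\int[uniform_prob T0]_t (g t + M)%:E =
    (T^-1 * \int[leb]_(t in `[0, T]) (g t + M))%:E)%E.
  rewrite integral_uniform//; last exact/measurable_EFinP.
  rewrite subr0 EFinM /Rintegral fineK//.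
  exact: integrable_fin_num igM.
have -> : (\int[uniform_prob T0]_t (g t)%:E =
   \int[uniform_prob T0]_t ((g t + M)%:E - M%:E))%E.
  by apply: eq_integral => t _; rewrite -EFinB addrK.
have ic : (uniform_prob T0).-integrable setT (EFin \o (fun=> M)).
  exact: (@bounded_integrable _ _ (uniform_prob T0) (fun=> M) `|M|).
rewrite integralB//; last first.
  exact: (@bounded_integrable _ _ (uniform_prob T0) (fun t => g t + M) (M + M)).
rewrite E1 integral_cst//.
rewrite [X in (M%:E * X)%E](_ : _ = 1%E); last first.
  exact: (@probability_setT _ _ _ (uniform_prob T0)).
rewrite mule1 -EFinB; congr EFin.
rewrite RintegralD// (Rintegral_itv_cst _ (ltW T0)) subr0.
by field; rewrite gt_eqF.
Qed.

End IntegralPreliminaries.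

Section TimeAverages.
Context {R : realType} {d : measure_display} {X : topMeasurableType d}.
Variable phi : R -> X -> X.
Hypothesis mphi :
  measurable_fun setT (fun z : measurableTypeR R * X => phi z.1 z.2).
Local Notation leb := (@lebesgue_measure R).
Implicit Types (f : X -> R) (m : probability X R) (T M : R).

Let mflow (z : measurableTypeR R * X) := phi z.1 z.2.

Lemma measurable_orbit x : measurable_fun setT (fun t : R => phi t x).
Proof.
exact: (measurableT_comp (f := mflow) mphi
  (g := fun t : measurableTypeR R => (t, x))).
Qed.

Lemma measurable_obs f x : measurable_fun setT f ->
  measurable_fun setT (fun t : R => f (phi t x)).
Proof. by move=> mf; apply: measurableT_comp => //; exact: measurable_orbit. Qed.

Lemma time_average_bounded T f M x : 0 <= M -> measurable_fun setT f ->
  (forall y, `|f y| <= M) -> `|time_average phi T f x| <= M.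
Proof.
move=> M0 mf fM; rewrite /time_average.
have [T0|T0] := ltP 0 T.
  rewrite normrM ger0_norm ?invr_ge0 ?(ltW T0)// mulrC ler_pdivrMr//.
  have := @ler_Rintegral_itv R _ M 0 T (measurable_obs x mf) (fun=> fM _) (ltW T0).
  by rewrite subr0.
move: T0; rewrite le_eqVlt => /predU1P[->|T0].
  by rewrite invr0 mul0r normr0.
by rewrite set_itv_ge ?bnd_simp -?ltNge// Rintegral_set0 mulr0 normr0.
Qed.

Section Fubini.
Variables (f : X -> R) (M : R).
Hypotheses (mf : measurable_fun setT f) (fM : forall x, `|f x| <= M).

Let M0 : 0 <= M. Proof. exact: le_trans (normr_ge0 _) (fM point). Qed.

Let mfphi : measurable_fun setT (f \o mflow).
Proof. exact: measurableT_comp mf mphi. Qed.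

Variables (m : probability X R) (T : R) (T0 : 0 < T).

Let U : probability (measurableTypeR R) R := uniform_prob T0.

Let ifphi : (U \x m)%E.-integrable setT (EFin \o (f \o mflow)).
Proof.
exact: (@bounded_integrable _ _ _ (U \x m)%E (f \o mflow) M mfphi (fun=> fM _)).
Qed.

Let time_averageE x : (\int[U]_t (f (phi t x))%:E)%E = (time_average phi T f x)%:E.
Proof.
by rewrite (Rintegral_uniform T0 (measurable_obs x mf) (fun=> fM _)).
Qed.

Lemma measurable_time_average : measurable_fun setT (time_average phi T f).
Proof.
apply/measurable_EFinP.
rewrite (_ : EFin \o _ = fubini_G U (EFin \o (f \o mflow))).
  exact: (measurable_fubini_G ifphi).
by apply/funext => x; rewrite /fubini_G /= -time_averageE.
Qed.

(** The averaged measure is the image under the flow of the product of the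
    uniform law on [[0, T]] with [m]. *)
Lemma averaged_measureE E : measurable E ->
  averaged_measure phi m T E = pushforward (U \x m)%E mflow E.
Proof.
move=> mE; rewrite /averaged_measure /pushforward /= /product_measure1.
have mJ : measurable (mflow @^-1` E) by rewrite -[X in measurable X]setTI; exact: mphi.
rewrite /U integral_uniform//; last exact: measurable_fun_xsection.
rewrite subr0; congr (_ * _)%E; apply: eq_integral => t _ /=.
congr (m _); apply/seteqP; split=> x /=; by rewrite /xsection /= inE.
Qed.

(** Fubini's theorem: the average in time of the integrals is the integral of
    the averages along the orbits. *)
Lemma integral_averaged_measure :
  (\int[averaged_measure phi m T]_x (f x)%:E =
   (\int[m]_x time_average phi T f x)%:E)%E.
Proof.
rewrite (eq_set_function_integral _ averaged_measureE).
rewrite (integral_pushforward mphi (f := EFin \o f))//; last exact/measurable_EFinP.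
rewrite preimage_setT.
transitivity (\int[m]_x fubini_G U (EFin \o (f \o mflow)) x)%E.
  by rewrite integral21_prod_meas1.
rewrite -(@integral_fin_bounded _ _ _ m _ M).
- by apply: eq_integral => x _; rewrite /fubini_G /= -time_averageE.
- exact: measurable_time_average.
- by move=> x; exact: time_average_bounded.
Qed.

End Fubini.

End TimeAverages.

(** * The half sum of two Dirac masses *)

Section TwoPointMeasure.
Context {R : realType} {d : measure_display} {X : measurableType d}.
Variables p q : X.

Definition two_points (b : bool) : X := if b then p else q.

Lemma measurable_two_points : measurable_fun setT two_points.
Proof. by []. Qed.

HB.instance Definition _ :=
  isMeasurableFun.Build _ _ _ _ two_points measurable_two_points.

Definition two_point_measure : probability X R :=
  distribution (bernoulli_prob (2^-1 : R)) two_points.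

Lemma half_itv : 0 <= (2^-1 : R) <= 1.
Proof. by rewrite invr_ge0 ler0n invf_le1// ler1n. Qed.

Lemma bernoulli_halfT : bernoulli_prob (2^-1 : R) [set true] = 2^-1%:E.
Proof. by rewrite /bernoulli_prob half_itv fsbig_set1. Qed.

Lemma integral_two_point (f : X -> R) (M : R) : measurable_fun setT f ->
  (forall x, `|f x| <= M) ->
  \int[two_point_measure]_x f x = (f p + f q) / 2.
Proof.
move=> mf fM.
have E b : (f \o two_points) b = f q + (f p - f q) * \1_[set true] b.
  rewrite indicE; case: b.
    by rewrite mem_set//= mulr1 addrC subrK.
  by rewrite memNset//= mulr0 addr0.
have i1 : (bernoulli_prob (2^-1 : R)).-integrable setT
    (EFin \o (\1_[set true] : bool -> R)).
  apply: (@bounded_integrable _ _ _ (bernoulli_prob (2^-1 : R)) _ 1) => //.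
  by move=> b; rewrite indicE; case: (_ \in _); rewrite ?normr1 ?normr0.
rewrite /Rintegral integral_distribution; last 2 first.
- exact/measurable_EFinP.
- apply: (@bounded_integrable _ _ _ (bernoulli_prob (2^-1 : R)) (f \o two_points) M) => //.
  by move=> b; exact: fM.
transitivity (\int[bernoulli_prob (2^-1 : R)]_b
   (f q + (f p - f q) * \1_[set true] b)).
  by congr fine; apply: eq_integral => b _; rewrite -E.
rewrite RintegralD//.
- rewrite Rintegral_cst// RintegralZl//.
  rewrite [X in fine X](_ : _ = 1%E) /=; last first.
    exact: (@probability_setT _ _ _ (bernoulli_prob (2^-1 : R))).
  rewrite /Rintegral integral_indic// setIT.
  rewrite [X in fine X](_ : _ = (2^-1)%:E) /=; last exact: bernoulli_halfT.
  by field.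
- exact: (@bounded_integrable _ _ _ (bernoulli_prob (2^-1 : R)) (fun=> f q) `|f q|).
- apply: (@bounded_integrable _ _ _ (bernoulli_prob (2^-1 : R)) _ (`|f p - f q|)) => //.
  move=> b; rewrite normrM ler_piMr// indicE.
  by case: (_ \in _); rewrite ?normr1 ?normr0.
Qed.

Lemma two_point_measureE (E : set X) : two_point_measure E =
  ((2^-1)%:E * (\1_E p)%:E + (2^-1)%:E * (\1_E q)%:E)%E.
Proof.
have Q : 1 - 2^-1 = 2^-1 :> R by field.
rewrite /two_point_measure /distribution /pushforward /=.
have half0 : 0 <= (2^-1 : R) by rewrite invr_ge0.
have half1 : (NngNum half0)%:num <= 1 by rewrite /= invf_le1// ler1n.
rewrite (bernoulli_dirac half1) measure_addE.
transitivity ((2^-1 : R)%:E * \d_true (two_points @^-1` E) +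
  (1 - 2^-1 : R)%:E * \d_false (two_points @^-1` E))%E; first by [].
rewrite Q !diracE !indicE; congr (_ * _ + _ * _)%E.
Qed.

End TwoPointMeasure.

(** * Systems whose orbits switch between two points *)

Section SwitchingSystem.
Context {R : realType} {d : measure_display} {X : topMeasurableType d}.
Variables (mu : probability X R) (phi : R -> X -> X) (p q : X) (B : set X).
Hypothesis open_measurable : forall U : set X, open U -> measurable U.
Hypothesis compactX : compact [set: X].
Hypothesis mphi :
  measurable_fun setT (fun z : measurableTypeR R * X => phi z.1 z.2).
Hypothesis mB : measurable B.
Hypothesis muB : mu B = 1%E.
Hypothesis switchB : forall x, B x -> switching_orbit (phi ^~ x) p q.
Local Notation leb := (@lebesgue_measure R).
Implicit Types (f : X -> R) (T e : R).

Let nu := two_point_measure (R := R) p q.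

Lemma continuous_measurable f : continuous f -> measurable_fun setT f.
Proof.
move=> cf; apply: (measurability _ (RGenOpens.measurableE R)) => _ [_ [a [b ->]] <-].
rewrite setTI; apply: open_measurable.
by apply: open_comp.
Qed.

Lemma continuous_bounded f : continuous f -> exists M, forall x, `|f x| <= M.
Proof.
move=> cf.
have [||x _ xmax] := @compact_EVT_max X R (fun x => `|f x|) setT _ compactX.
- by exists p.
- by apply: continuous_subspaceT => x; apply: cvg_norm; exact: cf.
- by exists `|f x| => y; apply: xmax; rewrite inE.
Qed.

Lemma Rintegral_nu f : continuous f -> \int[nu]_y f y = (f p + f q) / 2.
Proof.
move=> cf; have [M fM] := continuous_bounded cf.
exact: integral_two_point (continuous_measurable cf) fM.
Qed.

Lemma switching_attracted x : B x -> attracted phi nu x.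
Proof.
move=> Bx f cf; have [M fM] := continuous_bounded cf.
rewrite Rintegral_nu//; apply: (switching_average (M := M)) => //.
- exact: measurable_obs (continuous_measurable cf).
- exact: switching_orbit_comp (switchB Bx).
Qed.

Lemma switching_global_physical : global_physical mu phi nu.
Proof.
exists B; split=> //; split=> //; first by rewrite muB lte01.
by move=> x; exact: switching_attracted.
Qed.

(** Time averages converge on [B], which has full measure for [m] too by
    absolute continuity, and they are bounded: dominated convergence applies. *)
Lemma integral_time_average_cvg (m : probability X R) f : m `<< mu ->
  continuous f ->
  \int[m]_x time_average phi T f x @[T --> +oo] --> (f p + f q) / 2.
Proof.
move=> mmu cf; have [M fM] := continuous_bounded cf.
have mf := continuous_measurable cf.
have M0 : 0 <= M by exact: le_trans (normr_ge0 _) (fM p).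
have mB0 : m (~` B) = 0%E.
  move/null_content_dominatesP : mmu; apply; first exact: measurableC.
  by rewrite [LHS](probability_setC mu mB) muB subee.
(* Time averages are measurable for positive [T] only, while sequences that
   tend to infinity may have nonpositive terms. *)
pose S (T : R) := Num.max T 1.
have S0 T : 0 < S T by rewrite lt_max ltr01 orbT.
have eqS : \forall T \near +oo, \int[m]_x time_average phi (S T) f x =
    \int[m]_x time_average phi T f x.
  have := near_pinfty_ge (1 : R).
  by apply: filterS => T T1; rewrite /S max_l.
have cvgS (x : X) : B x ->
    time_average phi (S T) f x @[T --> +oo] --> (f p + f q) / 2.
  move=> Bx; rewrite -Rintegral_nu//.
  have := switching_attracted Bx cf.
  apply: cvg_trans; apply: near_eq_cvg.
  have := near_pinfty_ge (1 : R).
  by apply: filterS => T T1; rewrite /S max_l.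
apply: cvg_trans (near_eq_cvg eqS) _.
apply/cvg_pinftyP => u uoo.
pose c := (f p + f q) / 2.
have cE : c = \int[m]_x c.
  rewrite Rintegral_cst// [X in fine X](_ : _ = 1%E) ?mulr1//.
  exact: probability_setT.
have mavg n : measurable_fun setT (fun x => (time_average phi (S (u n)) f x)%:E).
  apply/measurable_EFinP.
  exact: (measurable_time_average mphi mf fM m (S0 (u n))).
have bavg n x : `|time_average phi (S (u n)) f x| <= M.
  exact: time_average_bounded.
have [|||_ _] := @dominated_convergence _ _ R m setT measurableT
  (fun n x => (time_average phi (S (u n)) f x)%:E) (fun=> c%:E) (fun=> M%:E)
  mavg (measurable_cst _) _ _ _.
- exists (~` B); split=> //; first exact: measurableC.
  move=> x /= Hx Bx; apply: Hx => _; apply: cvg_EFin; first exact: nearW.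
  by have /cvg_pinftyP := cvgS x Bx; apply.
- exact: (@bounded_integrable _ _ _ m (fun=> M) `|M|).
- by apply/aeW => x n _; rewrite /= lee_fin.
have Efin n : (\int[m]_x (time_average phi (S (u n)) f x)%:E =
   (\int[m]_x time_average phi (S (u n)) f x)%:E)%E.
  apply: (@integral_fin_bounded _ _ _ m _ M) => //.
  exact: (measurable_time_average mphi mf fM m (S0 (u n))).
have cI : (\int[m]_x c%:E = c%:E)%E.
  by rewrite (@integral_fin_bounded _ _ _ m (fun=> c) `|c|)// -cE.
rewrite cI => H.
have : (\int[m]_x time_average phi (S (u n)) f x)%:E @[n --> \oo] --> c%:E.
  by apply: cvg_trans H; apply: near_eq_cvg; apply: nearW => n; rewrite /= -Efin.
by move/fine_cvgP => [].
Qed.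

Lemma switching_global_natural : global_natural mu phi nu.
Proof.
split=> [|m mmu _ f cf]; first exact: openT.
have [M fM] := continuous_bounded cf; have mf := continuous_measurable cf.
rewrite (@integral_fin_bounded _ _ _ nu f M)// Rintegral_nu//.
have : (\int[m]_x time_average phi T f x)%:E @[T --> +oo] -->
    ((f p + f q) / 2)%:E.
  apply: cvg_EFin; first exact: nearW.
  exact: integral_time_average_cvg.
apply: cvg_trans; apply: near_eq_cvg.
have := near_pinfty_ge (1 : R).
apply: filterS => T T1; have T0 : 0 < T by exact: lt_le_trans T1.
by rewrite (integral_averaged_measure mphi mf fM m T0).
Qed.

Lemma measurable_superlevel (g : X -> R) e : measurable_fun setT g ->
  measurable [set x | e <= g x].
Proof.
move=> mg; rewrite (_ : [set x | _] = setT `&` g @^-1` [set` `[e, +oo[]).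
  exact: mg.
by apply/seteqP; split=> x /=; rewrite in_itv/= andbT // => -[].
Qed.

(** Turns the convergence of the integrals of time averages into convergence in
    measure. *)
Lemma markov_time_average f T e : 0 < T -> 0 < e -> continuous f ->
  (forall x, 0 <= f x <= 1) ->
  (mu [set x | (e <= time_average phi T f x)%R] <=
   (e^-1 * \int[mu]_x time_average phi T f x)%:E)%E.
Proof.
move=> T0 e0 cf f01; have mf := continuous_measurable cf.
have fM x : `|f x| <= 1 by have /andP[? ?] := f01 x; rewrite ger0_norm.
have mg := measurable_time_average mphi mf fM mu T0.
have g0 x : 0 <= time_average phi T f x.
  rewrite mulr_ge0 ?invr_ge0 ?(ltW T0)//; apply: Rintegral_ge0 => t _.
  by case/andP: (f01 (phi t x)).
have mA : measurable [set x | e <= time_average phi T f x].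
  exact: measurable_superlevel.
rewrite EFinM -(@integral_fin_bounded _ _ _ mu _ 1)//; last first.
  by move=> x; exact: time_average_bounded.
rewrite lee_pdivlMl//.
rewrite -[X in mu X]setIT -integral_indic// -ge0_integralZl//; last 2 first.
- exact/measurable_EFinP/measurable_indic.
- by rewrite lee_fin ltW.
apply: ge0_le_integral => //.
- by move=> x _; rewrite mule_ge0// lee_fin// ltW.
- by apply/measurable_EFinP/measurable_funM => //; exact: measurable_indic.
- exact/measurable_EFinP.
- move=> x _; rewrite -EFinM lee_fin indicE.
  case: (boolP (x \in _)) => [|_]; rewrite ?mulr0// inE mulr1.
  by [].
Qed.

Lemma le_time_average (g h : X -> R) T x : 0 < T ->
  measurable_fun setT g -> measurable_fun setT h ->
  (forall y, 0 <= g y) -> (forall y, g y <= h y) -> (forall y, h y <= 1) ->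
  time_average phi T g x <= time_average phi T h x.
Proof.
move=> T0 mg mh g0 gh h1; rewrite ler_wpM2l ?invr_ge0 ?(ltW T0)//.
apply: le_Rintegral => //; apply: (@integrable_bounded_itv _ _ 1).
- exact: (measurable_obs mphi x mg).
- by move=> t; rewrite ger0_norm// (le_trans (gh _)).
- exact: (measurable_obs mphi x mh).
- by move=> t; rewrite ger0_norm ?h1// (le_trans (g0 _) (gh _)).
Qed.

Lemma le_time_average_indic f (U : set X) T x : 0 < T -> open U ->
  continuous f -> (forall y, \1_U y <= f y <= 1) ->
  `|time_average phi T \1_U x| <= time_average phi T f x.
Proof.
move=> T0 oU cf Uf.
have mU : measurable_fun setT (\1_U : X -> R).
  by apply: measurable_indic; exact: open_measurable.
rewrite ger0_norm; last first.
  rewrite mulr_ge0 ?invr_ge0 ?(ltW T0)//; apply: Rintegral_ge0 => t _.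
  by rewrite indicE ler0n.
apply: le_time_average => //; first exact: continuous_measurable.
- by move=> y; case/andP: (Uf y).
- by move=> y; case/andP: (Uf y).
Qed.

(** All that the minimal attractor requires of a distance [rho]: continuous
    cut-off functions separate points from each other and from the complements
    of their neighbourhoods. *)
Variable rho : X -> X -> R.
Hypothesis crho : forall x, continuous (rho x).
Hypothesis rho_ge0 : forall x y, 0 <= rho x y.
Hypothesis rhoxx : forall x, rho x x = 0.
Hypothesis rho_eq0 : forall x y, rho x y = 0 -> x = y.
Hypothesis nbhs_rho : forall x (U : set X), nbhs x U ->
  exists2 e : R, 0 < e & forall y, rho x y < e -> U y.

(** A ball around [z] that avoids [p] and [q] is dominated by a continuous
    function that vanishes at both; the integrals of its time averages tend to
    [0], and Markov's inequality applies. *)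
Lemma Amin_subset z : Amin mu phi z -> z = p \/ z = q.
Proof.
move=> Az; apply: contrapT => /not_orP[zp zq]; apply: Az.
have zp0 : 0 < rho z p by rewrite lt_def rho_ge0 andbT; apply: contra_notN zp => /eqP/rho_eq0.
have zq0 : 0 < rho z q by rewrite lt_def rho_ge0 andbT; apply: contra_notN zq => /eqP/rho_eq0.
pose r := Num.min (rho z p) (rho z q) / 2.
have r0 : 0 < r by rewrite divr_gt0// lt_min zp0.
pose U := [set y | rho z y < r].
have oU : open U.
  rewrite (_ : U = rho z @^-1` [set s | s < r])//.
  by apply: open_comp => [y _|]; [exact: crho|exact: open_lt].
(* Equals [1] on the ball of radius [r], and [0] off that of radius [2 * r]. *)
pose f y := Num.min 1 (Num.max 0 (2 - rho z y / r)).
have cf : continuous f.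
  move=> y; apply: (@continuous_min _ _ (fun=> 1)
    (fun y => Num.max 0 (2 - rho z y / r)) y); first exact: cvg_cst.
  apply: (@continuous_max _ _ (fun=> 0) (fun y => 2 - rho z y / r) y).
    exact: cvg_cst.
  by apply: cvgB; [exact: cvg_cst|apply: cvgM; [exact: crho|exact: cvg_cst]].
have f01 y : 0 <= f y <= 1.
  by rewrite /f ge_min lexx andbT le_min ler01 le_max lexx.
have f0 w : r * 2 <= rho z w -> f w = 0.
  move=> rw; have : 2 <= rho z w / r by rewrite ler_pdivlMr// mulrC.
  by move=> H; rewrite /f max_l ?min_r// subr_le0.
have fp : f p = 0 by apply: f0; rewrite /r divfK// ge_min lexx.
have fq : f q = 0 by apply: f0; rewrite /r divfK// ge_min lexx orbT.
have Uf y : \1_U y <= f y <= 1.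
  have /andP[y0 ->] := f01 y; rewrite andbT indicE.
  case: (boolP (y \in U)) => [|_]; last exact: y0.
  rewrite inE => Uy; rewrite mulr1n /f le_min lexx le_max; apply/orP; right.
  have : rho z y / r < 1 by rewrite ltr_pdivrMr// mul1r.
  by lra.
exists U; last by rewrite /U /= rhoxx.
split=> // e e0.
have : (e^-1 * \int[mu]_x time_average phi T f x)%:E @[T --> +oo] -->
    (e^-1 * ((f p + f q) / 2))%:E.
  apply: cvg_EFin; first exact: nearW.
  apply: cvgM; first exact: cvg_cst.
  exact: integral_time_average_cvg.
rewrite fp fq addr0 mul0r mulr0.
apply: (squeeze_cvge _ (cvg_cst _)).
have := near_pinfty_ge (1 : R).
apply: filterS => T T1; have T0 : 0 < T by exact: lt_le_trans T1.
rewrite measure_ge0 /=.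
apply: le_trans (markov_time_average T0 e0 cf f01).
apply: le_measure; rewrite ?inE.
- apply: measurable_superlevel; apply: measurableT_comp => //.
  apply: (measurable_time_average mphi (f := \1_U) (M := 1) _ _ mu T0).
    by apply: measurable_indic; exact: open_measurable.
  by move=> y; rewrite indicE; case: (_ \in _); rewrite ?normr1 ?normr0.
- apply: measurable_superlevel.
  apply: (measurable_time_average mphi (M := 1) _ _ mu T0).
    exact: continuous_measurable.
  by move=> y; case/andP: (f01 y) => ? ?; rewrite ger0_norm.
- by move=> x /= ex; apply: (le_trans ex); exact: le_time_average_indic.
Qed.

(** A continuous function below the indicator of [U] with value [1] at the pole
    [c] has time averages whose integrals tend to at least [1 / 2]. If [U] were
    inessential, those integrals would end up below [1 / 8 + 1 / 8]. *)
Lemma pole_Amin c : c = p \/ c = q -> Amin mu phi c.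
Proof.
have arith (a b i : R) :
    1 / 2 <= a -> b < 1 / 8 -> a - i < 1 / 8 -> i <= 1 / 8 + b -> False by lra.
move=> cpq [U [oU Uin] Uc].
have [r r0 rU] := nbhs_rho (open_nbhs_nbhs (conj oU Uc)).
(* Equals [1] at [c], and [0] off the ball of radius [r], which lies in [U]. *)
pose f y := Num.max 0 (1 - rho c y / r).
have cf : continuous f.
  move=> y; apply: (@continuous_max _ _ (fun=> 0) (fun y => 1 - rho c y / r) y).
    exact: cvg_cst.
  by apply: cvgB; [exact: cvg_cst|apply: cvgM; [exact: crho|exact: cvg_cst]].
have f01 y : 0 <= f y <= 1.
  rewrite /f le_max lexx ge_max ler01 gerBl divr_ge0 ?rho_ge0//.
  exact: ltW.
have fU y : f y <= \1_U y.
  rewrite indicE; have [yr|yr] := ltP (rho c y) r.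
    rewrite mem_set; last exact: rU.
    by rewrite mulr1n; case/andP: (f01 y).
  by rewrite /f max_l ?ler0n// subr_le0 ler_pdivlMr// mul1r.
have fc : 1 / 2 <= (f p + f q) / 2.
  have f0 y : 0 <= f y by case/andP: (f01 y).
  have : f c = 1 by rewrite /f rhoxx mul0r subr0 max_r.
  by have := f0 p; have := f0 q; case: cpq => <- ? ? ->; lra.
have mU : measurable_fun setT (\1_U : X -> R).
  by apply: measurable_indic; exact: open_measurable.
have mf := continuous_measurable cf.
have U1 y : `|\1_U y| <= 1 :> R.
  by rewrite indicE; case: (_ \in _); rewrite ?normr1 ?normr0.
have f1 y : `|f y| <= 1 by case/andP: (f01 y) => ? ?; rewrite ger0_norm.
have e0 : 0 < 1 / 8 :> R by lra.
have mumu : mu `<< mu by [].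
have /fine_cvgP[Ufin /cvgrPdist_lt/(_ _ e0) US] := Uin _ e0.
have /cvgrPdist_lt/(_ _ e0) FS := integral_time_average_cvg mumu cf.
suff : \forall T \near (+oo : set_system R), False by move=> /filter_ex[].
near=> T.
have T0 : 0 < T by near: T; apply: nbhs_pinfty_gt; exact: num_real.
have UT : mu [set x | 1 / 8 <= `|time_average phi T \1_U x|] \is a fin_num.
  by near: T; exact: Ufin.
have US' : `|0 - fine (mu [set x | 1 / 8 <= `|time_average phi T \1_U x|])| < 1 / 8.
  by near: T; exact: US.
have FS' : `|(f p + f q) / 2 - \int[mu]_x time_average phi T f x| < 1 / 8.
  by near: T; exact: FS.
pose A := [set x | 1 / 8 <= `|time_average phi T \1_U x|].
have mtU := measurable_time_average mphi mU U1 mu T0.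
have mtf := measurable_time_average mphi mf f1 mu T0.
have mA : measurable A by apply: measurable_superlevel; exact: measurableT_comp.
have le x : time_average phi T f x <= 1 / 8 + \1_A x.
  have tfU : time_average phi T f x <= time_average phi T \1_U x.
    apply: (le_time_average x T0 mf mU _ fU) => y.
      by have /andP[] := f01 y.
    exact: le_trans (ler_norm _) (U1 y).
  have t1 : time_average phi T f x <= 1.
    exact: le_trans (ler_norm _) (time_average_bounded mphi T x ler01 mf f1).
  rewrite indicE; case: (boolP (x \in A)) => [_|]; first by rewrite mulr1n; lra.
  rewrite notin_setE /A /= => /negP; rewrite -ltNge mulr0n addr0 => tU.
  by apply: (le_trans tfU); apply: (le_trans (ler_norm _)); exact: ltW.
have mA1 : measurable_fun setT (\1_A : X -> R) by exact: measurable_indic.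
have A1 y : `|\1_A y| <= 1 :> R.
  by rewrite indicE; case: (_ \in _); rewrite ?normr1 ?normr0.
have i1 : mu.-integrable setT (EFin \o (fun=> 1 / 8)).
  exact: (@bounded_integrable _ _ _ mu (fun=> 1 / 8) `|1 / 8|).
have iA := bounded_integrable mu mA1 A1.
have itf : mu.-integrable setT (EFin \o time_average phi T f).
  apply: (@bounded_integrable _ _ _ mu _ 1) => // x.
  exact: time_average_bounded.
have : \int[mu]_x time_average phi T f x <= 1 / 8 + fine (mu A).
  apply: (@le_trans _ _ (\int[mu]_x (1 / 8 + \1_A x))).
    apply: le_Rintegral => //.
    apply: (@bounded_integrable _ _ _ mu _ (1 / 8 + 1)).
      exact: measurable_funD.
    move=> x; rewrite (le_trans (ler_normD _ _))// lerD//.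
    by rewrite ger0_norm//; lra.
  rewrite RintegralD// Rintegral_cst//.
  rewrite [X in fine X](_ : _ = 1%E); last exact: probability_setT.
  by rewrite mulr1 /Rintegral integral_indic// setIT.
move: US' FS'; rewrite sub0r normrN -/A.
have mA0 : 0 <= fine (mu A) by rewrite fine_ge0.
rewrite ger0_norm// ltr_norml => mA8 /andP[_ fI] If.
exact: arith fc mA8 fI If.
Unshelve. all: by end_near. Qed.

Lemma AminE : Amin mu phi = [set p; q].
Proof.
by apply/seteqP; split=> z; [exact: Amin_subset|exact: pole_Amin].
Qed.

End SwitchingSystem.

(** * Borel sets of the annulus and of its square *)

Section CountableBase.
Context {R : realType}.

(** The sigma-algebra enters as a mere family of sets, because the same carrier
    bears unrelated topological and measurable structures. *)
Definition countable_base {T : topologicalType} (M : set (set T)) :=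
  exists (I : countType) (b : I -> set T), (forall i, M (b i)) /\
    forall x (U : set T), nbhs x U -> exists2 i, b i x & b i `<=` U.

Lemma open_of_countable_base {T : topologicalType} (M : set (set T)) :
  countable_base M -> M set0 ->
  (forall (I : countType) (F : I -> set T), (forall i, M (F i)) ->
     M (\bigcup_i F i)) ->
  forall U : set T, open U -> M U.
Proof.
move=> [I [b [Mb Hb]]] M0 MU U oU.
pose F i := if `[< b i `<=` U >] then b i else set0.
have -> : U = \bigcup_i F i.
  apply/seteqP; split=> [x Ux|x [i _]]; last first.
    by rewrite /F; case: asboolP => // bU; exact: bU.
  have [i bx bU] := Hb x U (open_nbhs_nbhs (conj oU Ux)).
  by exists i => //; rewrite /F; case: asboolP.
by apply: MU => i; rewrite /F; case: asboolP.
Qed.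

Lemma countable_base_real : countable_base (@measurable _ (measurableTypeR R) : set (set R)).
Proof.
exists (rat * rat)%type, (fun i => [set` `]ratr i.1, ratr i.2[]); split=> [i|x U].
  exact: measurable_itv.
move=> /nbhs_ballP[e /= e0 eU].
have [r1 r1E] := @rat_in_itvoo R (x - e) x (ltac:(by rewrite gtrBl)).
have [r2 r2E] := @rat_in_itvoo R x (x + e) (ltac:(by rewrite ltrDl)).
move: r1E r2E; rewrite !in_itv/= => /andP[a1 a2] /andP[a3 a4].
exists (r1, r2); first by rewrite /= in_itv/= a2 a3.
move=> y; rewrite /= in_itv/= => /andP[y1 y2]; apply: eU.
rewrite /ball/= ltr_norml; apply/andP; split; lra.
Qed.

Lemma countable_base_prod {T1 T2 : topologicalType} (M1 : set (set T1))
    (M2 : set (set T2)) (M : set (set (T1 * T2))) :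
  (forall A B, M1 A -> M2 B -> M (A `*` B)) ->
  countable_base M1 -> countable_base M2 -> countable_base M.
Proof.
move=> MAB [I1 [b1 [Mb1 H1]]] [I2 [b2 [Mb2 H2]]].
exists (I1 * I2)%type, (fun i => b1 i.1 `*` b2 i.2); split=> [i|[x1 x2] U].
  exact: MAB.
move=> [[A B] /= [nA nB] ABU].
have [i1 b1x b1A] := H1 _ _ nA; have [i2 b2x b2B] := H2 _ _ nB.
exists (i1, i2) => //= -[y1 y2] [/= y1b y2b]; apply: ABU.
by split; [exact: b1A|exact: b2B].
Qed.

Lemma countable_base_preimage {S T : topologicalType} (f : S -> T)
    (M : set (set S)) (N : set (set T)) :
  (forall x (U : set S), nbhs x U -> exists2 V, nbhs (f x) V & f @^-1` V `<=` U) ->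
  (forall B, N B -> M (f @^-1` B)) ->
  countable_base N -> countable_base M.
Proof.
move=> fU NM [I [b [Nb H]]]; exists I, (fun i => f @^-1` b i); split=> [i|x U nU].
  exact: NM.
have [V nV VU] := fU _ _ nU; have [i bi biV] := H _ _ nV.
by exists i => // y biy; apply: VU; exact: biV.
Qed.

Lemma measurable_fun_of_open {d} {Y : measurableType d} (f : Y -> R) :
  (forall O : set R, open O -> measurable (f @^-1` O)) -> measurable_fun setT f.
Proof.
move=> H; apply: (measurability _ (RGenOpens.measurableE R)) => _ [_ [a [b ->]] <-].
by rewrite setTI; apply: H; exact: interval_open.
Qed.

End CountableBase.

Section AnnulusBorel.
Context {R : realType}.
Local Notation X := (annulus R).

Lemma measurable_annulus_val :
  measurable_fun setT (@annulus_val R : X -> R * R * R).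
Proof. by move=> _ B mB; exists B. Qed.

Lemma measurable_fun_annulus {d} {Y : measurableType d} (f : Y -> X) :
  measurable_fun setT (fun y => annulus_val (f y)) -> measurable_fun setT f.
Proof.
move=> mf _ _ [B mB <-]; rewrite !setTI.
by rewrite -[X in measurable X]setTI; exact: mf.
Qed.

Lemma countable_base_annulus : countable_base (@measurable _ X).
Proof.
apply: (@countable_base_preimage _ _ (@annulus_val R) _
  (@measurable _ (measurableTypeR R * measurableTypeR R * measurableTypeR R)%type)).
- move=> x U /nbhs_chordal[e e0 eU].
  exists (ball (annulus_val x) e); first exact: nbhsx_ballx.
  by move=> y xy; apply: eU; move: xy; rewrite /= -ball_normE.
- by move=> B mB; rewrite -[X in measurable X]setTI; exact: measurable_annulus_val.
- apply: countable_base_prod; [exact: measurableX| |exact: countable_base_real].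
  by apply: countable_base_prod; [exact: measurableX|exact: countable_base_real..].
Qed.

Lemma annulus_open_measurable (U : set X) : open U -> measurable U.
Proof.
apply: open_of_countable_base countable_base_annulus _ _ _; first exact: measurable0.
by move=> I F mF; exact: countable_bigcupT_measurable.
Qed.

Lemma annulus2_open_measurable (U : set (X * X)) : open U -> measurable U.
Proof.
apply: (@open_of_countable_base (X * X)%type measurable).
- apply: countable_base_prod countable_base_annulus countable_base_annulus.
  exact: measurableX.
- exact: measurable0.
- by move=> I F mF; exact: countable_bigcupT_measurable.
Qed.

Lemma continuous_flow : continuous (fun z : R * X => flow z.1 z.2).
Proof.
apply: continuous_comp_initial => -[t0 x0].
have [U [h [oU U0 hC hE]]] := @smooth_map_flow R t0 x0.
have ci : continuous (fun z : R * X => (z.1, annulus_val z.2)).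
  move=> z.
  have c2 : {for z, continuous (fun z : R * X => annulus_val z.2)}.
    by apply: continuous_comp; [exact: cvg_snd|exact: continuous_annulus_val].
  exact: cvg_pair cvg_fst c2.
have ch : {for (t0, annulus_val x0), continuous h} by exact: (hC 0%N).
have c := continuous_comp (ci (t0, x0)) ch.
suff : annulus_val (flow z.1 z.2) @[z --> (t0, x0)] -->
    annulus_val (flow t0 x0) by [].
rewrite -hE//.
apply: cvg_trans c; apply: near_eq_cvg.
have N : nbhs ((t0, x0) : R * X) [set z | U (z.1, annulus_val z.2)].
  exact: (ci (t0, x0) U (open_nbhs_nbhs (conj oU U0))).
by apply: filterS N => -[t x] /= Ux; rewrite hE.
Qed.

(** Continuity of the flow gives measurability for the product sigma-algebra
    because the open sets of [R * X] are countable unions of products. *)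
Lemma measurable_flow :
  measurable_fun setT (fun z : measurableTypeR R * X => flow z.1 z.2 : X).
Proof.
have oM (U : set (R * X)) : open U ->
    measurable (U : set (measurableTypeR R * X)).
  apply: (@open_of_countable_base (R * X)%type
    (@measurable _ (measurableTypeR R * X)%type)).
  - apply: countable_base_prod countable_base_real countable_base_annulus.
    exact: measurableX.
  - exact: measurable0.
  - by move=> I F mF; exact: countable_bigcupT_measurable.
have cf : continuous (fun z : R * X => annulus_val (flow z.1 z.2)).
  move=> z.
  exact: (continuous_comp (@continuous_flow z) (@continuous_annulus_val R _)).
have coord (g : R * R * R -> R) : continuous g -> measurable_fun setT
    (fun z : measurableTypeR R * X => g (annulus_val (flow z.1 z.2))).
  move=> cg; apply: measurable_fun_of_open => O oO.
  apply: oM; apply: (@open_comp _ _ (fun z : R * X => g (annulus_val (flow z.1 z.2)))) => //.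
  by move=> z _; apply: (continuous_comp (cf z)); exact: cg.
apply: measurable_fun_annulus.
pose v (z : measurableTypeR R * X) := annulus_val (flow z.1 z.2).
rewrite (_ : (fun _ => _) = fun z => ((v z).1.1, (v z).1.2, (v z).2)); last first.
  by apply/funext => z; rewrite /v; case: (annulus_val _) => [[]].
apply: measurable_fun_pair; first apply: measurable_fun_pair.
- apply: (coord (fun w => w.1.1)) => w.
  by apply: continuous_comp; exact: cvg_fst.
- apply: (coord (fun w => w.1.2)) => w.
  by apply: continuous_comp; [exact: cvg_fst|exact: cvg_snd].
- by apply: (coord (fun w => w.2)) => w; exact: cvg_snd.
Qed.

Lemma measurable_square_flow : measurable_fun setT
  (fun z : measurableTypeR R * (X * X) => square (@flow R) z.1 z.2 : X * X).
Proof.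
have aux (g : measurableTypeR R * (X * X) -> X) : measurable_fun setT g ->
    measurable_fun setT (fun z : measurableTypeR R * (X * X) => flow z.1 (g z)).
  move=> mg; apply: (measurableT_comp measurable_flow
    (g := fun z : measurableTypeR R * (X * X) => (z.1, g z))).
  exact: measurable_fun_pair.
apply: measurable_fun_pair; apply: aux.
  by apply: measurableT_comp => //.
by apply: measurableT_comp => //.
Qed.

Lemma continuous_annulus_param :
  continuous (fun z : R * R => annulus_param z : X).
Proof.
apply: continuous_comp_initial => z.
have c1 : {for z, continuous (fun z : R * R => 2 * pi * z.1)}.
  by apply: cvgM; [exact: cvg_cst|exact: cvg_fst].
have cc : {for z, continuous (fun z : R * R => cos (2 * pi * z.1))}.
  by apply: (continuous_comp c1); exact: continuous_cos.
have cs : {for z, continuous (fun z : R * R => sin (2 * pi * z.1))}.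
  by apply: (continuous_comp c1); exact: continuous_sin.
have ch : {for z, continuous (fun z : R * R => Num.max (-1) (Num.min 1 z.2))}.
  apply: (@continuous_max _ _ (fun=> -1) (fun z : R * R => Num.min 1 z.2) z).
    exact: cvg_cst.
  apply: (@continuous_min _ _ (fun=> 1) (fun z : R * R => z.2) z).
    exact: cvg_cst.
  exact: cvg_snd.
exact: cvg_pair (cvg_pair cc cs) ch.
Qed.

(** The angle is [acos a] or its opposite, the latter shifted by a full turn to
    be nonnegative. *)
Lemma circle_angle (a b : R) : a ^+ 2 + b ^+ 2 = 1 ->
  exists2 s : R, 0 <= s <= 1 & (cos (2 * pi * s), sin (2 * pi * s)) = (a, b).
Proof.
move=> ab; have a1 : -1 <= a <= 1.
  rewrite -ler_norml -(@ler_pXn2r _ 2)// ?nnegrE// expr1n real_normK ?num_real//.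
  by rewrite -ab lerDl sqr_ge0.
have p0 : 0 < pi :> R by exact: pi_gt0.
have p0' : pi != 0 :> R by rewrite gt_eqF.
have pp0 : 0 < 2 * pi :> R by rewrite mulr_gt0.
have s2 : sin (acos a) = `|b|.
  by rewrite sin_acos// -ab addrAC subrr add0r sqrtr_sqr.
have ca : cos (acos a) = a by rewrite acosK// in_itv/= a1.
have A0 := acos_ge0 a1; have A1 := acos_lepi a1.
have [b0|b0] := leP 0 b.
  exists (acos a / (2 * pi)).
    by apply/andP; split; [exact: divr_ge0 A0 (ltW pp0)|rewrite ler_pdivrMr//; lra].
  have -> : 2 * pi * (acos a / (2 * pi)) = acos a by rewrite mulrC divfK ?gt_eqF.
  by rewrite ca s2 ger0_norm.
exists (1 - acos a / (2 * pi)).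
  by rewrite subr_ge0 gerBl divr_ge0 ?(ltW pp0)// andbT ler_pdivrMr//; lra.
have -> : 2 * pi * (1 - acos a / (2 * pi)) = - acos a + pi *+ 2.
  by rewrite mulrBr mulr1 [X in _ - X]mulrC divfK ?gt_eqF// addrC mulr_natl.
by rewrite cosD2pi sinD2pi cosN sinN ca s2 ltr0_norm ?opprK.
Qed.

Lemma annulus_compact : compact [set: X].
Proof.
have -> : [set: X] = (fun z : R * R => annulus_param z : X) @`
    (`[0, 1]%classic `*` `[-1, 1]%classic).
  apply/seteqP; split=> // x _.
  have [ab y1] := annulus_valP x.
  have [s s01 sE] := circle_angle ab.
  exists (s, (annulus_val x).2); first by split; rewrite /= in_itv.
  apply: annulus_val_inj.
  transitivity (annulus_coord (s, (annulus_val x).2)); first by [].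
  rewrite /annulus_coord /=; case/andP: y1 => y1 y2.
  rewrite min_r// max_r//.
  by move: sE; case: (annulus_val x) => [[a b] y] /= [-> ->].
apply: continuous_compact.
  apply: continuous_subspaceT; exact: continuous_annulus_param.
by apply: compact_setX; exact: segment_compact.
Qed.

End AnnulusBorel.

(** * The measure of the basin *)

Section Basin.
Context {R : realType}.
Local Notation X := (annulus R).

Lemma uniform_prob_endpoints (a b : R) (ab : a < b) (A : set R) :
  measurable A -> (forall x, A x -> a <= x <= b -> x = a \/ x = b) ->
  uniform_prob ab A = 0%E.
Proof.
move=> mA H; rewrite /uniform_prob integral_uniform_pdf.
apply: null_set_integral; first exact: measurableI.
  apply: measurable_funTS; apply/measurable_EFinP; exact: measurable_uniform_pdf.
apply: countable_lebesgue_measure0.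
apply: (@sub_countable _ _ _ [set a; b]).
  apply: subset_card_le => x [Ax]; rewrite /= in_itv/= => axb.
  by have [->|->] := H x Ax axb; [left|right].
exact: finite_set_countable.
Qed.

Lemma cos2pi_eq1 (s : R) : cos (2 * pi * s) = 1 -> 0 <= s <= 1 -> s = 0 \/ s = 1.
Proof.
move=> c1 /andP[s0 s1].
move: s0; rewrite le_eqVlt => /predU1P[<-|s0]; first by left.
move: s1; rewrite le_eqVlt => /predU1P[->|s1]; first by right.
have p0 : 0 < pi :> R by exact: pi_gt0.
have : 0 < sin (pi * s).
  by apply: sin_gt0_pi; rewrite mulr_gt0//= -[ltRHS]mulr1 ltr_pM2l.
move: c1; rewrite -mulrA mulr_natl mulr2n cosD => c1 sp.
have := cos2Dsin2 (pi * s); have : 0 < sin (pi * s) * sin (pi * s) by rewrite mulr_gt0.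
by rewrite !expr2; lra.
Qed.

Lemma wandering_open : open (@wandering R).
Proof.
have cv (g : R * R * R -> R) : continuous g ->
    continuous (fun x : X => g (annulus_val x)).
  by move=> cg x; apply: (continuous_comp (@continuous_annulus_val R x)); exact: cg.
have c1 : continuous (fun x : X => (annulus_val x).1.1).
  by apply: (cv (fun w => w.1.1)) => w; apply: continuous_comp; exact: cvg_fst.
have c2 : continuous (fun x : X => (annulus_val x).2).
  by apply: (cv (fun w => w.2)) => w; exact: cvg_snd.
rewrite (_ : @wandering R = [set x : X | (annulus_val x).1.1 != 1] `&`
  [set x : X | (annulus_val x).2 \in `]-1, 1[]); last first.
  by apply/seteqP; split=> x /=; rewrite in_itv.
apply: openI.
  by apply: (@open_comp _ _ (fun x : X => (annulus_val x).1.1) [set r : R | r != 1]);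
    [move=> x _; exact: c1|exact: open_neq].
by apply: (@open_comp _ _ (fun x : X => (annulus_val x).2) [set` `]-1, 1[]);
  [move=> x _; exact: c2|exact: interval_open].
Qed.

Lemma measurable_wandering : measurable (@wandering R).
Proof. by apply: annulus_open_measurable; exact: wandering_open. Qed.

(** In the parameters [(s, y)] the complement consists of the two sides [s = 0]
    and [s = 1] and of the two sides [y = -1] and [y = 1] of the rectangle. *)
Lemma annulus_measure_wandering : annulus_measure R (@wandering R) = 1%E.
Proof.
pose P := ((uniform_prob (@ltr01 R) \x uniform_prob (ltrN11 R))%E).
pose N1 : set (measurableTypeR R) := [set s : R | cos (2 * pi * s) = 1].
pose N2 : set (measurableTypeR R) := [set y : R | y <= -1 \/ 1 <= y].
have mN1 : measurable N1.
  rewrite (_ : N1 = setT `&` (fun s : R => cos (2 * pi * s)) @^-1` [set 1]); last first.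
    by rewrite setTI.
  suff : measurable_fun setT (fun s : R => cos (2 * pi * s)) by apply.
  apply: continuous_measurable_fun => s.
  apply: (continuous_comp (f := fun s : R => 2 * pi * s)); last exact: continuous_cos.
  by apply: cvgM; [exact: cvg_cst|exact: cvg_id].
have mN2 : measurable N2.
  rewrite (_ : N2 = [set` `]-oo, -1]] `|` [set` `[1, +oo[]).
    by apply: measurableU; exact: measurable_itv.
  by apply/seteqP; split=> y /=; rewrite !in_itv/= andbT.
have E : @annulus_param R @^-1` (~` @wandering R) = (N1 `*` setT) `|` (setT `*` N2).
  have hE (y : R) : ~ (-1 < Num.max (-1) (Num.min 1 y) < 1) <-> N2 y.
    have [y1|] := boolP (y <= -1).
      have y2 : y <= 1 by apply: (le_trans y1); rewrite -subr_ge0 opprK.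
      rewrite min_r// max_l// ltxx; split=> // _; by left.
    rewrite -ltNge => y1; have [y2|] := boolP (1 <= y).
      rewrite min_l// max_r; last by rewrite -subr_ge0 opprK.
      by rewrite ltxx andbF; split=> // _; right.
    rewrite -ltNge => y2; rewrite min_r ?(ltW y2)// max_r ?(ltW y1)// y1 y2; split=> //.
    by case=> H; lra.
  apply/seteqP; split=> -[s y] /=.
    have [c1|c1] := eqVneq (cos (2 * pi * s)) 1; first by left.
    by move=> W; right; split=> //; apply/hE => y1; apply: W; split.
  by move=> [[c1 _]|[_ /hE Ny]] [/= a1 y1]; [rewrite c1 eqxx in a1|exact: Ny].
have P1 : P (N1 `*` setT) = 0%E.
  transitivity (uniform_prob (@ltr01 R) N1 * uniform_prob (ltrN11 R) setT)%E.
    exact: product_measure1E.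
  by rewrite (uniform_prob_endpoints (@ltr01 R) mN1) ?mul0e//; exact: cos2pi_eq1.
have P2 : P (setT `*` N2) = 0%E.
  transitivity (uniform_prob (@ltr01 R) setT * uniform_prob (ltrN11 R) N2)%E.
    exact: product_measure1E.
  rewrite (uniform_prob_endpoints (ltrN11 R) mN2) ?mule0//.
  move=> y [y1|y1] /andP[y2 y3]; [left|right]; apply/eqP; rewrite eq_le.
    by rewrite y1 y2.
  by rewrite y3 y1.
have W0 : annulus_measure R (~` @wandering R) = 0%E.
  transitivity (P (@annulus_param R @^-1` (~` @wandering R))); first by [].
  rewrite E; apply/eqP; rewrite -measure_le0.
  have mX1 : measurable (N1 `*` [set: measurableTypeR R]) by exact: measurableX.
  have mX2 : measurable ([set: measurableTypeR R] `*` N2) by exact: measurableX.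
  apply: le_trans (measureU2 _ mX1 mX2) _.
  by rewrite [X in (X + _ <= _)%E]P1 [X in (_ + X <= _)%E]P2 adde0.
have := probability_setC (annulus_measure R) measurable_wandering.
rewrite W0 => H.
have fin : annulus_measure R (@wandering R) \is a fin_num.
  by apply: fin_num_measure; exact: measurable_wandering.
by move/esym/eqP : H; rewrite sube_eq// ?fin_num_adde_defr// add0e => /eqP.
Qed.

Lemma annulus2_measure_wandering :
  annulus2_measure R (@wandering R `*` @wandering R) = 1%E.
Proof.
have mW := measurable_wandering.
transitivity (annulus_measure R (@wandering R) * annulus_measure R (@wandering R))%E.
  exact: product_measure1E.
by rewrite annulus_measure_wandering mule1.
Qed.

End Basin.

(** * The square of the flow *)

Section SquareMetric.
Context {R : realType}.
Local Notation X := (annulus R).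

Definition chordal2 (z w : X * X) : R :=
  Num.max (chordal z.1 w.1) (chordal z.2 w.2).

Lemma continuous_chordal2 z : continuous (chordal2 z).
Proof.
move=> w; apply: (@continuous_max _ _ (fun w => chordal z.1 w.1)
  (fun w => chordal z.2 w.2) w).
  by apply: (continuous_comp (f := fst)); [exact: cvg_fst|exact: continuous_chordal].
by apply: (continuous_comp (f := snd)); [exact: cvg_snd|exact: continuous_chordal].
Qed.

Lemma chordal2_ge0 z w : 0 <= chordal2 z w.
Proof. by rewrite le_max chordal_ge0. Qed.

Lemma chordal2xx z : chordal2 z z = 0.
Proof. by rewrite /chordal2 !chordalxx maxxx. Qed.

Lemma chordal2_eq0 z w : chordal2 z w = 0 -> z = w.
Proof.
case: z w => [z1 z2] [w1 w2] /eqP; rewrite eq_le => /andP[+ _].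
rewrite ge_max /= => /andP[H1 H2]; congr pair; apply: chordal_eq0; apply/eqP;
  by rewrite eq_le chordal_ge0 ?H1 ?H2.
Qed.

Lemma nbhs_chordal2 z (U : set (X * X)) : nbhs z U ->
  exists2 e : R, 0 < e & forall w, chordal2 z w < e -> U w.
Proof.
case: z => z1 z2 [[A B] /= [/nbhs_chordal[e1 e10 HA] /nbhs_chordal[e2 e20 HB]] ABU].
exists (Num.min e1 e2); first by rewrite lt_min e10.
move=> [w1 w2]; rewrite gt_max !lt_min /= => /andP[/andP[a1 _] /andP[_ b2]].
by apply: ABU; split; [exact: HA|exact: HB].
Qed.

Lemma annulus2_compact : compact [set: X * X].
Proof. by rewrite -setXTT; apply: compact_setX; exact: annulus_compact. Qed.

Lemma square_switching (z : X * X) : (@wandering R `*` @wandering R) z ->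
  switching_orbit (square (@flow R) ^~ z) (pole_up, pole_up) (pole_down, pole_down).
Proof.
by move=> [z1 z2]; apply: switching_orbit_pair; exact: flow_switching.
Qed.

Definition upper : set X := [set x | 0 < (annulus_val x).2].
Definition lower : set X := [set x | (annulus_val x).2 < 0].

Lemma open_upper : open upper.
Proof.
apply: (@open_comp _ _ (fun x : X => (annulus_val x).2) [set r : R | 0 < r]).
  move=> x _; apply: (continuous_comp (@continuous_annulus_val R x)).
  exact: cvg_snd.
exact: open_gt.
Qed.

Lemma open_lower : open lower.
Proof.
apply: (@open_comp _ _ (fun x : X => (annulus_val x).2) [set r : R | r < 0]).
  move=> x _; apply: (continuous_comp (@continuous_annulus_val R x)).
  exact: cvg_snd.
exact: open_lt.
Qed.

(** The left side is [0], since no pole has both a positive and a negative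
    height; the right side is [1 / 4]. *)
Lemma square_measure_neq_product :
  two_point_measure (R := R) (pole_up, pole_up : X) (pole_down, pole_down : X)
    (upper `*` lower) <>
  (two_point_measure (R := R) (pole_up : X) pole_down \x
   two_point_measure (R := R) (pole_up : X) pole_down)%E (upper `*` lower).
Proof.
have mU : measurable upper by apply: annulus_open_measurable; exact: open_upper.
have mL : measurable lower by apply: annulus_open_measurable; exact: open_lower.
have uU : (@pole_up R \in upper) = true.
  by apply: mem_set; suff : 0 < (annulus_val (@pole_up R)).2 by []; rewrite pole_upE.
have dU : (@pole_down R \in upper) = false.
  apply: memNset; suff : ~ 0 < (annulus_val (@pole_down R)).2 by [].
  rewrite pole_downE /=; lra.
have uL : (@pole_up R \in lower) = false.
  apply: memNset; suff : ~ (annulus_val (@pole_up R)).2 < 0 by [].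
  rewrite pole_upE /=; lra.
have dL : (@pole_down R \in lower) = true.
  apply: mem_set; suff : (annulus_val (@pole_down R)).2 < 0 by [].
  by rewrite pole_downE /= ltrN10.
rewrite two_point_measureE !indicE !in_setX /= uU dU uL dL /= !mule0 adde0.
have -> : (two_point_measure (R := R) (pole_up : X) pole_down \x
   two_point_measure (R := R) (pole_up : X) pole_down)%E (upper `*` lower) =
   (two_point_measure (R := R) (pole_up : X) pole_down upper *
    two_point_measure (R := R) (pole_up : X) pole_down lower)%E.
  exact: product_measure1E.
rewrite !two_point_measureE !indicE uU dU uL dL /= !mule0 adde0 add0e !mule1.
move/eqP; rewrite -EFinM eqe eq_sym mulf_eq0 invr_eq0 pnatr_eq0.
by [].
Qed.

End SquareMetric.

Theorem theorem22 (R : realType) :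
  exists (phi : R -> annulus R -> annulus R)
    (mu_phi : probability (annulus R) R)
    (mu_Phi : probability (annulus R * annulus R)%type R),
    let mu := annulus_measure R in
    let mu2 := annulus2_measure R in
    [/\ smooth_flow phi,
        global_physical mu phi mu_phi /\ global_natural mu phi mu_phi,
        global_physical mu2 (square phi) mu_Phi /\
          global_natural mu2 (square phi) mu_Phi,
        ~ (forall E : set (annulus R * annulus R), measurable E ->
             mu_Phi E = (mu_phi \x mu_phi)%E E) &
        Amin mu2 (square phi) `<` Amin mu phi `*` Amin mu phi].
Proof.
exists (@flow R), (two_point_measure pole_up pole_down),
  (two_point_measure (pole_up, pole_up) (pole_down, pole_down)).
move=> mu mu2.
have mW := @measurable_wandering R.
have mW2 : measurable (@wandering R `*` @wandering R) by exact: measurableX.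
have oM := @annulus_open_measurable R.
have oM2 := @annulus2_open_measurable R.
have cX := @annulus_compact R.
have cX2 := @annulus2_compact R.
have mF := @measurable_flow R.
have mF2 := @measurable_square_flow R.
have W1 := @annulus_measure_wandering R.
have W2 := @annulus2_measure_wandering R.
have sw := @flow_switching R.
have sw2 := @square_switching R.
split.
- exact: smooth_flow_flow.
- split; first exact: (switching_global_physical oM cX mF mW W1 sw).
  exact: (switching_global_natural oM cX mF mW W1 sw).
- split; first exact: (switching_global_physical oM2 cX2 mF2 mW2 W2 sw2).
  exact: (switching_global_natural oM2 cX2 mF2 mW2 W2 sw2).
- move=> H; apply: (@square_measure_neq_product R); apply: H.
  apply: measurableX.
    by apply: oM; exact: open_upper.
  by apply: oM; exact: open_lower.
have -> : Amin mu (@flow R) = [set pole_up; pole_down].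
  exact: (AminE oM cX mF mW W1 sw (@continuous_chordal R) (@chordal_ge0 R)
    (@chordalxx R) (@chordal_eq0 R) (@nbhs_chordal R)).
have -> : Amin mu2 (square (@flow R)) = [set (pole_up, pole_up); (pole_down, pole_down)].
  exact: (AminE oM2 cX2 mF2 mW2 W2 sw2 (@continuous_chordal2 R) (@chordal2_ge0 R)
    (@chordal2xx R) (@chordal2_eq0 R) (@nbhs_chordal2 R)).
have ud : @pole_up R <> pole_down.
  by move=> /(congr1 (fun x => (annulus_val x).2)); rewrite pole_upE pole_downE /=; lra.
split.
  by move=> [z1 z2] [] [-> ->]; split; [left|left|right|right].
move=> /(_ (pole_up, pole_down) (conj (or_introl erefl) (or_intror erefl))).
by case=> [/(congr1 snd)|/(congr1 fst)] e; apply: ud.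
Qed.
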